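(* Let $k\ge1$ be a fixed integer, let $\mu$ be the law of a real random variable $\xi$ with $\mathbb E\xi=0$, $\mathbb E\xi^2=1$ and $\mathbb E\exp(t_0\xi^2)<\infty$ for some $t_0>0$, and suppose $p=p_n$ satisfies $p/\log n\to\beta\in(0,\infty)$ as $n\to\infty$. Then: 1. $\Gamma_{k,\beta,\mu}$ is a totally bounded and convex set. 2. As $n\to\infty$, $d_{\mathrm H}\big(\mathcal C^{\mathrm{Wishart}}_{n,k},\Gamma_{k,\beta,\mu}\big)\to0$ in probability.
   Context: $X=X_n=(\xi_{ij})_{1\le i\le p,\,1\le j\le n}\in\mathbb R^{p\times n}$ has i.i.d. entries that are copies of $\xi$. For $S\subset[n]=\{1,\dots,n\}$ with $|S|=k$, $X_{[S]}\in\mathbb R^{p\times k}$ is the submatrix formed by the columns indexed by $S$ (in increasing order), and $$\mathcal C^{\mathrm{Wishart}}_{n,k}:=\Big\{\frac{X_{[S]}^\top X_{[S]}}{p}:\ S\subset[n],\ |S|=k\Big\}.$$ $\mathcal P_2(\mathbb R^k)$ is the set of Borel probability measures on $\mathbb R^k$ with finite second moment. For probability measures, $D(\nu\|\rho):=\int\log\frac{d\nu}{d\rho}\,d\nu$ if $\nu\ll\rho$ and $+\infty$ otherwise (KL divergence). For $\varnothing\ne U\subset[k]$, $\nu_U$ is the marginal of $\nu$ on the coordinates in $U$. Define $$\mathcal M_{k,\beta,\mu}:=\Big\{\nu\in\mathcal P_2(\mathbb R^k):\ D\big(\nu_U\,\big\|\,\mu^{\otimes|U|}\big)\le\frac{|U|}{\beta}\text{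 for all }\varnothing\ne U\subset[k]\Big\},$$ $$\Gamma_{k,\beta,\mu}:=\Big\{\int xx^\top\,d\nu(x):\ \nu\in\mathcal M_{k,\beta,\mu}\Big\}.$$ For nonempty subsets $P,Q$ of the space of real symmetric $k\times k$ matrices with the metric $d$ induced by the Frobenius norm, the Hausdorff distance is $$d_{\mathrm H}(P,Q):=\max\Big\{\sup_{x\in P}\inf_{y\in Q}d(x,y),\ \sup_{y\in Q}\inf_{x\in P}d(x,y)\Big\}.$$ *)

(* Defs.v *)
From HB Require Import structures.
From mathcomp Require Import all_boot all_order all_algebra.
From mathcomp Require Import all_classical all_reals all_analysis.
From mathcomp Require Import measurable_realfun.

Set Implicit Arguments.
Unset Strict Implicit.
Unset Printing Implicit Defensive.

Import Order.TTheory GRing.Theory Num.Theory.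
Import numFieldNormedType.Exports.

Local Open Scope classical_set_scope.
Local Open Scope ring_scope.

Section metric_notions.
Context {R : realType} {M : eqType} (dist : M -> M -> R).

Definition totally_bounded (A : set M) : Prop :=
  forall e : R, 0 < e -> exists s : seq M,
    [set` s] `<=` A /\ forall x, A x -> exists2 y, y \in s & dist x y < e.

(* Extended-real suprema and infima, so that no boundedness or nonemptiness
   is presupposed; the distance is finite for bounded nonempty sets. *)
Definition hausdorff_distance (A B : set M) : \bar R :=
  Order.max
    (ereal_sup [set ereal_inf [set (dist x y)%:E | y in B] | x in A])
    (ereal_sup [set ereal_inf [set (dist x y)%:E | x in A] | y in B]).

End metric_notions.

Definition frobenius_distance (R : realType) (k : nat) (A B : 'M[R]_k) : R :=
  Num.sqrt (\sum_i \sum_j (A i j - B i j) ^+ 2).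

Section probability_notions.
Local Open Scope ereal_scope.
Local Open Scope charge_scope.

(* The integral always makes sense: the negative part of the integrand is
   nu-integrable, since - x * ln x <= 1 for x > 0. *)
Definition KL_divergence (R : realType) (d : measure_display)
    (T : measurableType d) (nu rho : probability T R) : \bar R :=
  if `[< nu `<< rho >]
  then \int[nu]_x lne (('d (charge_of_finite_measure nu) '/d rho) x)
  else +oo.

Definition mutually_independent (R : realType) (d : measure_display)
    (T : measurableType d) (P : probability T R) (I : finType)
    (Y : I -> {RV P >-> R}) : Prop :=
  forall (J : {set I}) (B : I -> set R), (forall i, measurable (B i)) ->
    P (\bigcap_(i in [set` J]) (Y i @^-1` B i)) =
    \prod_(i in J) P (Y i @^-1` B i).

(* The n-th variable lives on its own probability space (the spaces may of
   course coincide). Measurability is part of the notion, as the library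
   evaluates a measure on arbitrary sets. *)
Definition cvg_in_probability (R : realType) (d : nat -> measure_display)
    (T : forall n, measurableType (d n)) (P : forall n, probability (T n) R)
    (Y : forall n, T n -> \bar R) (c : R) : Prop :=
  (forall n, measurable_fun [set: T n] (Y n)) /\
  forall e : R, (0 < e)%R ->
    P n [set w | e%:E < `|Y n w - c%:E|] @[n --> \oo] --> 0.

End probability_notions.

Section product_probability.
Context {R : realType} {d : measure_display} {T : measurableType d}.
Local Open Scope ereal_scope.

Definition cons_pair (n : nat) (x : T * n.-tuple T) : n.+1.-tuple T :=
  [tuple of x.1 :: x.2].

Lemma measurable_cons_pair n : measurable_fun setT (@cons_pair n).
Proof. by apply: measurable_cons. Qed.

HB.instance Definition _ n :=
  isMeasurableFun.Build _ _ _ _ (@cons_pair n) (@measurable_cons_pair n).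

Fixpoint power_probability (mu : probability T R) (n : nat) :
    probability (n.-tuple T) R :=
  if n is m.+1
  then distribution (mu \x power_probability mu m) (@cons_pair m)
  else \d_[tuple].

Lemma power_probability_box (mu : probability T R) (n : nat)
    (B : 'I_n -> set T) : (forall i, measurable (B i)) ->
  power_probability mu n [set x | forall i, B i (tnth x i)] =
  \prod_(i < n) mu (B i).
Proof.
elim: n B => [|n ih] B mB.
  rewrite big_ord0 /= diracE mem_set //; by case.
have E : cons_pair (n := n) @^-1` [set x | forall i, B i (tnth x i)] =
    B ord0 `*` [set x | forall i, B (lift ord0 i) (tnth x i)].
  apply/seteqP; split=> [[x t] /= h|[x t] /= [h0 h] i].
    split=> [|i]; first exact: (h ord0).
    by have := h (lift ord0 i); rewrite tnthS.
  by case: (unliftP ord0 i) => [j|] ->; rewrite ?tnthS ?tnth0.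
rewrite /= /distribution /pushforward E product_measure1E//.
  rewrite big_ord_recl; congr (_ * _).
  by apply: (ih (fun i => B (lift ord0 i))) => i; exact: mB.
have -> : [set x : n.-tuple T | forall i, B (lift ord0 i) (tnth x i)] =
    \bigcap_(i in [set: 'I_n]) ((tnth (T:=T))^~ i @^-1` B (lift ord0 i)).
  by apply/seteqP; split=> x /= h i; [move=> _|]; apply: h.
apply: fin_bigcap_measurable => // i _.
by rewrite -[X in measurable X]setTI; exact: measurable_tnth.
Qed.

End product_probability.

Section wishart.
Context {R : realType}.

Section marginal.
Variables (k : nat) (U : {set 'I_k}).

Definition tuple_restrict (x : k.-tuple R) : #|U|.-tuple R :=
  [tuple tnth x (enum_val i) | i < #|U|].

Lemma measurable_tuple_restrict : measurable_fun setT tuple_restrict.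
Proof.
apply/measurable_fun_tnthP => i; rewrite [X in measurable_fun _ X](_ : _ = 
  (@tnth _ R)^~ (enum_val i)); first exact: measurable_tnth.
by apply/funext => x /=; rewrite tnth_mktuple.
Qed.

HB.instance Definition _ :=
  isMeasurableFun.Build _ _ _ _ tuple_restrict measurable_tuple_restrict.

Definition marginal (nu : probability (k.-tuple R) R) :
  probability (#|U|.-tuple R) R := distribution nu tuple_restrict.

End marginal.

(* R^k is k.-tuple R with the product of the Borel sigma-algebras of R, that
   is, the Borel sigma-algebra of R^k. *)
Definition finite_second_moment (k : nat) (nu : probability (k.-tuple R) R) :=
  (\int[nu]_x (\sum_(i < k) tnth x i ^+ 2)%:E < +oo)%E.

Definition M_set (k : nat) (beta : R) (mu : probability R R) :
    set (probability (k.-tuple R) R) :=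
  [set nu | finite_second_moment nu /\
    forall U : {set 'I_k}, U != finset.set0 ->
      (KL_divergence (marginal U nu) (power_probability mu #|U|)
        <= (#|U|%:R / beta)%:E)%E].

Definition second_moment_mx (k : nat) (nu : probability (k.-tuple R) R) :
    'M[R]_k :=
  \matrix_(i, j) \int[nu]_x (tnth x i * tnth x j).

Definition Gamma_set (k : nat) (beta : R) (mu : probability R R) :
    set 'M[R]_k :=
  [set second_moment_mx nu | nu in @M_set k beta mu].

(* enum_val lists S in increasing order. *)
Definition column_submx (p n k : nat) (X : 'M[R]_(p, n)) (S : {set 'I_n})
    (cardS : #|S| = k) : 'M[R]_(p, k) :=
  colsub (fun j => enum_val (cast_ord (esym cardS) j)) X.

Definition wishart_set (p n k : nat) (X : 'M[R]_(p, n)) : set 'M[R]_k :=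
  [set A | exists (S : {set 'I_n}) (cardS : #|S| = k),
    A = p%:R^-1 *: ((column_submx X cardS)^T *m column_submx X cardS)].

End wishart.

Arguments M_set {R} k beta mu _.
Arguments Gamma_set {R} k beta mu _.
Arguments wishart_set {R p n} k X _.

(* Main.v *)
Require Import Defs.
From mathcomp Require Import all_boot all_order all_algebra.
From mathcomp Require Import all_classical all_reals all_analysis.
From mathcomp Require Import measurable_realfun ring lra.
Set Implicit Arguments.
Unset Strict Implicit.
Unset Printing Implicit Defensive.
Import Order.TTheory GRing.Theory Num.Theory.
Import numFieldNormedType.Exports.
Local Open Scope classical_set_scope.
Local Open Scope ring_scope.

(** For a set [S] of [k] columns, the [p] rows of [X_[S]] form a sample of
    size [p] in [R^k], and the Gram matrix divided by [p] is the second moment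
    matrix of the empirical law of that sample. For fixed [S] this empirical
    law is close to [nu] with probability about [exp (- p D(nu || mu^k))],
    whereas there are about [n^k = exp (k p / beta)] sets [S]; hence [nu] can
    be seen only if [D(nu || mu^k) <= k / beta]. The same count for the
    [n^|U|] choices of the columns with index in [U] gives the constraint on
    the marginal [nu_U], and a second moment computation shows that there is
    no other obstruction.

    Entropy bounds are used in a dual form ([kl_leP]): [D(nu || rho) <= r] iff
    [\int g dnu + 1 <= r + \int exp g drho] for every bounded measurable [g].
    This is affine in [nu], so that the entropy constraints pass to mixtures
    ([convex_combination_dual]), to marginals and to discretizations
    ([data_processing]) without any density, and [Gamma_convex] follows.
    Testing on truncations of [t0 x_j^2] bounds the second moments by the
    exponential moment of [mu] ([kl_energy]), whence total boundedness.

    Upper bound ([upper_whp]). The line is cut into cells on a logarithmic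
    scale, with relative precision [kap], up to a radius exceeding
    [sqrt (p E)]; there are only [O(log p)] cells, so the number of types of
    sequences of length [p] over the cells of [R^u] is [exp (o(p))]. By the
    method of types ([sum_atypical]) and a union bound over the column
    choices, with high probability every tuple of at most [k] columns has a
    type of relative entropy at most [u (1 / beta + delta)]. Spreading each
    row over its cell in proportion to [mu^k] turns the type into a law [nu]
    on [R^k] with the same entropies ([lift_kl]) and almost the same second
    moments ([lift_approx]), and a small admixture of [mu^k] brings [nu] into
    the admissible set ([upper_approx]).

    Lower bound ([lower_whp]). Given an admissible [nu], mix it with a little
    [mu^k] to make all the constraints strict, cut it to finitely many cells
    and move the unbounded cells onto a cell of positive mass ([lower_target]).
    Let the first column be chosen in the first of [k] consecutive blocks of
    [n %/ k] columns, the second one in the second block, and so on. Two such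
    choices overlap exactly in the set [U] of the indices where they agree,
    and the variance of the proportion of good choices, each weighted by a
    likelihood ratio, is about the sum over nonempty [U] of
    [exp (p D(nu_U || mu^U)) / (n %/ k)^|U|] ([no_typical_selection]), which
    tends to [0] as the constraints are strict ([near_overlap_bound]).

    Finally [Gamma], being totally bounded, has finite nets, which turn the
    two bounds into a bound on the Hausdorff distance ([hausdorff_whp]), and a
    countable dense subset, which makes this distance a countable supremum of
    countable infima of measurable functions ([measurable_hausdorff]). *)

(** * Types of finite sequences *)

Section types.
Variables (R : realType) (K : finType) (p : nat).
Hypothesis p_gt0 : (0 < p)%N.
Implicit Types (w q : K -> R) (y : {ffun 'I_p -> K}).

Definition freq y (c : K) : R := #|[pred i | y i == c]|%:R / p%:R.

Lemma sum_prod_ffun (I : finType) (F : I -> K -> R) :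
  \sum_(y : {ffun I -> K}) \prod_i F i (y i) = \prod_i \sum_c F i c.
Proof. by rewrite bigA_distr_bigA. Qed.

Lemma sum_prod1 (I : finType) w : \sum_c w c = 1 ->
  \sum_(y : {ffun I -> K}) \prod_i w (y i) = 1.
Proof. by move=> w1; rewrite (sum_prod_ffun (fun=> w)) big1. Qed.

Lemma sum_comp_freq y (F : K -> R) :
  \sum_i F (y i) = p%:R * \sum_c freq y c * F c.
Proof.
have p0 : p%:R != 0 :> R by rewrite pnatr_eq0 -lt0n.
rewrite (partition_big y xpredT)//= mulr_sumr; apply: eq_bigr => c _.
rewrite /freq mulrA mulrCA divff// mulr1.
rewrite (eq_bigr (fun=> F c)); last by move=> i /eqP ->.
by rewrite sumr_const mulr_natl.
Qed.

Lemma sum_freq y : \sum_c freq y c = 1.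
Proof.
have p0 : p%:R != 0 :> R by rewrite pnatr_eq0 -lt0n.
have := sum_comp_freq y (fun=> 1); under [in RHS]eq_bigr do rewrite mulr1.
rewrite sumr_const cardT size_enum_ord => /(congr1 (fun x => p%:R^-1 * x)).
by rewrite mulrA !mulVf// mul1r.
Qed.

Lemma freq_ge0 y c : 0 <= freq y c.
Proof. by rewrite divr_ge0. Qed.

Lemma freq_gt0 y i : 0 < freq y (y i).
Proof.
rewrite divr_gt0 ?ltr0n//; apply/card_gt0P; exists i.
by rewrite inE.
Qed.

(** The frequencies [t] of a sequence are a probability on [K], and the
    sequences with frequencies [t] have total mass at most [1] under the
    product of [t]. As a sequence of length [p] determines counts in [0 .. p],
    the sum splits into at most [(p + 1) ^ #|K|] such parts. *)
Lemma sum_freq_types :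
  \sum_y \prod_i freq y (y i) <= (p.+1 ^ #|K|)%:R.
Proof.
pose t y : {ffun K -> 'I_p.+1} := [ffun c => inord #|[pred i | y i == c]|].
pose v (u : {ffun K -> 'I_p.+1}) c : R := (u c : nat)%:R / p%:R.
have vt y c : v (t y) c = freq y c.
  rewrite /v /t ffunE inordK// ltnS.
  by rewrite (leq_trans (max_card _))// card_ord.
rewrite (partition_big t xpredT)//=.
have -> : (p.+1 ^ #|K| = #|{ffun K -> 'I_p.+1}|)%N by rewrite card_ffun card_ord.
rewrite -sum1_card natr_sum; apply: ler_sum => u _.
have [/existsP[y0 /eqP <-]|/existsPn nu] := boolP [exists y, t y == u]; last first.
  by rewrite big_pred0 // => y; exact: negbTE.
apply: (@le_trans _ _ (\sum_(y | t y == t y0) \prod_i v (t y0) (y i))).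
  apply: ler_sum => y /eqP <-; rewrite le_eqVlt; apply/orP; left; apply/eqP.
  by apply: eq_bigr => i _; rewrite vt.
have v1 : \sum_c v (t y0) c = 1 by under eq_bigr do rewrite vt; exact: sum_freq.
rewrite [leRHS](_ : _ = \sum_(y : {ffun 'I_p -> K}) \prod_i v (t y0) (y i)); last first.
  by rewrite sum_prod1.
rewrite [leRHS](bigID (fun y => t y == t y0))/= lerDl sumr_ge0// => y _.
by rewrite prodr_ge0// => i _; rewrite vt freq_ge0.
Qed.

(** The right-hand product is the largest mass that a product law gives to
    [y]; its ratio to the left-hand one is the exponential of [p] times the
    entropy of the frequencies of [y] relative to [w]. *)
Definition atypical w (r : R) : pred {ffun 'I_p -> K} :=
  fun y => \prod_i w (y i) < expR (- (p%:R * r)) * \prod_i freq y (y i).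

Lemma sum_atypical w r :
  \sum_(y | atypical w r y) \prod_i w (y i) <=
    expR (- (p%:R * r)) * (p.+1 ^ #|K|)%:R.
Proof.
apply: le_trans (ler_wpM2l (expR_ge0 _) sum_freq_types).
rewrite mulr_sumr [leRHS](bigID (atypical w r))/=.
apply: ler_wpDr.
  apply: sumr_ge0 => y _; rewrite mulr_ge0 ?expR_ge0//.
  by apply: prodr_ge0 => i _; exact: freq_ge0.
by apply: ler_sum => y; rewrite /atypical => /ltW.
Qed.

Lemma typical_gt0 w r y : (forall c, 0 <= w c) -> ~~ atypical w r y ->
  forall i, 0 < w (y i).
Proof.
move=> w0; rewrite -leNgt => /(lt_le_trans _) h.
have /prodf_neq0 hp : \prod_i w (y i) != 0.
  rewrite gt_eqF// h// mulr_gt0 ?expR_gt0//.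
  by apply: prodr_gt0 => i _; exact: freq_gt0.
by move=> i; rewrite lt_neqAle eq_sym hp// w0.
Qed.

Lemma typical_sum_ln w r y : (forall c, 0 <= w c) -> ~~ atypical w r y ->
  \sum_i ln (freq y (y i) / w (y i)) <= p%:R * r.
Proof.
move=> w0 ty; have wy := typical_gt0 w0 ty.
have P0 : 0 < \prod_i w (y i) by apply: prodr_gt0.
rewrite -ler_expR expR_sum.
rewrite (eq_bigr (fun i => freq y (y i) / w (y i))); last first.
  by move=> i _; rewrite lnK// posrE divr_gt0 ?freq_gt0.
move: ty; rewrite -leNgt expRN mulrC ler_pdivrMr ?expR_gt0// => ty.
by rewrite prodf_div ler_pdivrMr// mulrC.
Qed.

(** The off-diagonal terms vanish because the coordinates of [y] are
    independent and [F] is centered under [q]. *)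
Lemma sum_centered_sqr q (F : K -> R) : (forall c, 0 <= q c) ->
  \sum_c q c = 1 -> \sum_c q c * F c = 0 ->
  \sum_(y : {ffun 'I_p -> K}) (\prod_i q (y i)) * (\sum_i F (y i)) ^+ 2 =
    p%:R * \sum_c q c * F c ^+ 2.
Proof.
move=> q0 q1 qF.
have E i j : \sum_(y : {ffun 'I_p -> K}) (\prod_l q (y l)) * (F (y i) * F (y j)) =
    if i == j then \sum_c q c * F c ^+ 2 else 0.
  pose G l c : R := q c * ((if l == i then F c else 1) *
    (if l == j then F c else 1)).
  transitivity (\sum_(y : {ffun 'I_p -> K}) \prod_l G l (y l)).
    apply: eq_bigr => y _; rewrite big_split/= big_split/=.
    by rewrite -!big_mkcond/= !big_pred1_eq.
  rewrite sum_prod_ffun (bigD1 i)//= {1}/G eqxx.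
  have [ij|ij] := eqVneq i j.
    rewrite [X in _ * X]big1 ?mulr1; first by apply: eq_bigr => c _; rewrite /= expr2.
    move=> l /negbTE li; rewrite /G -ij li -[RHS]q1.
    by apply: eq_bigr => c _; rewrite !mulr1.
  by under eq_bigr do rewrite mulr1; rewrite qF mul0r.
transitivity (\sum_i \sum_j \sum_(y : {ffun 'I_p -> K}) (\prod_l q (y l)) * (F (y i) * F (y j))).
  under [RHS]eq_bigr do rewrite exchange_big/=.
  rewrite [RHS]exchange_big/=; apply: eq_bigr => y _.
  rewrite expr2 mulr_suml mulr_sumr; apply: eq_bigr => i _.
  by rewrite mulr_sumr mulr_sumr.
under eq_bigr => i _.
  under eq_bigr do rewrite E.
  rewrite -big_mkcond/= (eq_bigl (pred1 i)) ?big_pred1_eq; last first.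
    by move=> j; rewrite eq_sym.
over.
by rewrite sumr_const card_ord mulr_natl.
Qed.

Definition freq_close q (e : R) : pred {ffun 'I_p -> K} :=
  fun y => [forall c, `|freq y c - q c| <= e].

(** The weak law of large numbers for the frequencies: Chebyshev's inequality
    for each letter, then a union bound. *)
Lemma sum_freq_close q (e : R) : (forall c, 0 <= q c) -> \sum_c q c = 1 ->
  0 < e ->
  1 - #|K|%:R / (p%:R * e ^+ 2) <= \sum_(y | freq_close q e y) \prod_i q (y i).
Proof.
move=> q0 q1 e0.
have p0 : 0 < p%:R :> R by rewrite ltr0n.
have Q0 y : 0 <= \prod_i q (y i) by apply: prodr_ge0.
have q_le1 c : q c <= 1.
  by rewrite -q1 (bigD1 c)//= lerDl sumr_ge0.
rewrite lerBlDr -lerBlDl.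
have -> : 1 - \sum_(y | freq_close q e y) \prod_i q (y i) =
    \sum_(y | ~~ freq_close q e y) \prod_i q (y i).
  have := sum_prod1 'I_p q1; rewrite (bigID (freq_close q e))/= => H.
  by apply/eqP; rewrite subr_eq eq_sym addrC H.
have V c : \sum_(y | e < `|freq y c - q c|) \prod_i q (y i) <=
    (p%:R * e ^+ 2)^-1.
  pose F d : R := (d == c)%:R - q c.
  have hF : \sum_d q d * F d = 0.
    under eq_bigr do rewrite mulrBr; rewrite sumrB -mulr_suml q1 mul1r.
    rewrite (bigD1 c)//= eqxx mulr1 big1 ?addr0 ?subrr// => d /negbTE ->.
    by rewrite mulr0.
  have hF2 : \sum_d q d * F d ^+ 2 <= 1.
    rewrite -q1; apply: ler_sum => d _; rewrite ler_piMr// /F.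
    have := q_le1 c; have := q0 c; case: (d == c) => /=; nra.
  have H := sum_centered_sqr q0 q1 hF.
  have EF y : \sum_i F (y i) = p%:R * (freq y c - q c).
    rewrite (sum_comp_freq y F); congr (_ * _).
    under eq_bigr do rewrite mulrBr; rewrite sumrB -mulr_suml sum_freq mul1r.
    rewrite (bigD1 c)//= eqxx mulr1 big1 ?addr0// => d /negbTE ->.
    by rewrite mulr0.
  rewrite -(ler_pM2l (x := p%:R ^+ 2 * e ^+ 2)) ?mulr_gt0 ?exprn_gt0//.
  have -> : p%:R ^+ 2 * e ^+ 2 * (p%:R * e ^+ 2)^-1 = p%:R :> R.
    by field; rewrite !gt_eqF.
  apply: (@le_trans _ _ (p%:R * \sum_d q d * F d ^+ 2)); last first.
    by rewrite ler_piMr// ltW.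
  rewrite -H mulr_sumr [leRHS](bigID (fun y => e < `|freq y c - q c|))/=.
  apply: ler_wpDr.
    by apply: sumr_ge0 => y _; rewrite mulr_ge0// sqr_ge0.
  apply: ler_sum => y ey; rewrite mulrC ler_wpM2l// EF exprMn ler_pM2l ?exprn_gt0//.
  by rewrite -[leRHS]real_normK ?num_real// lerXn2r ?nnegrE ?normr_ge0 ?ltW.
apply: (@le_trans _ _ (\sum_c \sum_(y | e < `|freq y c - q c|) \prod_i q (y i))).
  under [leRHS]eq_bigr do rewrite big_mkcond/=.
  rewrite exchange_big/= big_mkcond/=; apply: ler_sum => y _.
  have h0 c : 0 <= (if e < `|freq y c - q c| then \prod_i q (y i) else 0) :> R.
    by case: ifP.
  case: ifPn => [|_]; last by rewrite sumr_ge0.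
  rewrite negb_forall => /existsP[c]; rewrite -ltNge => ec.
  by rewrite (bigD1 c)//= ec lerDl sumr_ge0.
apply: le_trans (ler_sum _ (fun c _ => V c)) _.
by rewrite sumr_const -[leLHS]mulr_natl.
Qed.

End types.

(** * The second moment method for overlapping selections *)

Section second_moment_method.
Variables (R : realType) (Z S : finType) (w : Z -> R) (N : S -> Z -> R).
Variables (th : R) (b : S -> S -> R).

(** Where all the [N s] vanish, the deviation of their sum from its mean is
    the whole mean; Chebyshev's inequality bounds the mass of this set, and
    the hypothesis on products bounds the variance. *)
Lemma second_moment_method : (0 < #|S|)%N -> (forall z, 0 <= w z) -> 0 < th ->
  \sum_z w z = 1 ->
  (forall s, \sum_z w z * N s z = th) ->
  (forall s t, \sum_z w z * (N s z * N t z) <= th ^+ 2 + b s t) ->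
  \sum_(z | [forall s, N s z == 0]) w z <=
    (\sum_s \sum_t b s t) / (#|S|%:R ^+ 2 * th ^+ 2).
Proof.
move=> S0 w0 th0 w1 EN ENN.
have nS : 0 < #|S|%:R :> R by rewrite ltr0n.
rewrite ler_pdivlMr ?mulr_gt0 ?exprn_gt0//.
pose A z := \sum_s (N s z - th).
(* On the event, A z is minus the mean of the sum of the N s. *)
apply: (@le_trans _ _ (\sum_z w z * A z ^+ 2)).
  rewrite mulr_suml [leRHS](bigID (fun z => [forall s, N s z == 0]))/=.
  apply: ler_wpDr.
    by apply: sumr_ge0 => z _; rewrite mulr_ge0// sqr_ge0.
  apply: ler_sum => z /forallP Nz; rewrite ler_wpM2l//.
  have -> : A z = - (#|S|%:R * th).
    rewrite /A; under eq_bigr do rewrite (eqP (Nz _)) sub0r.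
    by rewrite sumr_const mulNrn mulr_natl.
  by rewrite sqrrN exprMn.
have -> : \sum_z w z * A z ^+ 2 = \sum_s \sum_t \sum_z w z * ((N s z - th) * (N t z - th)).
  under [RHS]eq_bigr do rewrite exchange_big/=.
  rewrite [RHS]exchange_big/=; apply: eq_bigr => z _.
  rewrite expr2 mulr_suml mulr_sumr; apply: eq_bigr => s _.
  by rewrite mulr_sumr mulr_sumr.
apply: ler_sum => s _; apply: ler_sum => t _.
apply: (@le_trans _ _ (\sum_z (w z * (N s z * N t z) - th * (w z * N s z)
    - th * (w z * N t z) + th ^+ 2 * w z))).
  rewrite le_eqVlt; apply/orP; left; apply/eqP; apply: eq_bigr => z _; ring.
rewrite big_split/= !sumrB -!mulr_sumr !EN w1.
have := ENN s t; nra.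
Qed.

End second_moment_method.

Section overlaps.
Variables (R : realType) (C : finType) (k p : nat).
Variables (pi : C -> R) (q : {ffun 'I_k -> C} -> R) (e : R).
Hypothesis p_gt0 : (0 < p)%N.
Hypothesis pi_ge0 : forall c, 0 <= pi c.
Hypothesis q_ge0 : forall c, 0 <= q c.
Hypothesis q_sum1 : \sum_c q c = 1.

Local Notation K := {ffun 'I_k -> C}.
Implicit Types (c : K) (y : {ffun 'I_p -> K}) (U : {set 'I_k}).

Definition prod_weight c : R := \prod_j pi (c j).

Hypothesis q_dominated : forall c, prod_weight c = 0 -> q c = 0.

Definition agree U c c' := [forall (j | j \in U), c' j == c j].

(** The weight depends on [c] only through its coordinates in [U]; indexing it
    by full words avoids a family of alphabets indexed by [U]. *)
Definition marginal_weight U c : R := \sum_(c' | agree U c c') q c'.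

Definition marginal_ratio U c : R :=
  marginal_weight U c / \prod_(j in U) pi (c j).

Definition relative_entropy U : R := \sum_c q c * ln (marginal_ratio U c).

(** Moving the weights of all words by at most [e] changes the mean of the
    logarithmic ratio by at most [e] times this quantity. *)
Definition log_ratio_mass U : R := \sum_c `|ln (marginal_ratio U c)|.

(** The density, relative to the law of [p] independent words of law
    [prod_weight], of [p] independent words of law [q], cut to the sequences
    whose frequencies are within [e] of [q]. Its mean is nearly [1], and the
    cut bounds the ratios on shared coordinates by their typical value, which
    makes the second moment small. *)
Definition tilted_indicator y : R :=
  (freq_close q e y)%:R * \prod_i (q (y i) / prod_weight (y i)).

Lemma prod_weight_ge0 c : 0 <= prod_weight c.
Proof. by apply: prodr_ge0. Qed.

Lemma prod_weightK c : prod_weight c * (q c / prod_weight c) = q c.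
Proof.
have [c0|c0] := eqVneq (prod_weight c) 0; first by rewrite c0 q_dominated// !mul0r.
by rewrite mulrC divfK.
Qed.

Lemma tilted_indicator_ge0 y : 0 <= tilted_indicator y.
Proof.
rewrite mulr_ge0//; apply: prodr_ge0 => i _.
by rewrite divr_ge0// prod_weight_ge0.
Qed.

Lemma tilted_indicator_neq0 y : tilted_indicator y != 0 ->
  freq_close q e y /\ forall i, 0 < q (y i).
Proof.
rewrite /tilted_indicator; case: freq_close; rewrite ?mul0r ?eqxx// mul1r.
move=> /prodf_neq0 h; split=> // i; have := h i isT.
by rewrite mulf_eq0 negb_or lt_neqAle eq_sym q_ge0 andbT => /andP[].
Qed.

Definition typical_mass : R := \sum_(y : {ffun 'I_p -> K} | freq_close q e y) \prod_i q (y i).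

Lemma sum_tilted_indicator :
  \sum_(y : {ffun 'I_p -> K}) (\prod_i prod_weight (y i)) * tilted_indicator y = typical_mass.
Proof.
rewrite /typical_mass [RHS]big_mkcond/=; apply: eq_bigr => y _.
rewrite /tilted_indicator mulrCA -big_split/=.
under eq_bigr do rewrite prod_weightK.
by case: ifP => _; rewrite ?mul1r ?mul0r.
Qed.

Lemma typical_mass_le1 : typical_mass <= 1.
Proof.
rewrite -(sum_prod1 'I_p q_sum1) [leRHS](bigID (freq_close q e))/= lerDl.
by apply: sumr_ge0 => y _; apply: prodr_ge0.
Qed.

(** Conditionally on the coordinates in [U], the mean of the likelihood ratio
    is the likelihood ratio of the marginals on [U]. *)
Lemma sum_conditional_ratio U c :
  \sum_(c' | agree U c c') (\prod_(j | j \notin U) pi (c' j)) *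
     (q c' / prod_weight c') = marginal_ratio U c.
Proof.
rewrite /marginal_ratio /marginal_weight mulr_suml; apply: eq_bigr => c' /forallP cc.
have E : prod_weight c' =
    (\prod_(j in U) pi (c j)) * \prod_(j | j \notin U) pi (c' j).
  rewrite /prod_weight (bigID (mem U))/=; congr (_ * _); apply: eq_bigr => j jU.
  by have := cc j; rewrite jU => /eqP ->.
have [c0|] := eqVneq (prod_weight c') 0; first by rewrite q_dominated// !mul0r mulr0.
rewrite E mulf_eq0 negb_or => /andP[a0 b0].
by field; rewrite a0 b0.
Qed.

Lemma sum_conditional_likelihood U y :
  \sum_(y' : {ffun 'I_p -> K} | [forall i, agree U (y i) (y' i)])
    (\prod_i \prod_(j | j \notin U) pi (y' i j)) *
    (\prod_i (q (y' i) / prod_weight (y' i))) =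
  \prod_i marginal_ratio U (y i).
Proof.
under [RHS]eq_bigr do rewrite -sum_conditional_ratio.
rewrite bigA_distr_big_dep/=.
apply: eq_big => [y'|y' _]; last by rewrite -big_split.
by apply/forallP/familyP => h i; exact: (h i).
Qed.

Lemma marginal_ratio_gt0 U c : 0 < q c -> 0 < marginal_ratio U c.
Proof.
move=> qc; have pc : 0 < prod_weight c.
  rewrite lt_neqAle prod_weight_ge0 andbT eq_sym; apply: contraTneq qc => c0.
  by rewrite q_dominated// ltxx.
rewrite divr_gt0//.
  rewrite /marginal_weight (bigD1 c)/=; last by apply/forallP => j; rewrite eqxx implybT.
  by rewrite ltr_pwDl// sumr_ge0.
apply: prodr_gt0 => j _; rewrite lt_neqAle pi_ge0 andbT eq_sym.
by move: pc => /gt_eqF/negbT/prodf_neq0; apply.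
Qed.

(** The logarithm of the product is [p] times the mean of the logarithmic
    ratio under the frequencies of [y], and these are close to [q]. *)
Lemma typical_likelihood U y : freq_close q e y -> (forall i, 0 < q (y i)) ->
  \prod_i marginal_ratio U (y i) <=
    expR (p%:R * (relative_entropy U + e * log_ratio_mass U)).
Proof.
move=> /forallP fy qy.
rewrite (eq_bigr (fun i => expR (ln (marginal_ratio U (y i))))); last first.
  by move=> i _; rewrite lnK// posrE marginal_ratio_gt0.
rewrite -expR_sum ler_expR (sum_comp_freq p_gt0 y (fun c => ln (marginal_ratio U c))).
rewrite ler_wpM2l// -lerBlDl /relative_entropy -sumrB /log_ratio_mass mulr_sumr.
apply: ler_sum => c _; rewrite -mulrBl.
by rewrite (le_trans (ler_norm _))// normrM ler_wpM2r.
Qed.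

(** The joint law of two sequences of words that share the coordinates in [U]
    and are independent elsewhere. *)
Definition pair_weight U y y' : R :=
  [forall i, agree U (y i) (y' i)]%:R * (\prod_i prod_weight (y i)) *
  \prod_i \prod_(j | j \notin U) pi (y' i j).

(** Integrate the second sequence first, dropping its cut: this leaves the
    ratio of the marginals on [U], bounded on the typical sequences, against a
    tilted mass that is at most [1]. *)
Lemma pair_moment U :
  \sum_(y : {ffun 'I_p -> K}) \sum_(y' : {ffun 'I_p -> K}) pair_weight U y y' * (tilted_indicator y * tilted_indicator y')
  <= expR (p%:R * (relative_entropy U + e * log_ratio_mass U)).
Proof.
set L := expR _.
have tm : typical_mass * L <= L by rewrite ler_piMl ?expR_ge0// typical_mass_le1.
apply: le_trans tm; rewrite -sum_tilted_indicator mulr_suml; apply: ler_sum => y _.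
have [y0|y0] := eqVneq (tilted_indicator y) 0.
  by rewrite y0 mulr0 mul0r big1// => y' _; rewrite mul0r mulr0.
have [fy qy] := tilted_indicator_neq0 y0.
apply: (@le_trans _ _ ((\prod_i prod_weight (y i)) * tilted_indicator y *
    \prod_i marginal_ratio U (y i))); last first.
  rewrite ler_wpM2l ?typical_likelihood// mulr_ge0 ?tilted_indicator_ge0//.
  by apply: prodr_ge0 => i _; exact: prod_weight_ge0.
rewrite -sum_conditional_likelihood mulr_sumr [leRHS]big_mkcond/=.
apply: ler_sum => y' _; rewrite /pair_weight; case: ifP => _; last by rewrite !mul0r.
rewrite mul1r [leLHS](_ : _ = (\prod_i prod_weight (y i)) * tilted_indicator y *
  ((\prod_i \prod_(j | j \notin U) pi (y' i j)) * tilted_indicator y')); last by ring.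
rewrite ler_wpM2l//.
  by rewrite mulr_ge0 ?tilted_indicator_ge0// prodr_ge0// => i _; exact: prod_weight_ge0.
rewrite ler_wpM2l//; first by rewrite prodr_ge0// => i _; exact: prodr_ge0.
rewrite /tilted_indicator; case: freq_close; rewrite ?mul1r// mul0r.
by apply: prodr_ge0 => i _; rewrite divr_ge0// prod_weight_ge0.
Qed.

Lemma pair_moment0 :
  \sum_(y : {ffun 'I_p -> K}) \sum_(y' : {ffun 'I_p -> K}) pair_weight finset.set0 y y' *
    (tilted_indicator y * tilted_indicator y') = typical_mass ^+ 2.
Proof.
rewrite expr2 -{1}sum_tilted_indicator mulr_suml; apply: eq_bigr => y _.
rewrite -sum_tilted_indicator mulr_sumr; apply: eq_bigr => y' _.
rewrite /pair_weight (_ : [forall i, _] = true) ?mul1r; last first.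
  by apply/forallP => i; apply/forallP => j; rewrite inE.
rewrite [X in _ * X * _](eq_bigr (fun i => prod_weight (y' i))); first by ring.
by move=> i _; apply: eq_bigl => j; rewrite inE.
Qed.

Lemma sum_pair_weight_diag (F : {ffun 'I_p -> K} -> R) :
  \sum_(y : {ffun 'I_p -> K}) \sum_(y' : {ffun 'I_p -> K}) pair_weight finset.setT y y' * F y =
  \sum_(y : {ffun 'I_p -> K}) (\prod_i prod_weight (y i)) * F y.
Proof.
apply: eq_bigr => y _; rewrite (bigD1 y)//= big1 ?addr0.
  rewrite /pair_weight (_ : [forall i, _] = true) ?mul1r; last first.
    by apply/forallP => i; apply/forallP => j; rewrite eqxx implybT.
  rewrite [X in _ * X * _]big1 ?mulr1// => i _.
  by rewrite big_pred0// => j; rewrite inE.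
move=> y' yy'; rewrite /pair_weight (_ : [forall i, _] = false) ?mul0r//.
apply/negbTE; apply: contraNN yy' => /forallP h; apply/eqP/ffunP => i.
apply/ffunP => j; have /forallP/(_ j) := h i.
by rewrite inE => /eqP.
Qed.

Variables (M : nat) (Z : finType) (w : Z -> R).
Variable Y : {ffun 'I_k -> 'I_M} -> Z -> {ffun 'I_p -> K}.
Hypothesis M_gt0 : (0 < M)%N.
Hypothesis w_ge0 : forall z, 0 <= w z.
Hypothesis w_sum1 : \sum_z w z = 1.
Hypothesis pair_law : forall s t y y',
  \sum_(z | (Y s z == y) && (Y t z == y')) w z =
  pair_weight [set j | s j == t j]%SET y y'.

Lemma sum_pair_law s t (F : {ffun 'I_p -> K} -> {ffun 'I_p -> K} -> R) :
  \sum_z w z * F (Y s z) (Y t z) =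
  \sum_(y : {ffun 'I_p -> K}) \sum_(y' : {ffun 'I_p -> K}) pair_weight [set j | s j == t j]%SET y y' * F y y'.
Proof.
rewrite (partition_big (Y s) xpredT)//=; apply: eq_bigr => y _.
rewrite (partition_big (Y t) xpredT)//=; apply: eq_bigr => y' _.
rewrite -pair_law mulr_suml; apply: eq_bigr => z /andP[/eqP -> /eqP ->//].
Qed.

Lemma sum_agreeing (U : {set 'I_k}) (s : {ffun 'I_k -> 'I_M}) :
  \sum_(t : {ffun 'I_k -> 'I_M}) [forall (j | j \in U), s j == t j]%:R =
  M%:R ^+ k * (M%:R ^+ #|U|)^-1 :> R.
Proof.
pose F (j : 'I_k) (a : 'I_M) : R := ((j \in U) ==> (s j == a))%:R.
transitivity (\sum_(t : {ffun 'I_k -> 'I_M}) \prod_j F j (t j)).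
  apply: eq_bigr => t _; rewrite /F; case: forallP => [h|/forallP].
    by rewrite big1// => j _; rewrite h.
  by rewrite negb_forall => /existsP[j /negbTE h]; rewrite (bigD1 j)//= h mul0r.
have M0 : M%:R != 0 :> R by rewrite pnatr_eq0 -lt0n.
have -> : M%:R ^+ k = \prod_(j < k) M%:R :> R by rewrite prodr_const card_ord.
rewrite sum_prod_ffun -exprVn -prodr_const [X in _ * X]big_mkcond/= -big_split/=.
apply: eq_bigr => j _; rewrite /F; case: (j \in U) => /=.
  rewrite divff// (bigD1 (s j))//= eqxx big1 ?addr0// => a /negbTE.
  by rewrite eq_sym => ->.
by rewrite sumr_const card_ord mulr1.
Qed.

(** Selections [s] and [t] that agree exactly on [U] have the second moment
    computed in [pair_moment], and there is no excess over the squared mean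
    when [U] is empty. For given [s], a fraction [M ^- #|U|] of the selections
    [t] agree with [s] on [U]. *)
Lemma no_typical_selection : 0 < typical_mass ->
  \sum_(z | [forall s, tilted_indicator (Y s z) == 0]) w z <=
  (\sum_(U : {set 'I_k} | U != finset.set0)
     expR (p%:R * (relative_entropy U + e * log_ratio_mass U)) / M%:R ^+ #|U|)
  / typical_mass ^+ 2.
Proof.
move=> th0.
pose L U := expR (p%:R * (relative_entropy U + e * log_ratio_mass U)).
(* Summing over every set on which s and t agree, rather than the largest one,
   makes the double sum over s and t factor. *)
pose b (s t : {ffun 'I_k -> 'I_M}) : R :=
  \sum_(U : {set 'I_k} | U != finset.set0) [forall (j | j \in U), s j == t j]%:R * L U.
have M0 : 0 < M%:R :> R by rewrite ltr0n.
have b0 s t (U : {set 'I_k}) : 0 <= [forall (j | j \in U), s j == t j]%:R * L U.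
  by rewrite mulr_ge0 ?expR_ge0.
have S0 : (0 < #|{ffun 'I_k -> 'I_M}|)%N by rewrite card_ffun !card_ord expn_gt0 M_gt0.
have := @second_moment_method R Z {ffun 'I_k -> 'I_M} w
  (fun s z => tilted_indicator (Y s z)) typical_mass b S0 w_ge0 th0 w_sum1.
move=> /(_ _ _)/le_trans; apply.
- move=> s; rewrite (sum_pair_law s s (fun y _ => tilted_indicator y)).
  rewrite (_ : [set j | s j == s j]%SET = finset.setT); last first.
    by apply/setP => j; rewrite !inE eqxx.
  by rewrite sum_pair_weight_diag sum_tilted_indicator.
- move=> s t; rewrite (sum_pair_law s t (fun y y' => tilted_indicator y * tilted_indicator y')).
  set U := [set j | _]%SET; have [->|U0] := eqVneq U finset.set0.
    by rewrite pair_moment0 lerDl sumr_ge0.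
  rewrite (le_trans (pair_moment U))// ler_wpDl ?sqr_ge0//.
  rewrite /b (bigD1 U)//= ler_wpDr ?sumr_ge0// (_ : [forall j, _] = true) ?mul1r//.
  by apply/forallP => j; apply/implyP; rewrite inE.
rewrite invfM mulrA ler_wpM2r ?invr_ge0 ?sqr_ge0//.
have -> : \sum_s \sum_t b s t = \sum_(U : {set 'I_k} | U != finset.set0)
    (M%:R ^+ k) ^+ 2 * (L U / M%:R ^+ #|U|).
  rewrite /b; under eq_bigr do rewrite exchange_big/=.
  rewrite exchange_big/=; apply: eq_bigr => U _.
  under eq_bigr do rewrite -mulr_suml sum_agreeing.
  rewrite sumr_const card_ffun !card_ord -[LHS]mulr_natl natrX; ring.
by rewrite -mulr_sumr card_ffun !card_ord natrX mulrAC divff ?mul1r// gt_eqF// !exprn_gt0.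
Qed.

End overlaps.

(** * Relative entropy by duality *)

Section real_integrable.
Context {d : measure_display} {T : measurableType d} {R : realType}.
Variables (m : {measure set T -> \bar R}) (D : set T).
Hypothesis mD : measurable D.
Implicit Types f g : T -> R.

Lemma integrable_addr f g : m.-integrable D (EFin \o f) ->
  m.-integrable D (EFin \o g) -> m.-integrable D (EFin \o (fun x => f x + g x)).
Proof. by move=> hf hg; exact: (integrableD mD hf hg). Qed.

Lemma integrable_subr f g : m.-integrable D (EFin \o f) ->
  m.-integrable D (EFin \o g) -> m.-integrable D (EFin \o (fun x => f x - g x)).
Proof. by move=> hf hg; exact: (integrableB mD hf hg). Qed.

Lemma integrable_scaler (c : R) f : m.-integrable D (EFin \o f) ->
  m.-integrable D (EFin \o (fun x => c * f x)).
Proof. by move=> hf; exact: (integrableZl mD c hf). Qed.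

End real_integrable.

Section bounded_integrals.
Context {d : measure_display} {T : measurableType d} {R : realType}.
Variable m : probability T R.

Definition norm_bounded (g : T -> R) := exists M : R, forall x, `|g x| <= M.

Lemma bounded_integrable (g : T -> R) : measurable_fun setT g ->
  norm_bounded g -> m.-integrable setT (EFin \o g).
Proof.
move=> mg [M gM].
apply: (measurable_bounded_integrable measurableT _ mg).
  by rewrite ltey_eq fin_num_measure.
by exists M; split => [|x Mx y _ /=]; rewrite ?num_real// (le_trans (gM y))// ltW.
Qed.

Lemma Rintegral_probability_cst (c : R) : \int[m]_x c = c.
Proof. by rewrite Rintegral_cst//= probability_setT mulr1. Qed.

Lemma EFin_Rintegral (g : T -> R) : m.-integrable setT (EFin \o g) ->
  (\int[m]_x g x)%:E = (\int[m]_x (g x)%:E)%E.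
Proof. by move=> ig; rewrite fineK//; exact: integrable_fin_num. Qed.

End bounded_integrals.

Section kl_dual.
Context {d : measure_display} {T : measurableType d} {R : realType}.
Implicit Types nu rho : probability T R.

(** The variational formula for relative entropy in its affine form: [\int exp
    g drho - 1] replaces [ln (\int exp g drho)], which gives the same supremum
    because constants may be added to [g]. The condition is affine in [nu] and
    in [rho]. *)
Definition kl_dual_le nu rho (r : R) :=
  forall g : T -> R, measurable_fun setT g -> norm_bounded g ->
  \int[nu]_x g x + 1 <= r + \int[rho]_x expR (g x).

Local Open Scope ereal_scope.
Local Open Scope charge_scope.

Lemma bounded_expR (g : T -> R) : norm_bounded g -> norm_bounded (@expR R \o g).
Proof.
move=> [M gM]; exists (expR M) => x /=.
by rewrite ger0_norm ?expR_ge0// ler_expR (le_trans (ler_norm _)).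
Qed.

Lemma measurable_expR_comp (g : T -> R) : measurable_fun setT g ->
  measurable_fun setT (@expR R \o g).
Proof. by move=> mg; apply: measurableT_comp. Qed.

(** A density with finite nonnegative values everywhere, so that the entropy
    becomes the integral of a real logarithm. *)
Lemma kl_density nu rho : nu `<< rho -> exists F : T -> R,
  [/\ measurable_fun setT F, forall x, (0 <= F x)%R,
      forall g : T -> \bar R, measurable_fun setT g -> (forall x, 0 <= g x) ->
        \int[rho]_x (g x * (F x)%:E) = \int[nu]_x g x &
      KL_divergence nu rho = \int[nu]_x (ln (F x))%:E].
Proof.
move=> numu; pose f := Radon_Nikodym_SigmaFinite.f nu rho.
have ffin x : f x \is a fin_num by exact: Radon_Nikodym_SigmaFinite.f_fin_num.
have f0 x : 0 <= f x by exact: Radon_Nikodym_SigmaFinite.f_ge0.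
have mf : measurable_fun setT f.
  exact: measurable_int (Radon_Nikodym_SigmaFinite.f_integrable _).
have mF : measurable_fun setT (fine \o f) by exact: measurableT_comp.
have fF x : f x = (fine (f x))%:E by rewrite fineK.
have cov (g : T -> \bar R) : measurable_fun setT g -> (forall x, 0 <= g x) ->
    \int[rho]_x (g x * (fine (f x))%:E) = \int[nu]_x g x.
  move=> mg g0; under eq_integral do rewrite -fF.
  exact: Radon_Nikodym_SigmaFinite.change_of_variables.
exists (fine \o f); split => // [x|]; first by rewrite /= fine_ge0.
have mA : measurable [set x | f x = 0].
  have -> : [set x | f x = 0] = setT `&` f @^-1` [set 0] by rewrite setTI.
  exact: mf.
have nuA : nu [set x | f x = 0] = 0.
  rewrite (Radon_Nikodym_SigmaFinite.f_integral numu mA).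
  by rewrite integral0_eq.
rewrite /KL_divergence asboolT//.
apply: ae_eq_integral => //.
- pose D := 'd (charge_of_finite_measure nu) '/d rho.
  have mD : measurable_fun setT (fine \o D).
    apply: measurableT_comp => //.
    by apply: measurable_int; exact: Radon_Nikodym_integrable.
  rewrite [X in measurable_fun _ X](_ : _ = fun x => if (fine (D x) <= 0)%R
      then -oo else (ln (fine (D x)))%:E).
    apply: measurable_fun_ifT => //; first exact: measurable_fun_ler.
    by apply/measurable_EFinP; apply: measurableT_comp.
  by apply/funext => x; rewrite -[X in lne X]fineK// Radon_Nikodym_fin_num.
- by apply/measurable_EFinP; apply: measurableT_comp.
have aeR := null_dominates_ae_eq measurableT numu
   (ae_eq_Radon_Nikodym_SigmaFinite numu measurableT).
have aeA : {ae nu, forall x, f x != 0}.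
  exists [set x | f x = 0]; split => // x /=; rewrite -/f.
  by move/negP; rewrite negbK => /eqP.
move: aeR aeA; apply: filterS2 => x /(_ I) <- fx0 _.
rewrite -/f fF lne_EFin// lt_neqAle fine_ge0// andbT eq_sym.
by apply: contra fx0 => /eqP fx0; rewrite fF fx0.
Qed.

(** With [G] the logarithm of the density of [nu], [1 + (g - G) <= exp (g -
    G)]; integrate against [nu], under which [exp (- G)] cancels the density.
    The same inequality for [g = 0] shows that the negative part of [G] is
    integrable, so that the finiteness of the entropy makes [G] integrable. *)
Lemma kl_le_dual nu rho (r : R) : KL_divergence nu rho <= r%:E ->
  kl_dual_le nu rho r.
Proof.
have [numu|nn] := pselect (nu `<< rho); last first.
  by rewrite /KL_divergence asboolF.
have [F [mF F0 cov ->]] := kl_density numu => KLr g mg bg.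
pose G := @ln R \o F.
have mG : measurable_fun setT G by exact: measurableT_comp.
have mE (h : T -> R) : measurable_fun setT h ->
    measurable_fun setT (fun x => (expR (h x - G x))%:E).
  move=> mh; apply/measurable_EFinP; apply: measurableT_comp => //.
  exact: measurable_funB.
have intE (h : T -> R) : measurable_fun setT h -> norm_bounded h ->
    \int[nu]_x (expR (h x - G x))%:E <= (\int[rho]_x expR (h x))%:E.
  move=> mh bh; rewrite EFin_Rintegral; last first.
    by apply: bounded_integrable; [exact: measurable_expR_comp|exact: bounded_expR].
  rewrite -cov; [|exact: mE|by move=> x; rewrite lee_fin expR_ge0].
  apply: ge0_le_integral => //.
  - by move=> x _; rewrite mule_ge0// lee_fin ?expR_ge0.
  - by apply: emeasurable_funM; [exact: mE|exact/measurable_EFinP].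
  - by apply/measurable_EFinP; exact: measurable_expR_comp.
  - move=> x _; rewrite -EFinM lee_fin /G /=.
    have [F0'|Fx] := eqVneq (F x) 0%R; first by rewrite F0' mulr0 expR_ge0.
    have Fpos : (0 < F x)%R by rewrite lt_neqAle eq_sym Fx F0.
    by rewrite expRD expRN lnK// -mulrA mulVf// mulr1.
have iE (h : T -> R) : measurable_fun setT h -> norm_bounded h ->
    nu.-integrable setT (fun x => (expR (h x - G x))%:E).
  move=> mh bh; apply/integrableP; split; first exact: mE.
  under eq_integral do rewrite gee0_abs ?lee_fin ?expR_ge0//.
  by rewrite (le_lt_trans (intE _ mh bh))// ltry.
have iGn : nu.-integrable setT ((EFin \o G)^\-).
  apply: (le_integrable measurableT _ _ (iE (cst 0%R) _ _)) => //.
  - by apply: measurable_funeneg; exact/measurable_EFinP.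
  - move=> x _; rewrite (gee0_abs (funeneg_ge0 _ _)).
    rewrite funenegE /= -EFin_max lee_fin ger0_norm ?expR_ge0// /G /=.
    rewrite ge_max expR_ge0 andbT sub0r.
    by have := expR_ge1Dx (- ln (F x)); lra.
  - by exists 0%R => x /=; rewrite normr0.
have KLE : \int[nu]_x (EFin \o G)^\+ x < +oo.
  move: KLr; rewrite integralE.
  have /integrable_lty := iGn => /(_ measurableT) h.
  have h0 : 0 <= \int[nu]_x (EFin \o G)^\- x by apply: integral_ge0 => x _; exact: funeneg_ge0.
  rewrite leeBlDr; last by rewrite ge0_fin_numE.
  move=> /le_lt_trans; apply; rewrite lte_add_pinfty ?ltry//.
have iG : nu.-integrable setT (EFin \o G).
  rewrite [EFin \o G]funeposneg; apply: integrableB => //.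
  apply/integrableP; split; first by apply: measurable_funepos; exact/measurable_EFinP.
  by under eq_integral do rewrite gee0_abs ?funepos_ge0//.
have ig := bounded_integrable nu mg bg.
rewrite -lee_fin; apply: (@le_trans _ _ (\int[nu]_x ((g x)%:E + 1))).
  rewrite EFinD EFin_Rintegral// integralD//.
    by rewrite integral_cst//= probability_setT mule1.
  by apply: (bounded_integrable nu (g := cst 1%R)) => //; exists 1%R => x; rewrite normr1.
apply: (@le_trans _ _ (\int[nu]_x ((G x)%:E + (expR (g x - G x))%:E))).
  apply: le_integral => //.
  - apply: integrableD => //.
    by apply: (bounded_integrable nu (g := cst 1%R)) => //; exists 1%R => x; rewrite normr1.
  - by apply: integrableD => //; exact: iE.
  - move=> x _; rewrite -!EFinD lee_fin.
    by have := expR_ge1Dx (g x - G x); lra.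
rewrite integralD//; last exact: iE.
by rewrite EFinD leeD// intE.
Qed.

(** Large multiples of the indicator of a [rho]-null set show that [nu] is
    dominated by [rho]. Then the logarithm of the density, cut to [[-n, n]],
    is an admissible test function: the integral of its exponential is at most
    [1 + exp (- n)], and monotone convergence recovers the entropy. *)
Lemma dual_kl_le nu rho (r : R) : kl_dual_le nu rho r ->
  KL_divergence nu rho <= r%:E.
Proof.
move=> H.
(* If A is null for rho but not for nu, testing with K times its indicator
   gives K nu(A) <= r; K is chosen so that K nu(A) = r + 1. *)
have numu : nu `<< rho.
  apply/null_content_dominatesP => A mA rA0.
  apply/eqP/negP => /negP nA0.
  have nA : (0 < fine (nu A))%R.
    rewrite lt_neqAle eq_sym fine_ge0 ?andbT ?measure_ge0//.
    by rewrite fine_eq0 ?fin_num_measure.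
  pose K := ((r + 1) / fine (nu A))%R.
  have b1 : norm_bounded (fun x => K * \1_A x)%R.
    exists `|K|%R => x; rewrite normrM ler_piMr//.
    by rewrite indicE; case: (_ \in _); rewrite ?normr1 ?normr0.
  have m1 : measurable_fun setT (fun x => K * \1_A x)%R.
    by apply: measurable_funM => //; exact: measurable_indic.
  have := H _ m1 b1; rewrite RintegralZl//; last first.
    by apply: integrable_indic => //.
  have -> : (\int[nu]_x \1_A x = fine (nu A))%R.
    by rewrite /Rintegral integral_indic// setIT.
  rewrite divfK ?gt_eqF//.
  have -> : (\int[rho]_x expR (K * \1_A x) = 1)%R.
    rewrite -[RHS](Rintegral_probability_cst rho).
    rewrite /Rintegral; congr fine; apply: ae_eq_integral => //.
      by apply/measurable_EFinP; exact: measurable_expR_comp.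
    exists A; split => // x /= nx; apply: contrapT => Ax; apply: nx => _.
    by rewrite indicE memNset// mulr0 expR0.
  by lra.
have [F [mF F0 cov ->]] := kl_density numu.
pose G := @ln R \o F.
have mG : measurable_fun setT G by exact: measurableT_comp.
have mFE : measurable_fun setT (EFin \o F) by exact/measurable_EFinP.
have intF : \int[rho]_x (F x)%:E = 1.
  have := cov (cst 1) (measurable_cst _) (fun=> @lee01 R).
  under eq_integral do rewrite mul1e.
  by rewrite integral_cst//= probability_setT mule1.
have iGn : \int[nu]_x (EFin \o G)^\- x <= 1.
  rewrite -cov; last 2 first.
  - by apply: measurable_funeneg; exact/measurable_EFinP.
  - by move=> x; exact: funeneg_ge0.
  apply: (@le_trans _ _ (\int[rho]_x (cst 1) x)); last first.
    by rewrite integral_cst//= probability_setT mule1.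
  apply: ge0_le_integral => //.
  - by move=> x _; rewrite mule_ge0 ?funeneg_ge0// lee_fin.
  - apply: emeasurable_funM => //.
    by apply: measurable_funeneg; exact/measurable_EFinP.
  - move=> x _; rewrite funenegE /= -EFin_max -EFinM lee_fin /G /=.
    have [->|Fx] := eqVneq (F x) 0%R; first by rewrite mulr0.
    have Fpos : (0 < F x)%R by rewrite lt_neqAle eq_sym Fx F0.
    have := expR_ge1Dx (- ln (F x)); rewrite expRN lnK// => h.
    rewrite -ler_pdivlMr// mul1r ge_max invr_ge0 F0 andbT; lra.
pose c := \int[nu]_x (EFin \o G)^\- x.
have c0 : 0 <= c by apply: integral_ge0 => x _; exact: funeneg_ge0.
have cfin : c \is a fin_num by rewrite ge0_fin_numE// (le_lt_trans iGn)// ltry.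
rewrite integralE leeBlDr//.
(* The function gp n is the positive part of the logarithm, cut at n; the
   negative part, of integral c, is integrable and need not be cut. *)
pose gp (n : nat) x : R := (Num.min (Num.max (G x) 0) n%:R)%R.
have mgp n : measurable_fun setT (gp n).
  by apply: measurable_minr => //; apply: measurable_maxr.
have gp0 n x : (0 <= gp n x)%R by rewrite /gp le_min le_max lexx orbT ler0n.
have key (n : nat) : \int[nu]_x (gp n x)%:E <= r%:E + (expR (- n%:R))%:E + c.
  (* As ln 0 = 0, the set where the density vanishes is sent to - n
     explicitly. *)
  pose g x : R := if F x == 0%R then (- n%:R)%R else
    (Num.max (- n%:R) (Num.min (G x) n%:R))%R.
  have mF0 : measurable_fun setT (fun x => F x == 0%R) by exact: measurable_fun_eqr.
  have mg : measurable_fun setT g.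
    apply: measurable_fun_ifT => //.
    by apply: measurable_maxr => //; exact: measurable_minr.
  have bg : norm_bounded g.
    exists n%:R => x; rewrite /g; case: ifP => _; first by rewrite normrN ger0_norm.
    have h : (- n%:R <= n%:R :> R)%R by rewrite lerNl ge0_cp.
    by rewrite ler_norml le_max lexx/= ge_max ge_min lexx orbT andbT h.
  have := H g mg bg.
  have e1 : (\int[rho]_x expR (g x))%:E <= 1 + (expR (- n%:R))%:E.
    rewrite EFin_Rintegral; last first.
      by apply: bounded_integrable; [exact: measurable_expR_comp|exact: bounded_expR].
    apply: (@le_trans _ _ (\int[rho]_x ((F x)%:E + (expR (- n%:R))%:E))).
      apply: ge0_le_integral => //.
      - by apply/measurable_EFinP; exact: measurable_expR_comp.
      - by apply: emeasurable_funD.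
      move=> x _; rewrite -EFinD lee_fin /g; case: ifPn => Fx.
        by rewrite lerDr.
      have Fpos : (0 < F x)%R by rewrite lt_neqAle eq_sym Fx F0.
      apply: (@le_trans _ _ (Num.max (expR (- n%:R)) (F x))%R).
        case: (leP _ (Num.min _ _)%R) => _; last by rewrite le_max lexx.
        rewrite le_max; apply/orP; right.
        by rewrite -[leRHS]lnK// ler_expR ge_min lexx.
      by rewrite ge_max lerDr lerDl expR_ge0 F0.
    rewrite ge0_integralD//; last by move=> x _; rewrite lee_fin.
    by rewrite intF integral_cst//= probability_setT mule1.
  have ig := bounded_integrable nu mg bg.
  have e2 : \int[nu]_x (gp n x)%:E <= (\int[nu]_x g x)%:E + c.
    (* The function z compensates the value - n of g on the nu-null set where
       the density vanishes. *)
    pose z x : R := if F x == 0%R then n%:R else 0%R.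
    have mz : measurable_fun setT z by exact: measurable_fun_ifT.
    have z0 x : (0 <= z x)%R by rewrite /z; case: ifP.
    have iz : nu.-integrable setT (EFin \o z).
      apply: bounded_integrable => //; exists n%:R => x.
      by rewrite ger0_norm// /z; case: ifP.
    have Iz : \int[nu]_x (z x)%:E = 0.
      rewrite -cov//; last exact/measurable_EFinP.
      rewrite integral0_eq// => x _.
      by rewrite /z; case: eqP => [->|_]; rewrite ?mule0 ?mul0e.
    have iN : nu.-integrable setT (EFin \o G)^\-.
      apply/integrableP; split; first by apply: measurable_funeneg; exact/measurable_EFinP.
      by under eq_integral do rewrite gee0_abs ?funeneg_ge0//; rewrite (le_lt_trans iGn)// ltry.
    rewrite EFin_Rintegral// -[c]add0e -Iz addeCA -!integralD//; last exact: integrableD.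
    apply: le_integral => //.
    - apply: bounded_integrable => //; exists n%:R => x.
      by rewrite ger0_norm// ge_min lexx orbT.
    - by apply: integrableD => //; exact: integrableD.
    move=> x _; rewrite funenegE /= -EFin_max -!EFinD lee_fin /gp /g /z /G /=.
    case: eqP => [->|_].
      by rewrite ln0// maxxx oppr0 maxxx ge_min; lra.
    have n0 : (0 <= n%:R :> R)%R by [].
    by rewrite /Num.max /Num.min /Order.max /Order.min; do !case: ifPn; rewrite -?leNgt; lra.
  move=> h; apply: (le_trans e2); rewrite leeD2r//.
  have : (\int[nu]_x g x)%:E + 1 <= r%:E + (1 + (expR (- n%:R))%:E).
    by rewrite -EFinD (le_trans _ (leeD2l _ e1))// -EFinD lee_fin.
  rewrite -!EFinD !lee_fin; lra.
have lim : \int[nu]_x (EFin \o G)^\+ x = limn (fun n => \int[nu]_x (gp n x)%:E).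
  rewrite -monotone_convergence//.
  - apply: eq_integral => x _; apply/esym/cvg_lim => //.
    apply: cvg_near_cst; near=> n.
    rewrite funeposE /= -EFin_max; congr EFin; rewrite /gp (min_idPl _)//.
    near: n; exact: nbhs_infty_ger.
  - by move=> n; exact/measurable_EFinP.
  - by move=> n x _; rewrite lee_fin.
  - move=> x _ a b ab; rewrite lee_fin /gp le_min ge_min lexx/=.
    by rewrite ge_min ler_nat ab orbT.
have ndgp : nondecreasing_seq (fun n => \int[nu]_x (gp n x)%:E).
  move=> a b ab; apply: ge0_le_integral => //.
  - by move=> x _; rewrite lee_fin.
  - exact/measurable_EFinP.
  - exact/measurable_EFinP.
  - by move=> x _; rewrite lee_fin /gp le_min ge_min lexx/= ge_min ler_nat ab orbT.
rewrite lim; apply/lee_addgt0Pr => e e0.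
apply: lime_le; first exact: ereal_nondecreasing_is_cvgn.
near=> n; apply: (le_trans (key n)).
rewrite [leRHS]addeAC leeD2r// leeD2l// lee_fin.
have n0 : (0 < n%:R :> R)%R by near: n; exact: nbhs_infty_gtr.
rewrite expRN -[leRHS]invrK lef_pV2 ?posrE ?expR_gt0 ?invr_gt0//.
apply: (@le_trans _ _ n%:R); last by have := expR_ge1Dx (n%:R : R); lra.
near: n; exact: nbhs_infty_ger.
Unshelve. all: by end_near.
Qed.

Lemma kl_leP nu rho (r : R) :
  KL_divergence nu rho <= r%:E <-> kl_dual_le nu rho r.
Proof. by split; [exact: kl_le_dual|exact: dual_kl_le]. Qed.

End kl_dual.

(** * Powers of a probability and their mixtures *)

Section tuple_boxes.
Context {d : measure_display} {T : measurableType d} {n : nat}.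

Definition box (B : 'I_n -> set T) : set (n.-tuple T) :=
  [set x | forall i, B i (tnth x i)].

Lemma measurable_box (B : 'I_n -> set T) :
  (forall i, measurable (B i)) -> measurable (box B).
Proof.
move=> mB; rewrite (_ : box B =
    \bigcap_(i in [set: 'I_n]) ((tnth (T:=T))^~ i @^-1` B i)); last first.
  by apply/seteqP; split=> x /= h i; [move=> _|]; apply: h.
apply: fin_bigcap_measurable => // i _.
by rewrite -[X in measurable X]setTI; exact: measurable_tnth.
Qed.

Definition boxes : set (set (n.-tuple T)) :=
  [set box B | B in [set B | forall i, measurable (B i)]].

Lemma boxes_setI : setI_closed boxes.
Proof.
move=> _ _ [B mB <-] [B' mB' <-]; exists (fun i => B i `&` B' i).
  by move=> i; exact: measurableI.
apply/seteqP; split=> x /=; first by move=> h; split=> i; have [] := h i.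
by move=> [h h'] i; split.
Qed.

Lemma boxes_generate : (@measurable _ (n.-tuple T)) = <<s boxes >>.
Proof.
apply/seteqP; split; last first.
  apply: smallest_sub; first exact: sigma_algebra_measurable.
  by move=> _ [B mB <-]; exact: measurable_box.
apply: smallest_sub; first exact: smallest_sigma_algebra.
apply: (big_ind (fun S : set (set (n.-tuple T)) => S `<=` <<s boxes >>)) => //.
  by move=> A B hA hB x [/hA|/hB].
move=> i _ _ [A mA <-]; apply: sub_sigma_algebra.
exists (fun j => if j == i then A else setT).
  by move=> j; case: ifP.
apply/seteqP; split=> x /=.
  by move/(_ i); rewrite eqxx.
by move=> [_ h] j; case: ifPn => [/eqP ->|].
Qed.

(** The boxes are stable under intersection and generate the product of the
    sigma-algebras. *)
Lemma eq_measure_boxes (R : realType) (m1 m2 : {measure set (n.-tuple T) -> \bar R}) :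
  (m1 setT < +oo)%E -> (forall B, (forall i, measurable (B i)) ->
    m1 (box B) = m2 (box B)) ->
  forall A, measurable A -> m1 A = m2 A.
Proof.
move=> m1oo m12 A mA.
apply: (@measure_unique _ _ _ boxes (fun=> setT)) => //.
- exact: boxes_generate.
- exact: boxes_setI.
- by move=> i; exists (fun=> setT) => //; apply/seteqP; split.
- by rewrite bigcup_const.
- by move=> _ [B mB <-]; exact: m12.
Qed.

End tuple_boxes.

Lemma integral_mrestr d (T : measurableType d) (R : realType)
    (m : {measure set T -> \bar R}) (D : set T) (mD : measurable D)
    (f : T -> \bar R) : measurable_fun setT f -> (forall x, 0 <= f x)%E ->
  (\int[mrestr m mD]_x f x = \int[m]_(x in D) f x)%E.
Proof.
move=> mf f0; rewrite -(setUv D) ge0_integral_setU//; last 3 first.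
- exact: measurableC.
- by rewrite setUv.
- by rewrite disj_set2E setICr.
rewrite [X in (_ + X)%E](_ : _ = 0%E); last first.
  apply: null_set_integral; first exact: measurableC.
    exact: measurable_funTS.
  by rewrite /= /mrestr setICl measure0.
rewrite adde0; apply: eq_measure_integral => A mA AD.
by rewrite /= /mrestr setIidl.
Qed.

Section power_marginals.
Context {R : realType}.
Variables (mu : probability R R) (k : nat) (U : {set 'I_k}).

(** Both sides are finite measures in [A], so it is enough to compare them on
    boxes, where both are products. *)
Lemma power_restrict_box (B : 'I_k -> set R) (A : set (#|U|.-tuple R)) :
  (forall i, measurable (B i)) -> measurable A ->
  (power_probability mu k ([set x | A (tuple_restrict U x)] `&`
     [set x | forall j, j \notin U -> B j (tnth x j)]) =
   power_probability mu #|U| A * \prod_(j | j \notin U) mu (B j))%E.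
Proof.
move=> mB mA.
pose B' j := if j \in U then setT else B j.
have mB' j : measurable (B' j) by rewrite /B'; case: ifP.
have BE : [set x : k.-tuple R | forall j, j \notin U -> B j (tnth x j)] = box B'.
  apply/seteqP; split=> x h j; rewrite ?/B'.
    by case: ifPn => // jU; exact: h.
  by move=> jU; have := h j; rewrite /B' (negbTE jU).
rewrite BE; pose mr := mrestr (power_probability mu k) (measurable_box mB').
pose c := (\prod_(j | j \notin U) mu (B j))%E.
have c0 : (0 <= c)%E by apply: prode_ge0.
have cfin : c \is a fin_num.
  by apply: prode_fin_num => j _; exact: fin_num_measure.
have fc0 : 0 <= fine c by rewrite fine_ge0.
transitivity (pushforward mr (tuple_restrict U) A) => //.
transitivity (mscale (NngNum fc0) (power_probability mu #|U|) A); last first.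
  by rewrite /mscale/= fineK// muleC.
apply: eq_measure_boxes => //.
  rewrite /pushforward /mr /= /mrestr (le_lt_trans (probability_le1 _ _)) ?ltry//.
  apply: measurableI; last exact: measurable_box.
  by rewrite preimage_setT.
move=> D mD.
pose D' (j : 'I_k) := match pselect (j \in U) with
  | left jU => D (enum_rank_in jU j) | right _ => B j end.
have mD' j : measurable (D' j) by rewrite /D'; case: pselect.
rewrite /pushforward /mr /= /mrestr /mscale /=.
have RE : tuple_restrict U @^-1` box D `&` box B' = box D'.
  apply/seteqP; split=> x /=.
    move=> [h hB] j; rewrite /D'; case: pselect => [jU|nU].
      have := h (enum_rank_in jU j).
      by rewrite tnth_mktuple enum_rankK_in.
    by have := hB j; rewrite /B' (negbTE (introN idP nU)).
  move=> h; split=> [i|j].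
    rewrite tnth_mktuple; have := h (enum_val i); rewrite /D'.
    have iU := enum_valP i.
    case: pselect => // iU'; rewrite (_ : enum_rank_in _ _ = i)//.
    exact: enum_valK_in.
  rewrite /B'; case: ifPn => // jU; have := h j; rewrite /D'.
  by case: pselect => // jU'; rewrite jU' in jU.
rewrite /pushforward RE !power_probability_box// fineK// (bigID (mem U))/= muleC; congr (_ * _)%E.
  apply: eq_bigr => j jU; rewrite /D'; case: pselect => // jU'.
  by rewrite jU' in jU.
rewrite big_enum_val/=; apply: eq_bigr => i _; congr (mu _); rewrite /D'.
have iU := enum_valP i.
by case: pselect => // iU'; rewrite enum_valK_in.
Qed.

Lemma integral_power_restrict (B : 'I_k -> set R) (f : #|U|.-tuple R -> \bar R) :
  (forall i, measurable (B i)) -> measurable_fun setT f ->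
  (forall x, 0 <= f x)%E ->
  (\int[power_probability mu k]_(x in [set x | forall j, j \notin U ->
       B j (tnth x j)]) f (tuple_restrict U x) =
   \prod_(j | j \notin U) mu (B j) * \int[power_probability mu #|U|]_x f x)%E.
Proof.
move=> mB mf f0.
set E := [set x : k.-tuple R | _].
have mE : measurable E.
  rewrite (_ : E = box (fun j => if j \in U then setT else B j)).
    by apply: measurable_box => j; case: ifP.
  apply/seteqP; split=> x h j; first by case: ifPn => // jU; exact: h.
  by move=> jU; have := h j; rewrite (negbTE jU).
pose c := (\prod_(j | j \notin U) mu (B j))%E.
have c0 : (0 <= c)%E by apply: prode_ge0.
have cfin : c \is a fin_num.
  by apply: prode_fin_num => j _; exact: fin_num_measure.
have fc0 : 0 <= fine c by rewrite fine_ge0.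
rewrite -(integral_mrestr _ mE); last 2 first.
- by apply: measurableT_comp.
- by move=> x.
transitivity (\int[pushforward (mrestr (power_probability mu k) mE)
    (tuple_restrict U)]_x f x)%E.
  by rewrite ge0_integral_pushforward//; exact: measurable_tuple_restrict.
rewrite -/c -(fineK cfin) -(ge0_integral_mscale _ measurableT (NngNum fc0))//.
apply: eq_measure_integral => A mA _.
rewrite /pushforward /= /mrestr /mscale /= fineK//.
by rewrite [LHS](power_restrict_box mB mA) muleC.
Qed.

Lemma marginal_power A : measurable A ->
  marginal U (power_probability mu k) A = power_probability mu #|U| A.
Proof.
move=> mA; have mT (i : 'I_k) : measurable ([set: R] : set R) by [].
have := power_restrict_box mT mA.
rewrite [X in (_ * X)%E]big1; last by move=> j _; exact: probability_setT.
rewrite mule1 => <-; rewrite /marginal /distribution /pushforward /=; congr (power_probability mu k _).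
by apply/seteqP; split=> x //= [].
Qed.

End power_marginals.

Section mixtures.
Context {d : measure_display} {T : measurableType d} {R : realType}.
Local Open Scope ereal_scope.

(** Restricted measures are combined because this covers both uses: convex
    combinations, with full domains, and the lift of a discrete law, where
    each cell carries its own multiple of a fixed law. *)
Lemma mixture_exists (I : finType) (w : I -> R) (m : I -> probability T R)
    (D : I -> set T) : (forall i, 0 <= w i)%R -> (forall i, measurable (D i)) ->
  (\sum_i w i * fine (m i (D i)) = 1)%R ->
  exists nu : probability T R, forall f : T -> \bar R,
    measurable_fun setT f -> (forall x, 0 <= f x) ->
    \int[nu]_x f x = \sum_i (w i)%:E * \int[m i]_(x in D i) f x.
Proof.
move=> w0 mD w1.
have [i0 _|I0] := pickP I; last first.
  by move: w1; rewrite big_pred0// => /eqP; rewrite eq_sym oner_eq0.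
pose e j := nth i0 (enum I) j.
pose m' j := mscale (NngNum (w0 (e j))) (mrestr (m (e j)) (mD (e j))).
pose nu0 := msum m' (size (enum I)).
have sumE (F : I -> \bar R) : \sum_(j < size (enum I)) F (e j) = \sum_i F i.
  rewrite -(big_mkord xpredT (fun j => F (e j))) -(big_nth i0 xpredT F).
  by rewrite big_enum.
have nu1 : nu0 setT = 1.
  rewrite /nu0 /= /msum /m' /mscale /=.
  rewrite (sumE (fun i => (w i)%:E * mrestr (m i) (mD i) setT)) -w1 -sumEFin.
  apply: eq_bigr => i _; rewrite /mrestr setTI EFinM fineK//.
  by rewrite fin_num_measure.
exists (mnormalize nu0 (m i0)) => f mf f0.
transitivity (\int[nu0]_x f x).
  apply: eq_measure_integral => A mA _.
  transitivity ((if (nu0 setT == 0) || (nu0 setT == +oo) then fun B => m i0 B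
     else fun B => nu0 B * (fine (nu0 setT))^-1%:E) A) => //.
  by rewrite nu1 onee_eq0 /= invr1 mule1.
rewrite /nu0 ge0_integral_measure_sum//.
rewrite -(sumE (fun i => (w i)%:E * \int[m i]_(x in D i) f x)).
apply: eq_bigr => j _; rewrite /m' ge0_integral_mscale// integral_mrestr//.
Qed.

Lemma mixture_Rintegral (I : finType) (w : I -> R) (m : I -> probability T R)
    (D : I -> set T) (nu : probability T R) : (forall i, 0 <= w i)%R ->
  (forall i, measurable (D i)) ->
  (forall f : T -> \bar R, measurable_fun setT f -> (forall x, 0 <= f x) ->
    \int[nu]_x f x = \sum_i (w i)%:E * \int[m i]_(x in D i) f x) ->
  forall g : T -> R, measurable_fun setT g ->
    (forall i, (m i).-integrable (D i) (EFin \o g)) ->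
    nu.-integrable setT (EFin \o g) /\
    (\int[nu]_x g x = \sum_i w i * \int[m i]_(x in D i) g x)%R.
Proof.
move=> w0 mD nuE g mg ig.
have mgE : measurable_fun setT (EFin \o g) by exact/measurable_EFinP.
have ign : nu.-integrable setT (EFin \o g).
  apply/integrableP; split => //; rewrite nuE//; last exact: measurableT_comp.
  apply: lte_sum_pinfty => i _; rewrite lte_mul_pinfty ?lee_fin//.
  by have /integrableP[] := ig i.
split=> //.
have fp i : \int[m i]_(x in D i) (EFin \o g)^\+ x \is a fin_num.
  rewrite ge0_fin_numE; first exact: integral_funepos_lt_pinfty (ig i).
  by apply: integral_ge0 => x _; exact: funepos_ge0.
have fn i : \int[m i]_(x in D i) (EFin \o g)^\- x \is a fin_num.
  rewrite ge0_fin_numE; first exact: integral_funeneg_lt_pinfty (ig i).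
  by apply: integral_ge0 => x _; exact: funeneg_ge0.
rewrite /Rintegral integralE nuE ?nuE; last 4 first.
- exact: measurable_funeneg.
- by move=> x; exact: funeneg_ge0.
- exact: measurable_funepos.
- by move=> x; exact: funepos_ge0.
have Ep : \sum_i (w i)%:E * \int[m i]_(x in D i) (EFin \o g)^\+ x =
  (\sum_i w i * fine (\int[m i]_(x in D i) (EFin \o g)^\+ x))%:E.
  by rewrite -sumEFin; apply: eq_bigr => i _; rewrite EFinM fineK.
have En : \sum_i (w i)%:E * \int[m i]_(x in D i) (EFin \o g)^\- x =
  (\sum_i w i * fine (\int[m i]_(x in D i) (EFin \o g)^\- x))%:E.
  by rewrite -sumEFin; apply: eq_bigr => i _; rewrite EFinM fineK.
rewrite Ep En -EFinB/= -sumrB; apply: eq_bigr => i _.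
by rewrite -mulrBr; congr (_ * _)%R; rewrite -fineB// -integralE.
Qed.

End mixtures.

(** * Discretization and lifting *)

Section cells.
Context {R : realType} {C : finType}.
Variables (cl : R -> C) (mu : probability R R).
Hypothesis mcl : forall c, measurable (cl @^-1` [set c]).

Definition cell_weight (c : C) : R := fine (mu (cl @^-1` [set c])).

Lemma cell_weight_ge0 c : 0 <= cell_weight c.
Proof. by rewrite fine_ge0. Qed.

Definition cells k (x : k.-tuple R) : {ffun 'I_k -> C} :=
  [ffun j => cl (tnth x j)].

Definition cell_set k (c : {ffun 'I_k -> C}) : set (k.-tuple R) :=
  [set x | cells x = c].

Lemma cell_setE k (c : {ffun 'I_k -> C}) :
  cell_set c = box (fun j => cl @^-1` [set c j]).
Proof.
apply/seteqP; split=> x /=; first by move=> <- j /=; rewrite ffunE.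
by move=> h; apply/ffunP => j; rewrite ffunE; exact: h.
Qed.

Lemma measurable_cell_set k (c : {ffun 'I_k -> C}) : measurable (cell_set c).
Proof. by rewrite cell_setE; apply: measurable_box. Qed.

Lemma power_cell_set k (c : {ffun 'I_k -> C}) :
  power_probability mu k (cell_set c) = (prod_weight cell_weight c)%:E.
Proof.
rewrite cell_setE power_probability_box// /prod_weight -prodEFin.
by apply: eq_bigr => j _; rewrite fineK// fin_num_measure.
Qed.

Lemma measurable_cells k (F : {ffun 'I_k -> C} -> R) :
  measurable_fun setT (fun x => F (cells x)).
Proof.
move=> _ Y mY; rewrite setTI (_ : _ @^-1` _ =
  \bigcup_(c in [set c | F c \in Y]) cell_set c).
  apply: fin_bigcup_measurable; first exact: finite_finset.
  by move=> c _; exact: measurable_cell_set.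
apply/seteqP; split=> x /=; first by move=> Yx; exists (cells x) => //=; exact/mem_set.
by move=> [c /= /set_mem Yc ->].
Qed.

Lemma bounded_cells k (F : {ffun 'I_k -> C} -> R) :
  norm_bounded (fun x : k.-tuple R => F (cells x)).
Proof.
exists (\sum_c `|F c|) => x; rewrite (bigD1 (cells x))//= lerDl.
by apply: sumr_ge0.
Qed.

Section cell_law.
Variables (k : nat) (nu : probability (k.-tuple R) R).

Definition cell_law (c : {ffun 'I_k -> C}) : R := fine (nu (cell_set c)).

Lemma cell_law_ge0 c : 0 <= cell_law c.
Proof. by rewrite fine_ge0. Qed.

Lemma Rintegral_cells (F : {ffun 'I_k -> C} -> R) :
  \int[nu]_x F (cells x) = \sum_c cell_law c * F c.
Proof.
pose ind c (x : k.-tuple R) : R := \1_(cell_set c) x.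
have iind c : nu.-integrable setT (EFin \o ind c).
  by apply: integrable_indic => //; exact: measurable_cell_set.
transitivity (\int[nu]_x \sum_c F c * ind c x).
  apply: eq_Rintegral => x _; rewrite (bigD1 (cells x))//= big1 ?addr0.
    by rewrite /ind indicE mem_set// mulr1.
  move=> c cx; rewrite /ind indicE memNset ?mulr0// => h.
  by rewrite /cell_set /= in h; rewrite h eqxx in cx.
rewrite /Rintegral; under eq_integral do rewrite -sumEFin.
rewrite integral_sum//; last first.
  by move=> c; under eq_fun do rewrite EFinM; apply: integrableZl => //; exact: iind.
rewrite [in LHS](eq_bigr (fun c => (cell_law c * F c)%:E)) ?sumEFin//.
move=> c _; under eq_integral do rewrite EFinM.
rewrite integralZl//; last exact: iind.
rewrite integral_indic ?setIT//; last exact: measurable_cell_set.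
by rewrite /cell_law EFinM fineK ?fin_num_measure//; [rewrite muleC|exact: measurable_cell_set].
Qed.

Lemma cell_law_sum1 : \sum_c cell_law c = 1.
Proof.
have := Rintegral_cells (fun=> 1); rewrite Rintegral_probability_cst => ->.
by apply: eq_bigr => c _; rewrite mulr1.
Qed.

End cell_law.

Lemma cell_weight_sum1 : \sum_c cell_weight c = 1.
Proof.
have := cell_law_sum1 (power_probability mu 1).
under eq_bigr do rewrite /cell_law power_cell_set/= /prod_weight big_ord1.
move=> <-; rewrite (reindex (fun f : {ffun 'I_1 -> C} => f ord0)).
  by apply: eq_bigr => c _; exact.
exists (fun c => [ffun=> c]) => c _; last by rewrite ffunE.
by apply/ffunP => j; rewrite ffunE (ord1 j).
Qed.

Definition cell_restrict k (U : {set 'I_k}) (c : {ffun 'I_k -> C}) :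
  {ffun 'I_#|U| -> C} := [ffun i => c (enum_val i)].

Lemma cells_restrict k (U : {set 'I_k}) (x : k.-tuple R) :
  cells (tuple_restrict U x) = cell_restrict U (cells x).
Proof. by apply/ffunP => i; rewrite !ffunE tnth_mktuple. Qed.

Lemma prod_weight_restrict k (U : {set 'I_k}) (c : {ffun 'I_k -> C}) :
  prod_weight cell_weight (cell_restrict U c) = \prod_(j in U) cell_weight (c j).
Proof.
rewrite /prod_weight [RHS]big_enum_val/=; apply: eq_bigr => i _.
by rewrite ffunE.
Qed.

Lemma sum_cell_integrals k (m : probability (k.-tuple R) R)
    (f : k.-tuple R -> R) : m.-integrable setT (EFin \o f) ->
  \int[m]_x f x = \sum_c \int[m]_(x in cell_set c) f x.
Proof.
move=> intf.
have icell c : m.-integrable setT ((EFin \o f) \_ (cell_set c)).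
  have mc : measurable (cell_set c) by exact: measurable_cell_set.
  by apply/(integrable_mkcond _ mc); apply: integrableS intf.
rewrite /Rintegral [in RHS](eq_bigr (fun c =>
  fine (\int[m]_x ((EFin \o f) \_ (cell_set c)) x))); last first.
  by move=> c _; rewrite [in LHS]integral_mkcond.
transitivity (fine (\int[m]_x \sum_c ((EFin \o f) \_ (cell_set c)) x)).
  congr fine; apply: eq_integral => x _.
  rewrite (bigD1 (cells x))//= big1 ?adde0.
    by rewrite patchE mem_set.
  move=> c cx; rewrite patchE memNset// => h.
  by rewrite /cell_set /= in h; rewrite h eqxx in cx.
rewrite integral_sum// -sum_fine// => c _.
by apply: integrable_fin_num => //; exact: icell.
Qed.

Lemma marginal_Rintegral k (U : {set 'I_k}) (nu : probability (k.-tuple R) R)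
    (g : #|U|.-tuple R -> R) : measurable_fun setT g -> norm_bounded g ->
  \int[marginal U nu]_x g x = \int[nu]_x g (tuple_restrict U x).
Proof.
move=> mg bg; rewrite /Rintegral; congr fine.
rewrite [LHS](integral_pushforward (measurable_tuple_restrict (U := U)))//.
  exact/measurable_EFinP.
apply: (bounded_integrable nu (g := fun x => g (tuple_restrict U x))).
  by apply: measurableT_comp => //; exact: measurable_tuple_restrict.
by have [M gM] := bg; exists M => x; exact: gM.
Qed.

Section lift.
Variables (k p : nat) (y : {ffun 'I_p -> {ffun 'I_k -> C}}).
Hypothesis p_gt0 : (0 < p)%N.
Hypothesis y_gt0 : forall i j, 0 < cell_weight (y i j).

Definition cell_columns (U : {set 'I_k}) :
    {ffun 'I_p -> {ffun 'I_#|U| -> C}} :=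
  [ffun i => cell_restrict U (y i)].

Let w i : R := (p%:R * prod_weight cell_weight (y i))^-1.

Let py_gt0 i : 0 < prod_weight cell_weight (y i).
Proof. by apply: prodr_gt0 => j _; exact: y_gt0. Qed.

Let w_ge0 i : 0 <= w i.
Proof. by rewrite invr_ge0 mulr_ge0// ltW. Qed.

Let p0 : 0 < p%:R :> R. Proof. by rewrite ltr0n. Qed.

Let fine_cell i : fine (power_probability mu k (cell_set (y i))) =
  prod_weight cell_weight (y i).
Proof. by rewrite power_cell_set. Qed.

Let wD i : w i * fine (power_probability mu k (cell_set (y i))) = p%:R^-1.
Proof. by rewrite fine_cell /w; field; rewrite !gt_eqF. Qed.

(** The [i]-th row gets mass [p^-1], spread over its cell [y i] as the power
    of [mu] conditioned to that cell. *)
Definition is_lift (nu : probability (k.-tuple R) R) :=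
  forall f : k.-tuple R -> \bar R, measurable_fun setT f -> (forall x, 0 <= f x)%E ->
    (\int[nu]_x f x = \sum_i (w i)%:E *
      \int[power_probability mu k]_(x in cell_set (y i)) f x)%E.

Lemma lift_exists : exists nu, is_lift nu.
Proof.
apply: (@mixture_exists _ _ _ 'I_p w (fun=> power_probability mu k)
  (fun i => cell_set (y i)) w_ge0).
  by move=> i; exact: measurable_cell_set.
under eq_bigr do rewrite wD.
by rewrite sumr_const card_ord -[LHS]mulr_natl divff// gt_eqF.
Qed.

Variable nu : probability (k.-tuple R) R.
Hypothesis nu_lift : is_lift nu.

Let lift_Rintegral := mixture_Rintegral w_ge0
  (fun i => measurable_cell_set (y i)) nu_lift.

(** On its cell, [g] is within [e i] of [c i], and the cell of each row has
    mass [p^-1]. *)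
Lemma lift_approx (g : k.-tuple R -> R) (c e : 'I_p -> R) :
  measurable_fun setT g ->
  (forall i x, cells x = y i -> `|g x - c i| <= e i) ->
  nu.-integrable setT (EFin \o g) /\
  `|\int[nu]_x g x - p%:R^-1 * \sum_i c i| <= p%:R^-1 * \sum_i e i.
Proof.
move=> mg ge.
have mD i := measurable_cell_set (y i).
have fD i : (power_probability mu k (cell_set (y i)) < +oo)%E.
  by rewrite power_cell_set ltry.
have icst i (a : R) :
    (power_probability mu k).-integrable (cell_set (y i)) (EFin \o cst a).
  exact: finite_measure_integrable_cst.
have ig i : (power_probability mu k).-integrable (cell_set (y i)) (EFin \o g).
  apply: (le_integrable (mD i) _ _ (icst i (`|c i| + e i))).
    by apply/measurable_funTS/measurable_EFinP.
  move=> x yx /=; rewrite lee_fin [leRHS]ger0_norm.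
    by have := ge i x yx; have := ler_normD (g x - c i) (c i); rewrite subrK; lra.
  by rewrite addr_ge0//; apply: le_trans (ge i x yx).
have [ing ->] := lift_Rintegral mg ig; split => //.
rewrite !mulr_sumr -sumrB; apply: le_trans (ler_norm_sum _ _ _) _.
apply: ler_sum => i _.
have -> : w i * \int[power_probability mu k]_(x in cell_set (y i)) g x - p%:R^-1 * c i =
   w i * \int[power_probability mu k]_(x in cell_set (y i)) (g x - c i).
  rewrite RintegralB//; last exact: icst.
  by rewrite Rintegral_cst// mulrBr -(wD i); ring.
rewrite normrM ger0_norm// -(wD i) -mulrA ler_wpM2l//.
have igc : (power_probability mu k).-integrable (cell_set (y i))
    (EFin \o (fun x => g x - c i)).
  by apply: integrable_subr => //; exact: icst.
apply: (le_trans (le_normr_Rintegral _ igc)) => //.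
rewrite mulrC -Rintegral_cst//; apply: le_Rintegral => //; last exact: ge.
- exact: integrable_norm.
- exact: icst.
Qed.

(** The power of [mu] is a product over the coordinates in [U] and those
    outside, and so is a cell. *)
Lemma lift_cell (U : {set 'I_k}) (f : #|U|.-tuple R -> R) i :
  measurable_fun setT f -> norm_bounded f -> (forall x, 0 <= f x) ->
  \int[power_probability mu k]_(x in cell_set (y i)) f (tuple_restrict U x) =
  (\prod_(j | j \notin U) cell_weight (y i j)) *
  \int[power_probability mu #|U|]_(x in cell_set (cell_columns U i)) f x.
Proof.
move=> mf bf f0.
pose B j := cl @^-1` [set y i j].
have mB j : measurable (B j) by exact: mcl.
have mDU := measurable_cell_set (cell_columns U i).
have mfD : measurable_fun setT ((EFin \o f) \_ (cell_set (cell_columns U i))).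
  by apply/(measurable_restrictT _ _).1 => //; exact/measurable_funTS/measurable_EFinP.
have f0D x : (0 <= ((EFin \o f) \_ (cell_set (cell_columns U i))) x)%E.
  by apply: erestrict_ge0 => ? _; rewrite lee_fin.
have := integral_power_restrict mu mB mfD f0D.
rewrite -integral_mkcond => E.
rewrite /Rintegral -[X in X * _]/(fine (_%:E)) -prodEFin -fineM; last 2 first.
- by rewrite prode_fin_num.
- apply: integrable_fin_num => //; apply: integrableS (bounded_integrable _ mf bf) => //.
rewrite (eq_bigr (fun j => mu (B j))); last first.
  by move=> j _; rewrite fineK// fin_num_measure.
rewrite -[in RHS]E; congr fine.
rewrite integral_mkcond [RHS]integral_mkcond; apply: eq_integral => x _.
rewrite !patchE.
case: ifPn => [/set_mem yx|nyx].
  rewrite mem_set; last by move=> j jU; rewrite /B /= -yx ffunE.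
  by rewrite mem_set// /cell_set /= cells_restrict yx ffunE.
case: ifPn => // /set_mem h; rewrite memNset// => h'.
move/negP: nyx; apply; rewrite inE /cell_set /=; apply/ffunP => j.
rewrite ffunE; have [jU|jU] := boolP (j \in U); last exact: h.
move: h'; rewrite /cell_set /= cells_restrict ffunE => /ffunP/(_ (enum_rank_in jU j)).
by rewrite !ffunE enum_rankK_in.
Qed.

(** The lift has on each cell a constant density with respect to the power of
    [mu], and so do its marginals; this makes the entropy of a marginal equal
    to that of the frequencies of the cells. The dual form needs one
    inequality per row: [1 + (G - ln h) <= exp (G - ln h)] on the cell of that
    row. *)
Lemma lift_kl (U : {set 'I_k}) (r : R) :
  \sum_i ln (freq R (cell_columns U) (cell_columns U i) /
     prod_weight cell_weight (cell_columns U i)) <= p%:R * r ->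
  kl_dual_le (marginal U nu) (power_probability mu #|U|) r.
Proof.
move=> Hr g mg bg.
pose yU := cell_columns U.
pose h i : R := freq R yU (yU i) / prod_weight cell_weight (yU i).
have wU i : prod_weight cell_weight (yU i) = \prod_(j in U) cell_weight (y i j).
  by rewrite ffunE prod_weight_restrict.
have wU0 i : 0 < prod_weight cell_weight (yU i).
  by rewrite wU; apply: prodr_gt0 => j _.
have f_gt0 i : 0 < freq R yU (yU i) by exact: freq_gt0.
have h0 i : 0 < h i by rewrite divr_gt0.
pose G x := g (tuple_restrict U x).
have mG : measurable_fun setT G.
  by apply: measurableT_comp => //; exact: measurable_tuple_restrict.
have bG : norm_bounded G by have [M gM] := bg; exists M => x; exact: gM.
have mD i := measurable_cell_set (y i).
have iS i (f : k.-tuple R -> R) : measurable_fun setT f -> norm_bounded f ->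
    (power_probability mu k).-integrable (cell_set (y i)) (EFin \o f).
  by move=> mf bf; apply: integrableS (bounded_integrable _ mf bf).
have mE := measurable_expR_comp mg; have bE := bounded_expR bg.
have mEG := measurable_expR_comp mG; have bEG := bounded_expR bG.
rewrite marginal_Rintegral//.
have [_ ->] := lift_Rintegral mG (fun i => iS i _ mG bG).
pose J b : R := \int[power_probability mu #|U|]_(x in cell_set b) expR (g x).
have J0 b : 0 <= J b by apply: Rintegral_ge0 => x _; exact: expR_ge0.
(* Here h i is the value of the density of the marginal on the cell of row i. *)
have step i : w i * \int[power_probability mu k]_(x in cell_set (y i)) G x + p%:R^-1
    <= p%:R^-1 * ln (h i) + p%:R^-1 * (J (yU i) / freq R yU (yU i)).
  have -> : p%:R^-1 * (J (yU i) / freq R yU (yU i)) = w i *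
      ((h i)^-1 * \int[power_probability mu k]_(x in cell_set (y i)) expR (G x)).
    rewrite (lift_cell i mE bE) => [|x]; last exact: expR_ge0.
    rewrite -/(J _) /w /h wU /prod_weight (bigID (mem U))/=.
    have a0 : \prod_(j in U) cell_weight (y i j) != 0 by rewrite -wU gt_eqF.
    have b0 : \prod_(j | j \notin U) cell_weight (y i j) != 0.
      by rewrite gt_eqF// prodr_gt0.
    by field; rewrite a0 b0 !gt_eqF.
  rewrite -{1}(wD i) -{1}(wD i) -[w i * _ * ln _]mulrA -!mulrDr ler_wpM2l//.
  have icst (a : R) : (power_probability mu k).-integrable (cell_set (y i)) (EFin \o cst a).
    by exact: finite_measure_integrable_cst.
  rewrite -[X in _ + X <= _]mul1r -Rintegral_cst// [X in _ <= X + _]mulrC -Rintegral_cst//.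
  rewrite -RintegralD//; [|exact: iS|exact: icst].
  rewrite -RintegralZl//; last exact: iS.
  rewrite -RintegralD//; last 2 first.
  - exact: icst.
  - by apply: integrable_scaler => //; exact: iS.
  apply: le_Rintegral => //.
  - by apply: integrable_addr => //; [exact: iS|exact: icst].
  - by apply: integrable_addr => //; [exact: icst|apply: integrable_scaler => //; exact: iS].
  - move=> x _; have := expR_ge1Dx (G x - ln (h i)).
    rewrite expRD expRN lnK ?posrE// [X in _ <= X -> _]mulrC /=.
    move=> H; rewrite addrC; lra.
have p1 : \sum_(i < p) p%:R^-1 = 1 :> R.
  by rewrite sumr_const card_ord -[LHS]mulr_natl divff// gt_eqF.
rewrite -[X in _ + X <= _]p1 -big_split/=.
apply: (le_trans (ler_sum _ (fun i _ => step i))).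
rewrite big_split/= -!mulr_sumr lerD//.
  by rewrite ler_pdivrMl.
rewrite (sum_comp_freq p_gt0 yU (fun b => J b / freq R yU b)) mulrA mulVf ?gt_eqF// mul1r.
rewrite (sum_cell_integrals (bounded_integrable _ mE bE)).
apply: ler_sum => b _; rewrite mulrCA -/(J b).
have [->|f0] := eqVneq (freq R yU b) 0; first by rewrite mul0r mulr0.
by rewrite divff// mulr1.
Qed.

End lift.
End cells.

(** * The admissible laws and their second moments *)

Section power_coordinates.
Context {R : realType}.
Variable mu : probability R R.

Lemma integral_power_coordinate n (i : 'I_n) (f : R -> \bar R) :
  measurable_fun setT f -> (forall x, 0 <= f x)%E ->
  (\int[power_probability mu n]_x f (tnth x i) = \int[mu]_x f x)%E.
Proof.
move=> mf f0; pose c (x : n.-tuple R) := tnth x i.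
have mc : measurable_fun setT c by exact: measurable_tnth.
transitivity (\int[pushforward (power_probability mu n) c]_x f x)%E.
  by rewrite ge0_integral_pushforward.
apply: eq_measure_integral => A mA _; rewrite /pushforward.
have mB (j : 'I_n) : measurable (if j == i then A else setT) by case: ifP.
transitivity (power_probability mu n
    [set x | forall j, (if j == i then A else setT) (tnth x j)]).
  congr (power_probability mu n _); apply/seteqP; split=> x /=.
    by move=> Ax j; case: ifPn => // /eqP ->.
  by move/(_ i); rewrite eqxx.
rewrite (power_probability_box mu mB) (bigD1 i)//= eqxx big1 ?mule1// => j /negbTE ->.
exact: probability_setT.
Qed.

Lemma kl_dual_le_power k (U : {set 'I_k}) :
  kl_dual_le (marginal U (power_probability mu k)) (power_probability mu #|U|) 0.
Proof.
move=> g mg bg.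
have -> : \int[marginal U (power_probability mu k)]_x g x =
    \int[power_probability mu #|U|]_x g x.
  rewrite /Rintegral; congr fine; apply: eq_measure_integral => A mA _.
  exact: marginal_power.
have ig := bounded_integrable (power_probability mu #|U|) mg bg.
have ie := bounded_integrable (power_probability mu #|U|)
  (measurable_expR_comp mg) (bounded_expR bg).
have i1 : (power_probability mu #|U|).-integrable setT (EFin \o cst 1%R).
  by apply: (bounded_integrable _ (g := cst 1)) => //; exists 1 => x; rewrite normr1.
rewrite add0r -[X in _ + X <= _](Rintegral_probability_cst (power_probability mu #|U|) 1).
rewrite -RintegralD//; apply: le_Rintegral => //; first exact: integrable_addr.
by move=> x _; rewrite addrC expR_ge1Dx.
Qed.

End power_coordinates.

Section gamma.
Context {R : realType}.
Variables (k : nat) (beta t0 : R) (mu : probability R R).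
Hypothesis t0_gt0 : 0 < t0.
Hypothesis exp_moment : (\int[mu]_x (expR (t0 * x ^+ 2))%:E < +oo)%E.
Implicit Types (nu : probability (k.-tuple R) R) (U : {set 'I_k}).

Definition exp_mass : R := fine (\int[mu]_x (expR (t0 * x ^+ 2))%:E)%E.

Lemma measurable_expsqr : measurable_fun setT (fun x : R => expR (t0 * x ^+ 2)).
Proof.
by apply: measurableT_comp => //; apply: measurable_funM.
Qed.

Lemma exp_massE : (exp_mass%:E = \int[mu]_x (expR (t0 * x ^+ 2))%:E)%E.
Proof.
rewrite fineK// ge0_fin_numE//.
by apply: integral_ge0 => x _; rewrite lee_fin expR_ge0.
Qed.

Lemma exp_mass_ge1 : 1 <= exp_mass.
Proof.
rewrite -lee_fin exp_massE; apply: (@le_trans _ _ (\int[mu]_x (cst 1%E x))%E).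
  by rewrite integral_cst//= probability_setT mule1.
apply: ge0_le_integral => //.
- by apply/measurable_EFinP; exact: measurable_expsqr.
- move=> x _ /=; rewrite lee_fin -[leLHS]expR0 ler_expR.
  by rewrite mulr_ge0 ?sqr_ge0// ltW.
Qed.

(** Test the dual inequality on [t0 min (x_j^2, n)], whose exponential has
    mean at most [exp_mass], and let [n] tend to infinity. *)
Lemma kl_energy nu (j : 'I_k) (U : {set 'I_k}) (r : R) : j \in U ->
  kl_dual_le (marginal U nu) (power_probability mu #|U|) r ->
  (\int[nu]_x ((tnth x j) ^+ 2)%:E <= ((r + exp_mass) / t0)%:E)%E.
Proof.
move=> jU H.
pose s (n : nat) (a : R) : R := Num.min (a ^+ 2) n%:R.
have ms n : measurable_fun setT (s n).
  by apply: measurable_minr => //; exact: measurable_funX.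
have s0 n a : 0 <= s n a by rewrite le_min sqr_ge0 ler0n.
pose i := enum_rank_in jU j.
have key (n : nat) : (\int[nu]_x (s n (tnth x j))%:E <= ((r + exp_mass) / t0)%:E)%E.
  pose g (x : #|U|.-tuple R) : R := t0 * s n (tnth x i).
  have mc : measurable_fun setT (fun x : #|U|.-tuple R => s n (tnth x i)).
    by apply: measurableT_comp => //; exact: measurable_tnth.
  have mg : measurable_fun setT g by exact: measurable_funM.
  have bg : norm_bounded g.
    exists (t0 * n%:R) => x; rewrite /g ger0_norm; last by rewrite mulr_ge0// ltW.
    by rewrite ler_pM2l// ge_min lexx orbT.
  have := H g mg bg; rewrite marginal_Rintegral//.
  have mcj : measurable_fun setT (fun x : k.-tuple R => s n (tnth x j)).
    by apply: measurableT_comp => //; exact: measurable_tnth.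
  have iS : nu.-integrable setT (EFin \o (fun x => s n (tnth x j))).
    apply: bounded_integrable => //; exists n%:R => x.
    by rewrite ger0_norm// ge_min lexx orbT.
  have -> : \int[nu]_x g (tuple_restrict U x) = t0 * \int[nu]_x s n (tnth x j).
    rewrite -RintegralZl//; apply: eq_Rintegral => x _.
    by rewrite /g tnth_mktuple enum_rankK_in.
  have hE : \int[power_probability mu #|U|]_x expR (g x) <= exp_mass.
    rewrite -lee_fin EFin_Rintegral; last first.
      by apply: bounded_integrable; [exact: measurable_expR_comp|exact: bounded_expR].
    rewrite exp_massE /g.
    rewrite (integral_power_coordinate mu i (f := fun a => (expR (t0 * s n a))%:E)); last 2 first.
    - by apply/measurable_EFinP; apply: measurableT_comp => //; exact: measurable_funM.
    - by move=> a; rewrite lee_fin expR_ge0.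
    apply: ge0_le_integral => //.
    - by apply/measurable_EFinP; apply: measurableT_comp => //; exact: measurable_funM.
    - by apply/measurable_EFinP; exact: measurable_expsqr.
    - by move=> x _; rewrite lee_fin ler_expR ler_pM2l// ge_min lexx.
  move=> h; rewrite -EFin_Rintegral// lee_fin ler_pdivlMr//; lra.
have mX : measurable_fun setT (fun x : k.-tuple R => (tnth x j) ^+ 2).
  by apply: measurable_funX; exact: measurable_tnth.
have mSn n : measurable_fun setT (fun x : k.-tuple R => (s n (tnth x j))%:E).
  by apply/measurable_EFinP; apply: measurableT_comp => //; exact: measurable_tnth.
have nd x : nondecreasing_seq (fun n => (s n (tnth x j))%:E).
  by move=> a b ab; rewrite lee_fin le_min ge_min lexx/= ge_min ler_nat ab orbT.
have -> : (\int[nu]_x ((tnth x j) ^+ 2)%:E = limn (fun n => \int[nu]_x (s n (tnth x j))%:E))%E.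
  rewrite -monotone_convergence//; last by move=> n x _; rewrite lee_fin.
  apply: eq_integral => x _; apply/esym/cvg_lim => //.
  apply: cvg_near_cst; near=> n; congr EFin; rewrite /s (min_idPl _)//.
  near: n; exact: nbhs_infty_ger.
apply: lime_le.
  apply: ereal_nondecreasing_is_cvgn => a b ab; apply: ge0_le_integral => //.
  - by move=> x _; rewrite lee_fin.
  - by move=> x _; exact: nd.
by near=> n; exact: key.
Unshelve. all: by end_near.
Qed.

(** The admissible laws, with the entropy constraints in dual form;
    [kl_energy] makes their second moments finite, whence [M_setP]. *)
Definition dual_M nu := forall U, U != finset.set0 ->
  kl_dual_le (marginal U nu) (power_probability mu #|U|) (#|U|%:R / beta).

Definition energy_bound (r : R) : R := (r + exp_mass) / t0.

Definition bounded_energy (E : R) nu := forall j,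
  (\int[nu]_x ((tnth x j) ^+ 2)%:E <= E%:E)%E.

Lemma dual_energy nu (r : R) :
  (forall U, U != finset.set0 ->
    kl_dual_le (marginal U nu) (power_probability mu #|U|) (#|U|%:R * r)) ->
  bounded_energy (energy_bound r) nu.
Proof.
move=> H j; apply: (@kl_energy nu j [set j]%SET); first by rewrite inE.
rewrite -[X in kl_dual_le _ _ X]mul1r -[X in X * r]/(1%:R) -[in 1%:R](cards1 j).
apply: H; apply/eqP => /setP/(_ j).
by rewrite !inE eqxx.
Qed.

Lemma dual_M_energy nu : dual_M nu -> bounded_energy (energy_bound beta^-1) nu.
Proof. exact: dual_energy. Qed.

Lemma bounded_energy_sqr E nu j : bounded_energy E nu ->
  nu.-integrable setT (EFin \o (fun x => (tnth x j) ^+ 2)).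
Proof.
move=> nE; apply/integrableP; split.
  by apply/measurable_EFinP/measurable_funX; exact: measurable_tnth.
under eq_integral do rewrite gee0_abs ?lee_fin ?sqr_ge0//.
by rewrite (le_lt_trans (nE j))// ltry.
Qed.

Lemma measurable_coordinate_product i j :
  measurable_fun setT (fun x : k.-tuple R => tnth x i * tnth x j).
Proof. by apply: measurable_funM; exact: measurable_tnth. Qed.

Lemma norm_product_le (a b : R) : `|a * b| <= 2^-1 * (a ^+ 2 + b ^+ 2).
Proof.
rewrite normrM -[a ^+ 2]real_normK ?num_real// -[b ^+ 2]real_normK ?num_real//.
by have := sqr_ge0 (`|a| - `|b|); rewrite !expr2; lra.
Qed.

Lemma bounded_energy_product E nu i j : bounded_energy E nu ->
  nu.-integrable setT (EFin \o (fun x => tnth x i * tnth x j)).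
Proof.
move=> nE; have iD : nu.-integrable setT (EFin \o (fun x =>
    2^-1 * ((tnth x i) ^+ 2 + (tnth x j) ^+ 2))).
  apply: integrable_scaler => //; apply: integrable_addr => //;
  exact: bounded_energy_sqr nE.
apply: (le_integrable measurableT _ _ iD).
  by apply/measurable_EFinP; exact: measurable_coordinate_product.
move=> x _ /=; rewrite lee_fin; apply: le_trans (norm_product_le _ _) _.
exact: ler_norm.
Qed.

Lemma second_moment_bound E nu i j : bounded_energy E nu ->
  `|second_moment_mx nu i j| <= E.
Proof.
move=> nE; rewrite mxE.
have hE l : \int[nu]_x ((tnth x l) ^+ 2) <= E.
  by rewrite -lee_fin EFin_Rintegral; [exact: nE|exact: bounded_energy_sqr nE].
have iab := bounded_energy_product i j nE.
have iD : nu.-integrable setT (EFin \o (fun x =>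
    2^-1 * ((tnth x i) ^+ 2 + (tnth x j) ^+ 2))).
  apply: integrable_scaler => //; apply: integrable_addr => //;
  exact: bounded_energy_sqr nE.
apply: (le_trans (le_normr_Rintegral _ iab)) => //.
apply: (@le_trans _ _ (\int[nu]_x (2^-1 * ((tnth x i) ^+ 2 + (tnth x j) ^+ 2)))).
  apply: le_Rintegral => //; first exact: integrable_norm.
  by move=> x _; exact: norm_product_le.
rewrite RintegralZl//; last first.
  by apply: integrable_addr => //; exact: bounded_energy_sqr nE.
rewrite RintegralD//; [|exact: bounded_energy_sqr nE..].
have := hE i; have := hE j; lra.
Qed.

Lemma M_setP nu : M_set k beta mu nu <-> dual_M nu.
Proof.
split; first by move=> [_ H] U U0; apply/kl_leP; exact: H.
move=> H; split=> [|U U0]; last by apply/kl_leP; exact: H.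
have nE := dual_M_energy H.
rewrite /finite_second_moment; under eq_integral do rewrite -sumEFin.
rewrite ge0_integral_sum//.
- by apply: lte_sum_pinfty => j _; rewrite (le_lt_trans (nE j))// ltry.
- by move=> j; apply/measurable_EFinP/measurable_funX; exact: measurable_tnth.
- by move=> j x _; rewrite lee_fin sqr_ge0.
Qed.

(** The mixture is described by the integrals of real functions, the form in
    which both the dual constraints and the second moments use it. *)
Lemma convex_combination nu1 nu2 (t : R) : 0 <= t <= 1 ->
  exists nu, forall g : k.-tuple R -> R, measurable_fun setT g ->
    nu1.-integrable setT (EFin \o g) -> nu2.-integrable setT (EFin \o g) ->
    nu.-integrable setT (EFin \o g) /\
    \int[nu]_x g x = t * \int[nu1]_x g x + (1 - t) * \int[nu2]_x g x.
Proof.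
move=> /andP[t_ge0 t_le1].
pose w (b : bool) : R := if b then t else 1 - t.
pose m (b : bool) := if b then nu1 else nu2.
have w0 b : 0 <= w b by case: b; rewrite //= subr_ge0.
have mT (b : bool) : measurable ([set: k.-tuple R] : set (k.-tuple R)) by [].
have w1 : \sum_b w b * fine (m b setT) = 1.
  by rewrite big_bool /= !probability_setT /=; ring.
have [nu nuE] := mixture_exists w0 mT w1.
exists nu => g mg i1 i2.
have im b : (m b).-integrable setT (EFin \o g) by case: b.
have [ig ->] := mixture_Rintegral w0 mT nuE mg im.
by split=> //; rewrite big_bool.
Qed.

Lemma convex_combination_dual nu1 nu2 nu (t : R) U r1 r2 : 0 <= t <= 1 ->
  (forall g : k.-tuple R -> R, measurable_fun setT g ->
    nu1.-integrable setT (EFin \o g) -> nu2.-integrable setT (EFin \o g) ->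
    nu.-integrable setT (EFin \o g) /\
    \int[nu]_x g x = t * \int[nu1]_x g x + (1 - t) * \int[nu2]_x g x) ->
  kl_dual_le (marginal U nu1) (power_probability mu #|U|) r1 ->
  kl_dual_le (marginal U nu2) (power_probability mu #|U|) r2 ->
  kl_dual_le (marginal U nu) (power_probability mu #|U|) (t * r1 + (1 - t) * r2).
Proof.
move=> /andP[t_ge0 t_le1] nuE H1 H2 g mg bg.
have := H1 g mg bg; have := H2 g mg bg; rewrite !marginal_Rintegral//.
pose G x := g (tuple_restrict U x).
have mG : measurable_fun setT G.
  by apply: measurableT_comp => //; exact: measurable_tuple_restrict.
have bG : norm_bounded G by have [M gM] := bg; exists M => x; exact: gM.
have [_ ->] := nuE G mG (bounded_integrable nu1 mG bG) (bounded_integrable nu2 mG bG).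
rewrite -/(G _); set I1 := Rintegral nu1 _ _; set I2 := Rintegral nu2 _ _.
set J := Rintegral _ _ _; nra.
Qed.

(** The dual entropy constraints are affine, and so is the second moment
    matrix. *)
Lemma Gamma_convex : convex_set (Gamma_set k beta mu).
Proof.
move=> A B l; rewrite !inE => -[nu1 /M_setP M1 <-] [nu2 /M_setP M2 <-].
have t01 : 0 <= (l%:num : R) <= 1 by apply/andP; split; [exact: ge0|exact: le1].
have [nu nuE] := convex_combination nu1 nu2 t01.
exists nu.
  apply/M_setP => U U0; have := convex_combination_dual t01 nuE (M1 U U0) (M2 U U0).
  by rewrite -mulrDl addrC subrK mul1r.
apply/matrixP => i j; rewrite !mxE.
have [_ ->] := nuE _ (measurable_coordinate_product i j)
  (bounded_energy_product i j (dual_M_energy M1))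
  (bounded_energy_product i j (dual_M_energy M2)).
by [].
Qed.

Lemma power_in_M : 0 < beta -> dual_M (power_probability mu k).
Proof.
move=> b0 U U0 g mg bg; have := @kl_dual_le_power _ mu k U g mg bg.
have : 0 <= #|U|%:R / beta by rewrite divr_ge0// ltW.
lra.
Qed.

End gamma.

(** * The Frobenius distance *)

Section frobenius.
Context {R : realType}.

(** The triangle inequality of the Euclidean norm, from the Cauchy-Schwarz
    inequality [CS]. *)
Lemma minkowski_sqr (I : finType) (f g : I -> R) :
  Num.sqrt (\sum_i (f i + g i) ^+ 2) <=
  Num.sqrt (\sum_i f i ^+ 2) + Num.sqrt (\sum_i g i ^+ 2).
Proof.
set a := Num.sqrt (\sum_i f i ^+ 2); set b := Num.sqrt (\sum_i g i ^+ 2).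
have S0 (h : I -> R) : 0 <= \sum_i h i ^+ 2 by apply: sumr_ge0 => i _; exact: sqr_ge0.
have a0 : 0 <= a by exact: sqrtr_ge0.
have b0 : 0 <= b by exact: sqrtr_ge0.
have aE : a ^+ 2 = \sum_i f i ^+ 2 by rewrite sqr_sqrtr.
have bE : b ^+ 2 = \sum_i g i ^+ 2 by rewrite sqr_sqrtr.
have CS : \sum_i f i * g i <= a * b.
  have [az|an] := eqVneq a 0.
    rewrite az mul0r; have f0 i : f i = 0.
      apply/eqP; rewrite -sqrf_eq0; move: aE; rewrite az expr0n/= => /esym/eqP.
      by rewrite psumr_eq0 => [/allP/(_ i (mem_index_enum _))/implyP|j _]; [exact|exact: sqr_ge0].
    by rewrite big1// => i _; rewrite f0 mul0r.
  have [bz|bn] := eqVneq b 0.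
    rewrite bz mulr0; have g0 i : g i = 0.
      apply/eqP; rewrite -sqrf_eq0; move: bE; rewrite bz expr0n/= => /esym/eqP.
      by rewrite psumr_eq0 => [/allP/(_ i (mem_index_enum _))/implyP|j _]; [exact|exact: sqr_ge0].
    by rewrite big1// => i _; rewrite g0 mulr0.
  have ab : 0 < a * b by rewrite mulr_gt0// lt_neqAle eq_sym ?an ?bn.
  have : 0 <= \sum_i (b * f i - a * g i) ^+ 2 by exact: S0.
  have -> : \sum_i (b * f i - a * g i) ^+ 2 =
      b ^+ 2 * (\sum_i f i ^+ 2) + a ^+ 2 * (\sum_i g i ^+ 2)
      - (2 * (a * b)) * \sum_i f i * g i.
    rewrite !mulr_sumr -big_split/= -sumrB; apply: eq_bigr => i _; ring.
  rewrite -aE -bE => h.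
  rewrite -(ler_pM2l ab); nra.
rewrite -(@ler_pXn2r _ 2)// ?nnegrE ?sqrtr_ge0 ?addr_ge0// sqr_sqrtr//.
have -> : \sum_i (f i + g i) ^+ 2 = a ^+ 2 + b ^+ 2 + 2 * \sum_i f i * g i.
  rewrite aE bE mulr_sumr -!big_split/=; apply: eq_bigr => i _; ring.
nra.
Qed.

Variable k : nat.
Implicit Types A B : 'M[R]_k.

Lemma frobenius_triangle A B C : frobenius_distance A C <=
  frobenius_distance A B + frobenius_distance B C.
Proof.
rewrite /frobenius_distance !pair_big/=.
have := @minkowski_sqr ('I_k * 'I_k)%type (fun i => A i.1 i.2 - B i.1 i.2)
  (fun i => B i.1 i.2 - C i.1 i.2).
rewrite /=; under eq_bigr => i _ do rewrite addrA subrK.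
exact.
Qed.

Lemma frobenius_sym A B : frobenius_distance A B = frobenius_distance B A.
Proof.
rewrite /frobenius_distance; congr Num.sqrt; apply: eq_bigr => i _.
by apply: eq_bigr => j _; rewrite -sqrrN opprB.
Qed.

Lemma frobenius_le A B (e : R) : 0 <= e -> (forall i j, `|A i j - B i j| <= e) ->
  frobenius_distance A B <= k%:R * e.
Proof.
move=> e0 h; rewrite -[leRHS]ger0_norm ?mulr_ge0// -sqrtr_sqr ler_sqrt ?sqr_ge0//.
have -> : (k%:R * e) ^+ 2 = \sum_(i < k) \sum_(j < k) e ^+ 2.
  by rewrite !sumr_const card_ord exprMn -mulrnA -[RHS]mulr_natl natrM expr2.
apply: ler_sum => i _; apply: ler_sum => j _.
by rewrite -[leLHS]real_normK ?num_real// lerXn2r ?nnegrE.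
Qed.

(** Round all the entries to a mesh [h]: finitely many roundings occur, and
    two matrices with the same rounding are within [k h] of each other. One
    representative is chosen in [G] for each rounding that occurs. *)
Lemma bounded_totally_bounded (G : set 'M[R]_k) (C : R) :
  (forall A, G A -> forall i j, `|A i j| <= C) ->
  totally_bounded (@frobenius_distance R k) G.
Proof.
move=> GC e e0.
have C1 : 0 < `|C| + 1 by rewrite ltr_pwDr.
pose h := e / (k.+1)%:R.
have h0 : 0 < h by rewrite divr_gt0.
pose q (a : R) := Num.truncn ((a + (`|C| + 1)) / h).
pose N := q (`|C| + 1).
pose phi A : {ffun 'I_k * 'I_k -> 'I_N.+1} := [ffun ij => inord (q (A ij.1 ij.2))].
have close A B : G A -> G B -> phi A = phi B -> frobenius_distance A B < e.
  move=> GA GB AB; apply: (@le_lt_trans _ _ (k%:R * h)); last first.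
    by rewrite /h mulrA ltr_pdivrMr// mulrC ltr_pM2l// ltr_nat.
  apply: frobenius_le; first exact: ltW.
  move=> i j; move/ffunP/(_ (i, j)): AB; rewrite !ffunE /= => /(congr1 val) /=.
  have qN D : G D -> (q (D i j) < N.+1)%N.
    move=> GD; rewrite ltnS; apply: le_truncn; rewrite ler_pM2r ?invr_gt0//.
    by rewrite lerD2r (le_trans (ler_norm _))// (le_trans (GC _ GD _ _))// ler_wpDr// ler_norm.
  rewrite !inordK ?qN// => qAB.
  have bnd D : G D -> (q (D i j))%:R * h <= D i j + (`|C| + 1) < ((q (D i j))%:R + 1) * h.
    move=> GD; have D0 : 0 <= (D i j + (`|C| + 1)) / h.
      rewrite divr_ge0 ?ltW//; have := GC _ GD i j; rewrite ler_norml.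
      by have := ler_norm C; lra.
    have := truncn_itv D0; rewrite -/(q _) => /andP[l1 l2].
    by rewrite -ler_pdivlMr// l1 -ltr_pdivrMr// natr1.
  have := bnd _ GA; have := bnd _ GB; rewrite qAB => /andP[b1 b2] /andP[a1 a2].
  rewrite ler_norml; apply/andP; split; lra.
pose has_rep v := `[< exists2 A, G A & phi A = v >].
pose rep v : 'M[R]_k := if pselect (exists2 A, G A & phi A = v) is left H
  then sval (cid2 H) else 0.
have repP v : has_rep v -> G (rep v) /\ phi (rep v) = v.
  move=> /asboolP H; rewrite /rep; case: pselect => // H'.
  by case: cid2.
exists [seq rep v | v <- enum [pred v | has_rep v]]; split.
  move=> A /mapP[v]; rewrite mem_enum inE => vr ->.
  by have [] := repP v (introT (asboolP _) vr).
move=> A GA; have vr : has_rep (phi A) by apply/asboolP; exists A.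
have [Gr rE] := repP _ vr.
exists (rep (phi A)); last exact: close.
by apply/mapP; exists (phi A) => //; rewrite mem_enum; exact: vr.
Qed.

End frobenius.

(** * A logarithmic grid of the line *)

Section grid.
Context {R : realType}.
Variables (kap : R) (m : nat).
Hypothesis kap_gt0 : 0 < kap.

Local Notation step := (ln (1 + kap)).

(** The integer part of the logarithm of [1 + `|x|] in base [1 + kap]. *)
Definition level (x : R) : nat := Num.truncn (ln (1 + `|x|) / step).

(** The sign and the level, the levels from [m] on being merged: the cells of
    level below [m] have relative width [kap], and the number of cells up to a
    radius [r] is only logarithmic in [r]. *)
Definition grid_cell (x : R) : (bool * 'I_m.+1)%type :=
  (x < 0, inord (minn (level x) m)).

Definition grid_radius (l : nat) : R := (1 + kap) ^+ l - 1.

(** The point of the cell nearest to [0]. Rounding towards [0] never increases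
    squares, so energy bounds pass to the rounded points. *)
Definition grid_point (c : bool * 'I_m.+1) : R :=
  (-1) ^+ c.1 * grid_radius c.2.

Let kap1 : 1 < 1 + kap. Proof. by rewrite ltrDl. Qed.

Let step_gt0 : 0 < step. Proof. exact: ln_gt0. Qed.

Let ln_ge0 (x : R) : 0 <= ln (1 + `|x|).
Proof. by rewrite exp.ln_ge0// lerDl. Qed.

Let pow_le (n : nat) (x : R) : (n%:R <= ln (1 + `|x|) / step) = ((1 + kap) ^+ n <= 1 + `|x|).
Proof.
rewrite ler_pdivlMr// mulr_natl -lnXn ?(lt_trans ltr01)// ler_ln//.
- by rewrite posrE exprn_gt0// (lt_trans ltr01).
- by rewrite posrE ltr_pwDl.
Qed.

Lemma level_ge (n : nat) x : (n <= level x)%N = ((1 + kap) ^+ n <= 1 + `|x|).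
Proof. by rewrite truncn_ge_nat ?pow_le// divr_ge0// ltW. Qed.

Lemma grid_cell2 x : ((grid_cell x).2 : nat) = minn (level x) m.
Proof. by rewrite /= inordK// ltnS geq_minr. Qed.

Lemma grid_radius_ge0 l : 0 <= grid_radius l.
Proof. by rewrite subr_ge0 exprn_ege1// ltW. Qed.

Lemma norm_grid_point c : `|grid_point c| = grid_radius c.2.
Proof. by rewrite normrM normrX normrN1 expr1n mul1r ger0_norm// grid_radius_ge0. Qed.

Lemma grid_point_le x : `|grid_point (grid_cell x)| <= `|x|.
Proof.
rewrite norm_grid_point grid_cell2 lerBlDl -level_ge.
exact: geq_minl.
Qed.

Lemma grid_point_near x : ((grid_cell x).2 < m)%N ->
  `|x - grid_point (grid_cell x)| <= kap * (1 + `|grid_point (grid_cell x)|).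
Proof.
rewrite grid_cell2 gtn_min ltnn orbF => lm.
have E : minn (level x) m = level x by apply/minn_idPl/ltnW.
rewrite norm_grid_point grid_cell2 E.
have l1 : (1 + kap) ^+ (level x) <= 1 + `|x| by rewrite -level_ge.
have l2 : 1 + `|x| < (1 + kap) ^+ (level x).+1.
  by rewrite ltNge -level_ge ltnn.
have xE : x - grid_point (grid_cell x) =
    (-1) ^+ (x < 0)%R * (`|x| - grid_radius (level x)).
  rewrite /grid_point grid_cell2 E /= [RHS]mulrBr; congr (_ - _).
  by case: ltrP => x0; rewrite ?expr0 ?mul1r ?expr1 ?mulN1r ?(ltr0_norm x0) ?opprK// ger0_norm.
rewrite xE normrM normrX normrN1 expr1n mul1r /grid_radius.
move: l1 l2; rewrite exprS; move: ((1 + kap) ^+ level x) => Q l1 l2.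
rewrite ger0_norm; lra.
Qed.

Lemma measurable_grid_cell c : measurable (grid_cell @^-1` [set c]).
Proof.
have mA : measurable_fun setT (fun x : R => 1 + `|x|).
  by apply: measurable_funD => //; exact: measurableT_comp.
have mL n : measurable [set x : R | (n <= level x)%N].
  rewrite (_ : [set x : R | _] = [set x | (1 + kap) ^+ n <= 1 + `|x|]).
    rewrite -[X in measurable X]setTI.
    have h := measurable_fun_ler (measurable_cst ((1 + kap) ^+ n)) mA.
    by apply: (h measurableT [set true]).
  by apply/seteqP; split=> x /=; rewrite level_ge.
have mneg : measurable [set x : R | (x < 0) = c.1].
  rewrite -[X in measurable X]setTI.
  have h := measurable_fun_ltr (@measurable_id _ R setT) (measurable_cst (0 : R)).
  by apply: (h measurableT [set c.1]).
rewrite (_ : _ @^-1` _ = [set x : R | (x < 0) = c.1] `&`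
    (if (c.2 < m)%N then [set x | (c.2 <= level x)%N] `\` [set x | (c.2.+1 <= level x)%N]
     else [set x | (m <= level x)%N])).
  apply: measurableI => //; case: ifP => _; last exact: mL.
  by apply: measurableD; exact: mL.
have cm : (c.2 <= m)%N by rewrite -ltnS.
apply/seteqP; split=> x /=.
  move=> <- /=; split=> //; rewrite inordK ?ltnS ?geq_minr//.
  case: ifPn; rewrite gtn_min ltnn orbF => h /=.
    by rewrite (minn_idPl (ltnW h)); split => //; apply/negP; rewrite ltnn.
  by rewrite leqNgt.
case: c {mneg} cm => b l /= cm [<- h]; congr pair; apply: val_inj => /=.
rewrite inordK ?ltnS ?geq_minr//; move: h; case: ifPn => lm /=.
  move=> [h1 /negP]; rewrite -leqNgt => h2.
  have -> : level x = l by apply/eqP; rewrite eqn_leq h1 h2.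
  by apply/minn_idPl.
move=> h; rewrite (minn_idPr h); apply/eqP; rewrite eqn_leq cm andbT.
by rewrite leqNgt.
Qed.

Let cross_terms_le (A B : R) :
  (1 + B) * (1 + A) + B * (1 + A) + A * (1 + B) <= 3 + 3 * B ^+ 2 + 3 * A ^+ 2.
Proof.
have h1 := sqr_ge0 (A - B); have h2 := sqr_ge0 (A - 1); have h3 := sqr_ge0 (B - 1).
nra.
Qed.

(** The error of each factor is at most [kap] times [1] plus the size of the
    rounded factor; [cross_terms_le] puts the bound in terms of squares, whose
    means are controlled. *)
Lemma grid_product_near x y : ((grid_cell x).2 < m)%N -> ((grid_cell y).2 < m)%N ->
  kap <= 1 ->
  `|x * y - grid_point (grid_cell x) * grid_point (grid_cell y)| <=
  kap * (3 + 3 * (grid_point (grid_cell x)) ^+ 2 + 3 * (grid_point (grid_cell y)) ^+ 2).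
Proof.
move=> xm ym k1; have := grid_point_near xm; have := grid_point_near ym.
set a := grid_point _; set b := grid_point _ => hb ha.
rewrite -[a ^+ 2]real_normK ?num_real// -[b ^+ 2]real_normK ?num_real//.
have -> : x * y - b * a = (x - b) * (y - a) + b * (y - a) + a * (x - b) by ring.
apply: (@le_trans _ _ (`|x - b| * `|y - a| + `|b| * `|y - a| + `|a| * `|x - b|)).
  by rewrite -!normrM (le_trans (ler_normD _ _))// lerD2r ler_normD.
set u := `|x - b| in ha *; set v := `|y - a| in hb *.
have u0 : 0 <= u by exact: normr_ge0. have v0 : 0 <= v by exact: normr_ge0.
have a0 : 0 <= `|a| by exact: normr_ge0. have b0 : 0 <= `|b| by exact: normr_ge0.
set A := `|a| in a0 hb *; set B := `|b| in b0 ha *.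
have uv : u * v <= kap * (1 + B) * (1 + A).
  apply: ler_pM => //; apply: (le_trans hb).
  by rewrite ler_piMl// addr_ge0.
have bv : B * v <= B * (kap * (1 + A)) by rewrite ler_wpM2l.
have au : A * u <= A * (kap * (1 + B)) by rewrite ler_wpM2l.
apply: (@le_trans _ _ (kap * ((1 + B) * (1 + A) + B * (1 + A) + A * (1 + B)))).
  by move: uv bv au; lra.
by rewrite ler_pM2l//; exact: cross_terms_le.
Qed.

End grid.

(** * The law of a discretized array *)

Lemma prob_finite d (T : measurableType d) (R : realType) (P : probability T R)
    (Y : finType) (f : T -> Y) (G : pred Y) :
  (forall y, measurable (f @^-1` [set y])) ->
  P [set w | G (f w)] = (\sum_(y | G y) fine (P (f @^-1` [set y])))%:E.
Proof.
move=> mf.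
have E : [set w | G (f w)] = \bigcup_(y in [set` G]) (f @^-1` [set y]).
  apply/seteqP; split=> w /=; first by move=> Gw; exists (f w).
  by move=> [y Gy /= ->].
rewrite E measure_fin_bigcup//; last by move=> y y' _ _ [w [/= <- <-]].
rewrite -(@bigfs _ _ _ _ (index_enum Y)) ?index_enum_uniq//; last first.
  by move=> y _; rewrite mem_index_enum.
rewrite -sumEFin; apply: eq_bigr => y _.
by rewrite fineK// fin_num_measure.
Qed.

Lemma measurable_finite_pred d (T : measurableType d) (Y : finType) (f : T -> Y)
    (G : pred Y) : (forall y, measurable (f @^-1` [set y])) ->
  measurable [set w | G (f w)].
Proof.
move=> mf.
rewrite (_ : [set w | _] = \bigcup_(y in [set` G]) (f @^-1` [set y])).
  by apply: fin_bigcup_measurable => [|z _]; [exact: finite_finset|exact: mf].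
apply/seteqP; split=> w /=; first by move=> Gw; exists (f w).
by move=> [y Gy /= ->].
Qed.

Section cell_arrays.
Context {d : measure_display} {T : measurableType d} {R : realType}.
Variables (P : probability T R) (I : finType) (X : I -> {RV P >-> R}).
Variables (mu : probability R R) (C : finType) (cl : R -> C).
Hypothesis X_indep : mutually_independent X.
Hypothesis X_law : forall i (B : set R), measurable B -> distribution P (X i) B = mu B.
Hypothesis mcl : forall c, measurable (cl @^-1` [set c]).

Definition cell_array (w : T) : {ffun I -> C} := [ffun i => cl (X i w)].

Local Notation pi := (cell_weight cl mu).

(** Independence is assumed for events indexed by [I], so the events for the
    indices outside the image of [phi] are taken to be full. *)
Lemma cells_prob (J : finType) (A : {set J}) (phi : J -> I) (y : J -> C) :
  {in A &, injective phi} ->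
  P [set w | forall j, j \in A -> cl (X (phi j) w) = y j] =
  (\prod_(j in A) pi (y j))%:E.
Proof.
move=> phi_inj.
pose B i := if [pick j in A | phi j == i] is Some j then cl @^-1` [set y j] else setT.
have mB i : measurable (B i) by rewrite /B; case: pickP.
have Bphi j : j \in A -> B (phi j) = cl @^-1` [set y j].
  move=> jA; rewrite /B; case: pickP => [j' /andP[j'A /eqP e]|/(_ j)].
    by rewrite (phi_inj _ _ j'A jA e).
  by rewrite jA eqxx.
have := X_indep (phi @: A)%SET mB.
rewrite (_ : \bigcap_(i in _) _ = [set w | forall j, j \in A -> cl (X (phi j) w) = y j]).
  move=> ->; rewrite big_imset//= -prodEFin; apply: eq_bigr => j jA.
  rewrite Bphi// /cell_weight fineK ?fin_num_measure//.
  exact: (X_law (phi j) (mcl (y j))).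
apply/seteqP; split=> w /= h.
  move=> j jA; have := h (phi j); rewrite /= imset_f// => /(_ isT).
  by rewrite /= Bphi.
by move=> i /imsetP[j jA ->]; rewrite /= Bphi//; exact: h.
Qed.

Definition array_weight (z : {ffun I -> C}) : R := \prod_i pi (z i).

Lemma measurable_cell_array z : measurable (cell_array @^-1` [set z]).
Proof.
rewrite (_ : _ @^-1` _ = \bigcap_(i in [set: I]) (X i @^-1` (cl @^-1` [set z i]))).
  apply: fin_bigcap_measurable => [|i _]; first exact: finite_finset.
  rewrite -[X in measurable X]setTI; exact: measurable_funP.
apply/seteqP; split=> w /=; first by move=> <- i _; rewrite /= ffunE.
by move=> h; apply/ffunP => i; rewrite ffunE; exact: h.
Qed.

Lemma prob_cell_array z : fine (P (cell_array @^-1` [set z])) = array_weight z.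
Proof.
have := @cells_prob I [set: I]%SET id z (in2W (@inj_id I)).
rewrite (_ : [set w | _] = cell_array @^-1` [set z]).
  by move=> ->; rewrite /array_weight; apply: eq_bigl => i; rewrite inE.
apply/seteqP; split=> w /=.
  by move=> h; apply/ffunP => i; rewrite ffunE; apply: h; rewrite inE.
by move=> <- i _; rewrite ffunE.
Qed.

Lemma prob_array (G : pred {ffun I -> C}) :
  P [set w | G (cell_array w)] = (\sum_(z | G z) array_weight z)%:E.
Proof.
rewrite (prob_finite P G measurable_cell_array); congr EFin.
by apply: eq_bigr => z _; rewrite prob_cell_array.
Qed.

Lemma measurable_array (G : pred {ffun I -> C}) :
  measurable [set w | G (cell_array w)].
Proof. exact: (measurable_finite_pred G measurable_cell_array). Qed.

Lemma array_weight_ge0 z : 0 <= array_weight z.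
Proof. by apply: prodr_ge0 => i _; exact: cell_weight_ge0. Qed.

Lemma array_weight_sum1 : \sum_z array_weight z = 1.
Proof. by rewrite sum_prod1// cell_weight_sum1. Qed.

Lemma marginal_array (J : finType) (A : {set J}) (phi : J -> I) (y : J -> C) :
  {in A &, injective phi} ->
  \sum_(z : {ffun I -> C} | [forall (j | j \in A), z (phi j) == y j]) array_weight z =
  \prod_(j in A) pi (y j).
Proof.
move=> phi_inj; apply: EFin_inj; rewrite -(cells_prob y phi_inj) -prob_array.
congr (P _); apply/seteqP; split=> w /=.
  by move=> /forall_inP h j jA; have := h j jA; rewrite ffunE => /eqP.
by move=> h; apply/forall_inP => j jA; rewrite ffunE h.
Qed.

End cell_arrays.

Section column_cells.
Context {d : measure_display} {T : measurableType d} {R : realType}.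
Variables (P : probability T R) (p n : nat) (X : 'I_p * 'I_n -> {RV P >-> R}).
Variables (mu : probability R R) (C : finType) (cl : R -> C).
Hypothesis X_indep : mutually_independent X.
Hypothesis X_law : forall i (B : set R), measurable B -> distribution P (X i) B = mu B.
Hypothesis mcl : forall c, measurable (cl @^-1` [set c]).

Local Notation pi := (cell_weight cl mu).
Local Notation array := {ffun 'I_p * 'I_n -> C}.
Local Notation weight := (array_weight mu cl).

Definition column_cells u (s : 'I_u -> 'I_n) (z : array) :
    {ffun 'I_p -> {ffun 'I_u -> C}} :=
  [ffun i => [ffun j => z (i, s j)]].

Lemma sum_column_cells1 u (s : 'I_u -> 'I_n) (y : {ffun 'I_p -> {ffun 'I_u -> C}}) :
  injective s ->
  \sum_(z | column_cells s z == y) weight z = \prod_i prod_weight pi (y i).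
Proof.
move=> s_inj; pose phi (ij : 'I_p * 'I_u) := (ij.1, s ij.2).
have phi_inj : {in [set: 'I_p * 'I_u]%SET &, injective phi}.
  by move=> [i j] [i' j'] _ _ [-> /s_inj ->].
transitivity (\prod_(ij in [set: 'I_p * 'I_u]%SET) pi (y ij.1 ij.2)); last first.
  rewrite /prod_weight pair_big/=; apply: eq_bigl => ij.
  by rewrite inE.
rewrite -(marginal_array X_indep X_law mcl _ phi_inj).
apply: eq_bigl => z; apply/eqP/forall_inP => [<- [i j] _|h].
  by rewrite !ffunE.
apply/ffunP => i; apply/ffunP => j; rewrite !ffunE.
by have /eqP := h (i, j) (finset.in_setT _).
Qed.

Lemma sum_column_cells u (s : 'I_u -> 'I_n) (G : pred {ffun 'I_p -> {ffun 'I_u -> C}}) :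
  injective s ->
  \sum_(z | G (column_cells s z)) weight z =
  \sum_(y | G y) \prod_i prod_weight pi (y i).
Proof.
move=> s_inj; rewrite (partition_big (column_cells s) G)//=.
apply: eq_bigr => y Gy; rewrite -(sum_column_cells1 y s_inj).
apply: eq_bigl => z; case: eqP => [->|_]; rewrite ?Gy ?andbF//.
Qed.

(** The choices of columns are injective because the method of types is
    applied to the law of independent columns. *)
Definition atypical_array k (r : R) : pred array := fun z =>
  [exists u : 'I_k, exists s : {ffun 'I_u.+1 -> 'I_n},
    injectiveb s && atypical (prod_weight pi) (u.+1%:R * r) (column_cells s z)].

(** The union bound over the choices of columns, each of them treated by
    [sum_atypical]. *)
Lemma sum_atypical_array k (r : R) : (0 < p)%N ->
  \sum_(z | atypical_array k r z) weight z <=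
  \sum_(u < k) (n ^ u.+1)%:R * (expR (- (p%:R * (u.+1%:R * r))) *
     (p.+1 ^ (#|C| ^ u.+1))%:R).
Proof.
move=> p0.
have w0 (z : array) : 0 <= weight z by exact: array_weight_ge0.
pose B u (s : {ffun 'I_u.+1 -> 'I_n}) : pred array := fun z =>
  injectiveb s && atypical (prod_weight pi) (u.+1%:R * r) (column_cells s z).
apply: (@le_trans _ _ (\sum_(u < k) \sum_(s : {ffun 'I_u.+1 -> 'I_n})
    \sum_(z | B u s z) weight z)).
  under [leRHS]eq_bigr do under eq_bigr do rewrite big_mkcond/=.
  under [leRHS]eq_bigr do rewrite exchange_big/=.
  rewrite exchange_big/= big_mkcond/=; apply: ler_sum => z _.
  have h0 (u : 'I_k) (s : {ffun 'I_u.+1 -> 'I_n}) :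
      0 <= (if B u s z then weight z else 0) by case: ifP.
  case: ifPn => [/existsP[u /existsP[s Bs]]|_]; last first.
    by apply: sumr_ge0 => u _; apply: sumr_ge0 => s _.
  rewrite (bigD1 u)//= (bigD1 s)//= [in X in _ <= X + _ + _]/B Bs -addrA lerDl.
  by rewrite addr_ge0//; [|apply: sumr_ge0 => ? _]; apply: sumr_ge0 => ? _.
apply: ler_sum => u _.
apply: (@le_trans _ _ (\sum_(s : {ffun 'I_u.+1 -> 'I_n})
    expR (- (p%:R * (u.+1%:R * r))) * (p.+1 ^ (#|C| ^ u.+1))%:R)); last first.
  by rewrite [leRHS]mulr_natl sumr_const card_ffun !card_ord.
apply: ler_sum => s _; have [s_inj|ns] := boolP (injectiveb s); last first.
  rewrite big_pred0; first by rewrite mulr_ge0// expR_ge0.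
  by move=> z; rewrite /B (negbTE ns).
rewrite (eq_bigl (fun z => atypical (prod_weight pi) (u.+1%:R * r) (column_cells s z))).
  rewrite (sum_column_cells _ (injectiveP _ s_inj)).
  by apply: (le_trans (sum_atypical p0 _ _)); rewrite card_ffun card_ord.
by move=> z; rewrite /B s_inj.
Qed.

Lemma typical_array k r (z : array) u (s : 'I_u -> 'I_n) : ~~ atypical_array k r z ->
  (0 < u <= k)%N -> injective s ->
  ~~ atypical (prod_weight pi) (u%:R * r) (column_cells s z).
Proof.
case: u s => // u s + uk s_inj; apply: contra => at_s.
apply/existsP; exists (Ordinal uk); apply/existsP; exists (finfun s); apply/andP; split.
  by apply/injectiveP => i j; rewrite !ffunE => /s_inj.
rewrite (_ : column_cells _ _ = column_cells s z)//.
by apply/ffunP => i; apply/ffunP => j; rewrite !ffunE.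
Qed.

Section blocks.
Variables (k M : nat) (kM : (k * M <= n)%N).

Lemma block_column_subproof (j : 'I_k) (a : 'I_M) : (j * M + a < n)%N.
Proof.
apply: leq_trans kM; apply: (@leq_trans (j.+1 * M)).
  by rewrite mulSn addnC ltn_add2r.
by rewrite leq_mul2r ltn_ord orbT.
Qed.

(** The [j]-th column is taken in the [j]-th of [k] consecutive blocks of
    length [M]. The columns are thus increasing in [j], and two selections can
    share a column only at the same index [j], so that overlaps are subsets of
    ['I_k]. *)
Definition block_column (s : {ffun 'I_k -> 'I_M}) (j : 'I_k) : 'I_n :=
  Ordinal (block_column_subproof j (s j)).

Lemma block_column_inj s t j j' : block_column s j = block_column t j' ->
  j = j' /\ s j = t j'.
Proof.
move=> /(congr1 val) /= e.
have M0 : (0 < M)%N by apply: leq_ltn_trans (ltn_ord (s j)).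
have jj : j = j'.
  apply: val_inj => /=; have := congr1 (fun x => x %/ M)%N e.
  by rewrite !divnMDl// !divn_small// !addn0.
split=> //; apply: val_inj => /=; move: e; rewrite jj => /eqP.
by rewrite eqn_add2l => /eqP.
Qed.

(** The two selections read the entries in the columns of [s], and those in
    the columns of [t] with index outside [U]; these entries are distinct,
    hence independent. The pairs with [true] index the latter. *)
Lemma block_pair_law (s t : {ffun 'I_k -> 'I_M}) (y y' : {ffun 'I_p -> {ffun 'I_k -> C}}) :
  \sum_(z | (column_cells (block_column s) z == y) &&
            (column_cells (block_column t) z == y')) weight z =
  pair_weight pi [set j | s j == t j]%SET y y'.
Proof.
set U := [set j | s j == t j]%SET.
have [/forallP yy|nyy] := boolP [forall i, agree U (y i) (y' i)]; last first.
  rewrite /pair_weight (negbTE nyy) !mul0r big_pred0// => z.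
  apply/negbTE; apply: contra nyy => /andP[/eqP <- /eqP <-].
  apply/forallP => i; apply/forall_inP => j; rewrite inE !ffunE => /eqP st.
  by rewrite /block_column; apply/eqP; congr (z (_, _)); apply: val_inj; rewrite /= st.
rewrite /pair_weight (_ : [forall i, _]%B = true) ?mul1r; last exact/forallP.
pose phi (a : bool * ('I_p * 'I_k)) : 'I_p * 'I_n :=
  (a.2.1, block_column (if a.1 then t else s) a.2.2).
pose v (a : bool * ('I_p * 'I_k)) := (if a.1 then y' else y) a.2.1 a.2.2.
pose A := [set a : bool * ('I_p * 'I_k) | a.1 ==> (a.2.2 \notin U)]%SET.
have phi_inj : {in A &, injective phi}.
  move=> [b [i j]] [b' [i' j']]; rewrite !inE /= => h h' e.
  have /= ii := congr1 fst e; have /block_column_inj[jj st] := congr1 snd e.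
  move: jj st => /= jj st {e}; subst i' j'; congr (_, _); move: h h' st; case: b; case: b' => //= h h' st.
    by rewrite st eqxx in h.
  by rewrite st eqxx in h'.
transitivity (\prod_(a in A) pi (v a)).
  rewrite -(marginal_array X_indep X_law mcl v phi_inj).
  apply: eq_bigl => z; apply/andP/forall_inP => [[/eqP ey /eqP ey']|h].
    by move=> [[] [i j]] _; rewrite /v /phi /= -?ey -?ey' !ffunE.
  have e1 : column_cells (block_column s) z = y.
    apply/ffunP => i; apply/ffunP => j; rewrite !ffunE.
    by apply/eqP; apply: (h (false, (i, j))); rewrite inE.
  split; first exact/eqP.
  apply/eqP/ffunP => i; apply/ffunP => j; rewrite !ffunE.
  have [jU|jU] := boolP (j \in U); last first.
    by apply/eqP; apply: (h (true, (i, j))); rewrite inE.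
  have /forall_inP/(_ j jU)/eqP -> := yy i.
  rewrite -e1 !ffunE; congr (z (_, _)); apply: val_inj => /=.
  by move: jU; rewrite inE => /eqP ->.
rewrite (eq_bigl (fun a => xpredT a.1 && (a.1 ==> (a.2.2 \notin U)))); last first.
  by move=> a; rewrite inE.
rewrite -(pair_big_dep xpredT (fun (b : bool) (ij : 'I_p * 'I_k) => b ==> (ij.2 \notin U))
  (fun b ij => pi (v (b, ij))))/= big_bool /= mulrC; congr (_ * _).
  by rewrite /prod_weight pair_big.
by rewrite (pair_big_dep xpredT (fun _ j => j \notin U) (fun i j => pi (y' i j))).
Qed.

End blocks.
End column_cells.

(** * Gram matrices of typical arrays *)

Section upper.
Context {R : realType}.
Variables (k : nat) (beta t0 : R) (mu : probability R R).
Hypothesis k_gt0 : (0 < k)%N.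
Hypothesis beta_gt0 : 0 < beta.
Hypothesis t0_gt0 : 0 < t0.
Hypothesis exp_moment : (\int[mu]_x (expR (t0 * x ^+ 2))%:E < +oo)%E.
Variables (kap delta : R) (m : nat).
Hypothesis kap_gt0 : 0 < kap.
Hypothesis kap_le1 : kap <= 1.
Hypothesis delta_gt0 : 0 < delta.

Local Notation cl := (@grid_cell R kap m).
Local Notation pi := (cell_weight cl mu).
Local Notation mcl := (@measurable_grid_cell R kap m kap_gt0).
Local Notation pt := (grid_point kap).

Let r : R := beta^-1 + delta.
Let E : R := energy_bound t0 mu r.
Let t : R := beta^-1 / r.

(** Rounding to grid points costs [kap * (3 + 6 * E)] twice, for the empirical
    law and for its lift; the rest comes from mixing the lift with the power
    of [mu] with weight [1 - t]. *)
Definition upper_error : R := 2 * (kap * (3 + 6 * E)) + 2 * (1 - t) * E.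

Let r_gt0 : 0 < r. Proof. by rewrite addr_gt0// invr_gt0. Qed.

Let t01 : 0 <= t <= 1.
Proof.
apply/andP; split; first by rewrite divr_ge0 ?ltW// invr_gt0.
by rewrite ler_pdivrMr// mul1r lerDl ltW.
Qed.

(** The marginals of the lift of the cells of the chosen columns have entropy
    at most [#|U| r], and mixing with the power of [mu] multiplies these
    bounds by [t], which gives [#|U| / beta]. *)
Lemma upper_approx (p n : nat) (x : 'I_p * 'I_n -> R) (s : 'I_k -> 'I_n) :
  (0 < p)%N -> p%:R * E < grid_radius kap m ^+ 2 -> injective s ->
  ~~ atypical_array mu cl k r [ffun ij => cl (x ij)] ->
  exists2 B : 'M[R]_k, Gamma_set k beta mu B &
    forall a b, `|p%:R^-1 * (\sum_i x (i, s a) * x (i, s b)) - B a b| <= upper_error.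
Proof.
move=> p0 pE s_inj; set z := [ffun _ => _] => tz.
have p1 : 0 < p%:R :> R by rewrite ltr0n.
have ip : 0 <= p%:R^-1 :> R by rewrite invr_ge0 ltW.
pose y := column_cells s z.
have yE i j : y i j = cl (x (i, s j)) by rewrite !ffunE.
have w0 u (c : {ffun 'I_u -> _}) : 0 <= prod_weight pi c.
  by apply: prodr_ge0 => j _; exact: cell_weight_ge0.
have ty : ~~ atypical (prod_weight pi) (k%:R * r) y.
  by apply: typical_array tz _ s_inj; rewrite k_gt0 leqnn.
have y_gt0 i j : 0 < pi (y i j).
  rewrite lt_neqAle cell_weight_ge0 andbT eq_sym.
  have := typical_gt0 p0 (w0 k) ty i; rewrite /prod_weight => /gt_eqF/negbT/prodf_neq0.
  exact.
have [nu nu_lift] := lift_exists mcl p0 y_gt0.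
have nu_dual (U : {set 'I_k}) : U != finset.set0 ->
    kl_dual_le (marginal U nu) (power_probability mu #|U|) (#|U|%:R * r).
  move=> U0; apply: (lift_kl mcl p0 y_gt0 nu_lift).
  have yU : cell_columns y U = column_cells (s \o enum_val) z.
    by apply/ffunP => i; apply/ffunP => j; rewrite !ffunE.
  rewrite yU; apply: typical_sum_ln => //.
  apply: typical_array tz _ _.
    by rewrite card_gt0 U0/= -[leqRHS]card_ord max_card.
  by apply: inj_comp => //; exact: enum_val_inj.
have nuE : bounded_energy E nu by exact: dual_energy.
have sqrE j : p%:R^-1 * \sum_i pt (y i j) ^+ 2 <= E.
  pose g (v : k.-tuple R) := pt (cells cl v j) ^+ 2.
  have mg : measurable_fun setT g.
    exact: (measurable_cells mcl (fun c : {ffun 'I_k -> _} => pt (c j) ^+ 2)).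
  have [|ig] := lift_approx mcl p0 y_gt0 nu_lift (c := fun i => pt (y i j) ^+ 2)
    (e := fun=> 0) mg.
    by move=> i v vy; rewrite /g vy subrr normr0.
  rewrite [X in _ <= _ * X -> _]big1 ?mulr0// normr_le0 subr_eq0 => /eqP <-.
  rewrite -lee_fin EFin_Rintegral//; apply: le_trans (nuE j).
  apply: ge0_le_integral => //.
  - by move=> v _; rewrite lee_fin sqr_ge0.
  - exact/measurable_EFinP.
  - by apply/measurable_EFinP/measurable_funX; exact: measurable_tnth.
  move=> v _; rewrite lee_fin /g ffunE -[leLHS]real_normK ?num_real//.
  rewrite -[leRHS]real_normK ?num_real// lerXn2r ?nnegrE//.
  exact: grid_point_le.
(* A single row in a top cell would alone contribute more than E to the mean
   of the squares, since the radius of the grid exceeds sqrt (p E). *)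
have ntop i j : ((y i j).2 < m)%N.
  rewrite ltn_neqAle -ltnS ltn_ord andbT; apply/negP => /eqP ym.
  have : p%:R^-1 * pt (y i j) ^+ 2 <= E.
    apply: le_trans (sqrE j); rewrite ler_wpM2l//.
    by rewrite (bigD1 i)//= lerDl sumr_ge0// => ? _; rewrite sqr_ge0.
  rewrite ler_pdivrMl// -[pt _ ^+ 2]real_normK ?num_real// norm_grid_point// ym.
  by rewrite leNgt pE.
pose c a b i := pt (y i a) * pt (y i b).
pose e a b i := kap * (3 + 3 * pt (y i a) ^+ 2 + 3 * pt (y i b) ^+ 2).
have eE a b : p%:R^-1 * \sum_i e a b i <= kap * (3 + 6 * E).
  have -> : p%:R^-1 * \sum_i e a b i = kap * (3 + 3 * (p%:R^-1 * \sum_i pt (y i a) ^+ 2)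
      + 3 * (p%:R^-1 * \sum_i pt (y i b) ^+ 2)).
    rewrite -mulr_sumr !big_split/= -!mulr_sumr sumr_const card_ord -mulr_natl.
    by field; rewrite gt_eqF.
  by rewrite ler_pM2l//; have := sqrE a; have := sqrE b; lra.
have near1 a b : `|p%:R^-1 * (\sum_i x (i, s a) * x (i, s b)) -
    p%:R^-1 * \sum_i c a b i| <= kap * (3 + 6 * E).
  apply: le_trans (eE a b); rewrite -mulrBr -sumrB normrM ger0_norm//.
  rewrite ler_wpM2l//; apply: le_trans (ler_norm_sum _ _ _) _.
  apply: ler_sum => i _; rewrite /c /e !yE.
  by apply: grid_product_near => //; rewrite -yE ntop.
have near2 a b : `|second_moment_mx nu a b - p%:R^-1 * \sum_i c a b i| <= kap * (3 + 6 * E).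
  rewrite mxE; apply: le_trans (eE a b).
  have [|//] := lift_approx mcl p0 y_gt0 nu_lift (c := c a b) (e := e a b)
    (measurable_coordinate_product a b).
  move=> i v vy; rewrite /c /e -vy !ffunE.
  by apply: grid_product_near => //; [have := ntop i a|have := ntop i b]; rewrite -vy ffunE.
have [nu' nu'E] := convex_combination nu (power_probability mu k) t01.
have pow_dual (U : {set 'I_k}) := @kl_dual_le_power R mu k U.
have powE : bounded_energy E (power_probability mu k).
  apply: dual_energy => // U U0 g mg bg; have := pow_dual U g mg bg.
  have : 0 <= #|U|%:R * r by apply: mulr_ge0 => //; exact: ltW.
  lra.
exists (second_moment_mx nu').
  exists nu' => //; apply/(M_setP _ t0_gt0 exp_moment) => U U0.
  have := convex_combination_dual t01 nu'E (nu_dual U U0) (pow_dual U).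
  have tr : t * r = beta^-1 by rewrite divfK// gt_eqF.
  by rewrite mulr0 addr0 mulrCA tr.
move=> a b; have n1 := near1 a b; have n2 := near2 a b.
have b1 := second_moment_bound a b nuE; have b2 := second_moment_bound a b powE.
have [_ e1] := nu'E _ (measurable_coordinate_product a b)
  (bounded_energy_product a b nuE) (bounded_energy_product a b powE).
have -> : second_moment_mx nu' a b =
    second_moment_mx nu a b + (1 - t) *
    (second_moment_mx (power_probability mu k) a b - second_moment_mx nu a b).
  by rewrite [LHS]mxE e1 !mxE; ring.
set S := p%:R^-1 * _ in n1 *; set S' := p%:R^-1 * _ in n1 n2.
set A := second_moment_mx nu a b in n2 b1 *.
set A' := second_moment_mx _ a b in b2 *.
have t1 : 0 <= 1 - t by rewrite subr_ge0; case/andP: t01.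
have h : `|(1 - t) * (A' - A)| <= 2 * (1 - t) * E.
  rewrite normrM ger0_norm// [2 * _]mulrC -mulrA ler_wpM2l//.
  by rewrite (le_trans (ler_normB _ _))//; lra.
move: n1 n2 h; rewrite /upper_error !ler_norml => /andP[? ?] /andP[? ?] /andP[? ?].
by apply/andP; split; lra.
Qed.

End upper.

(** * Discretizing a target law *)

Section data_processing.
Context {R : realType} {C : finType}.
Variables (cl : R -> C) (mu : probability R R).
Hypothesis mcl : forall c, measurable (cl @^-1` [set c]).

Local Notation pi := (cell_weight cl mu).

Lemma cell_law_power u (b : {ffun 'I_u -> C}) :
  cell_law cl (power_probability mu u) b = prod_weight pi b.
Proof. by rewrite /cell_law power_cell_set. Qed.

Lemma cell_law_dominated u (nu : probability (u.-tuple R) R) r b :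
  kl_dual_le nu (power_probability mu u) r ->
  prod_weight pi b = 0 -> cell_law cl nu b = 0.
Proof.
move=> H b0; apply/eqP; rewrite eq_le cell_law_ge0 andbT leNgt; apply/negP => q0.
(* If the cell b is null for the power of mu, this test function gives r + 2
   <= r + 1. *)
pose G c := ((r + 1) / cell_law cl nu b) * (c == b)%:R.
have := H _ (measurable_cells mcl G) (bounded_cells cl G).
rewrite (Rintegral_cells mcl nu G) (Rintegral_cells mcl _ (fun c => expR (G c))).
rewrite (bigD1 b)//= big1 ?addr0; last by move=> c /negbTE cb; rewrite /G cb !mulr0.
rewrite {1}/G eqxx mulr1 mulrCA divff ?gt_eqF// mulr1.
have -> : \sum_c cell_law cl (power_probability mu u) c * expR (G c) = 1.
  rewrite -(cell_law_sum1 mcl (power_probability mu u)); apply: eq_bigr => c _.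
  have [->|cb] := eqVneq c b; first by rewrite cell_law_power b0 mul0r.
  by rewrite /G (negbTE cb) mulr0 expR0 mulr1.
lra.
Qed.

(** The dual inequality is tested on the function of the cells that is the
    logarithm of the ratio of the two laws. On the cells not charged by [nu]
    the value [ln e], for small [e], stands for minus infinity. *)
Lemma data_processing u (nu : probability (u.-tuple R) R) r :
  kl_dual_le nu (power_probability mu u) r ->
  \sum_b cell_law cl nu b * ln (cell_law cl nu b / prod_weight pi b) <= r.
Proof.
move=> H; apply/ler_addgt0Pr => e e0.
pose q := cell_law cl nu.
pose G b := if q b == 0 then ln e else ln (q b / prod_weight pi b).
have := H _ (measurable_cells mcl G) (bounded_cells cl G).
rewrite (Rintegral_cells mcl nu G) (Rintegral_cells mcl _ (fun c => expR (G c))).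
have -> : \sum_b cell_law cl nu b * G b = \sum_b q b * ln (q b / prod_weight pi b).
  by apply: eq_bigr => b _; rewrite /G -/(q b); case: eqP => [->|]; rewrite ?mul0r.
have : \sum_b cell_law cl (power_probability mu u) b * expR (G b) <= 1 + e.
  have -> : 1 + e = \sum_b (q b + cell_law cl (power_probability mu u) b * e).
    by rewrite big_split/= -mulr_suml !cell_law_sum1// mul1r.
  apply: ler_sum => b _; rewrite cell_law_power /G.
  have w0 : 0 <= prod_weight pi b by apply: prodr_ge0 => j _; exact: cell_weight_ge0.
  have q0 : 0 <= q b by exact: cell_law_ge0.
  have [qb|qb] := eqVneq (q b) 0; first by rewrite qb add0r lnK.
  have wb : 0 < prod_weight pi b.
    rewrite lt_neqAle w0 andbT eq_sym; apply: contraNneq qb => wb.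
    by apply/eqP; apply: cell_law_dominated H wb.
  rewrite lnK ?posrE ?divr_gt0// ?lt_neqAle ?q0 1?eq_sym ?qb//.
  by rewrite mulrC divfK ?gt_eqF// lerDl mulr_ge0// ltW.
rewrite -/q; set S1 := \sum_b _; set S2 := \sum_b _; lra.
Qed.

Lemma sum_cell_law_restrict k (U : {set 'I_k}) (nu : probability (k.-tuple R) R)
    (F : {ffun 'I_#|U| -> C} -> R) :
  \sum_c cell_law cl nu c * F (cell_restrict U c) =
  \sum_b cell_law cl (marginal U nu) b * F b.
Proof.
rewrite -(Rintegral_cells mcl nu (fun c => F (cell_restrict U c))).
rewrite -(Rintegral_cells mcl (marginal U nu) F).
rewrite (marginal_Rintegral nu (measurable_cells mcl F) (bounded_cells cl F)).
by apply: eq_Rintegral => x _; rewrite cells_restrict.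
Qed.

Lemma marginal_weight_cell_law k (U : {set 'I_k}) (nu : probability (k.-tuple R) R) c :
  marginal_weight (cell_law cl nu) U c = cell_law cl (marginal U nu) (cell_restrict U c).
Proof.
have E : \sum_c' cell_law cl nu c' * (cell_restrict U c' == cell_restrict U c)%:R =
    cell_law cl (marginal U nu) (cell_restrict U c).
  rewrite (sum_cell_law_restrict nu (fun b => (b == cell_restrict U c)%:R)).
  rewrite (bigD1 (cell_restrict U c))//= eqxx mulr1 big1 ?addr0// => b /negbTE ->.
  by rewrite mulr0.
rewrite -E /marginal_weight big_mkcond/=; apply: eq_bigr => c' _.
have -> : agree U c c' = (cell_restrict U c' == cell_restrict U c).
  apply/forall_inP/eqP => [h|h j jU].
    apply/ffunP => i; rewrite !ffunE; apply/eqP/h; exact: enum_valP.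
  move/ffunP/(_ (enum_rank_in jU j)): h.
  by rewrite !ffunE enum_rankK_in// => ->.
by case: eqP => _; rewrite ?mulr1 ?mulr0.
Qed.

Lemma relative_entropy_cell_law k (U : {set 'I_k}) (nu : probability (k.-tuple R) R) r :
  kl_dual_le (marginal U nu) (power_probability mu #|U|) r ->
  relative_entropy pi (cell_law cl nu) U <= r.
Proof.
move=> H; have := data_processing H.
rewrite -(sum_cell_law_restrict nu (fun b =>
  ln (cell_law cl (marginal U nu) b / prod_weight pi b))).
rewrite /relative_entropy /marginal_ratio.
rewrite (eq_bigr (fun c => cell_law cl nu c * ln (marginal_weight (cell_law cl nu) U c /
   \prod_(j in U) pi (c j))))//.
by move=> c _; rewrite marginal_weight_cell_law prod_weight_restrict.
Qed.

Lemma cell_law_gt0_exists k (nu : probability (k.-tuple R) R) c :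
  0 < cell_law cl nu c -> exists x, cells cl x = c.
Proof.
move=> q0; apply: contrapT => /forallNP h.
have E : cell_set cl c = set0 by apply/seteqP; split=> x //= /h.
by move: q0; rewrite /cell_law E measure0 ltxx.
Qed.

End data_processing.

Section folding.
Context {R : realType}.
Variables (C : finType) (cl : R -> C) (mu : probability R R) (top : pred C) (c0 : C).
Hypothesis mcl : forall c, measurable (cl @^-1` [set c]).
Hypothesis c0_low : ~~ top c0.

Local Notation pi := (cell_weight cl mu).

(** A bounded discretization is obtained by moving the unbounded cells [top]
    onto one cell [c0]. *)
Definition fold_cell (c : C) : C := if top c then c0 else c.
Definition folded (x : R) : C := fold_cell (cl x).

Lemma measurable_folded c : measurable (folded @^-1` [set c]).
Proof.
rewrite (_ : _ @^-1` _ = \bigcup_(c' in [set c' | fold_cell c' = c]) (cl @^-1` [set c'])).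
  by apply: fin_bigcup_measurable => [|c' _]; [exact: finite_finset|exact: mcl].
apply/seteqP; split=> x /=; first by move=> h; exists (cl x).
by move=> [c' /= h xc]; rewrite /folded xc.
Qed.

Lemma folded_low x : ~~ top (folded x).
Proof. by rewrite /folded /fold_cell; case: ifPn. Qed.

Definition top_mass : R := \sum_(c | top c) pi c.

Lemma folded_weight c : ~~ top c ->
  cell_weight folded mu c = pi c + (c == c0)%:R * top_mass.
Proof.
move=> cl_low; rewrite /cell_weight.
have -> : folded @^-1` [set c] = [set x | fold_cell (cl x) == c].
  by apply/seteqP; split=> x /= /eqP.
rewrite (prob_finite mu (fun c' => fold_cell c' == c) mcl) /=.
rewrite (bigID top)/= addrC; congr (_ + _).
  rewrite (big_pred1 c)// => c'; rewrite /fold_cell.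
  case: ifPn => [tc|tc]; rewrite ?andbF ?andbT//.
  by apply/esym/negbTE; apply: contra cl_low => /eqP <-.
have [->|cc] := eqVneq c c0.
  rewrite mul1r /top_mass; apply: eq_bigl => c'; rewrite /fold_cell.
  by case: ifPn; rewrite ?eqxx ?andbF.
rewrite mul0r big_pred0// => c'; rewrite /fold_cell; case: ifPn; rewrite ?andbF//.
by rewrite andbT eq_sym (negbTE cc).
Qed.

Hypothesis c0_gt0 : 0 < pi c0.

Variables (k : nat) (nu : probability (k.-tuple R) R).
Local Notation q := (cell_law folded nu).

Lemma top_mass_ge0 : 0 <= top_mass.
Proof. by apply: sumr_ge0 => c _; exact: cell_weight_ge0. Qed.

Lemma folded_law_low c : 0 < q c -> forall j, ~~ top (c j).
Proof.
move=> /cell_law_gt0_exists[x <-] j; rewrite ffunE; exact: folded_low.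
Qed.

Lemma folded_weight_gt0 (U : {set 'I_k}) r c :
  kl_dual_le (marginal U nu) (power_probability mu #|U|) r ->
  0 < q c -> forall j, j \in U -> 0 < cell_weight folded mu (c j) /\ 0 < pi (c j).
Proof.
move=> H qc j jU.
have w0 : 0 < cell_weight folded mu (c j).
  rewrite lt_neqAle cell_weight_ge0 andbT eq_sym.
  have : prod_weight (cell_weight folded mu) (cell_restrict U c) != 0.
    apply: contraTneq qc => /(cell_law_dominated measurable_folded H).
    rewrite -(marginal_weight_cell_law measurable_folded) /marginal_weight => h.
    rewrite -leNgt -h (bigD1 c)/=; last by apply/forallP => i; rewrite eqxx implybT.
    by rewrite lerDl sumr_ge0// => c' _; exact: cell_law_ge0.
  by rewrite prod_weight_restrict => /prodf_neq0; apply.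
split=> //; have := folded_weight (folded_law_low qc j).
have [->//|_] := eqVneq (c j) c0.
by rewrite mul0r addr0 => <-.
Qed.

(** Discretization by the folded cells does not increase the entropy, but it
    is relative to the folded weights of [mu], which exceed the original ones
    at [c0] only, by a factor [1 + top_mass / pi c0]. Each coordinate in [U]
    contributes at most the logarithm of this factor. *)
Lemma folded_relative_entropy (U : {set 'I_k}) r :
  kl_dual_le (marginal U nu) (power_probability mu #|U|) r ->
  relative_entropy pi q U <= r + #|U|%:R * (top_mass / pi c0).
Proof.
move=> H; rewrite -lerBlDr.
apply: le_trans (relative_entropy_cell_law measurable_folded H).
have -> : #|U|%:R * (top_mass / pi c0) = \sum_c q c * (#|U|%:R * (top_mass / pi c0)).
  by rewrite -mulr_suml (cell_law_sum1 measurable_folded) mul1r.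
rewrite lerBlDr /relative_entropy -big_split/=; apply: ler_sum => c _.
rewrite -mulrDr; have [q0|q0] := eqVneq (q c) 0; first by rewrite q0 !mul0r.
have qc : 0 < q c by rewrite lt_neqAle eq_sym q0 cell_law_ge0.
rewrite ler_pM2l// /marginal_ratio.
have W j : j \in U -> _ := @folded_weight_gt0 U r c H qc j.
have mw : 0 < marginal_weight q U c.
  rewrite /marginal_weight (bigD1 c)/=; last by apply/forallP => i; rewrite eqxx implybT.
  by rewrite ltr_pwDl// sumr_ge0// => c' _; exact: cell_law_ge0.
have P1 : 0 < \prod_(j in U) pi (c j) by apply: prodr_gt0 => j /W[].
have P2 : 0 < \prod_(j in U) cell_weight folded mu (c j) by apply: prodr_gt0 => j /W[].
rewrite !ln_div ?posrE//.
suff : ln (\prod_(j in U) cell_weight folded mu (c j)) - ln (\prod_(j in U) pi (c j)) <=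
    #|U|%:R * (top_mass / pi c0).
  by move: (ln _) (ln _) (ln _) (_ * _) => ? ? ? ?; lra.
rewrite -ln_div ?posrE// -prodf_div.
rewrite -ler_expR lnK ?posrE; last first.
  by apply: prodr_gt0 => j jU; have [? ?] := W j jU; rewrite divr_gt0.
have -> : #|U|%:R * (top_mass / pi c0) = \sum_(j in U) top_mass / pi c0.
  by rewrite sumr_const mulr_natl.
rewrite expR_sum; apply: ler_prod => j jU; have [w1 w2] := W j jU.
apply/andP; split; first by rewrite divr_ge0 ?ltW.
rewrite folded_weight ?(folded_law_low qc)//.
rewrite mulrDl divff ?gt_eqF//; have [->|_] := eqVneq (c j) c0.
  by rewrite (_ : true%:R = 1)// mul1r; exact: expR_ge1Dx.
by rewrite !mul0r addr0 -[leLHS]expR0 ler_expR divr_ge0 ?top_mass_ge0 ?cell_weight_ge0.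
Qed.

End folding.

(** * Truncation of a target law *)

Section truncation.
Context {R : realType}.
Variables (k : nat) (beta t0 : R) (mu : probability R R).
Hypothesis beta_gt0 : 0 < beta.
Hypothesis t0_gt0 : 0 < t0.
Hypothesis exp_moment : (\int[mu]_x (expR (t0 * x ^+ 2))%:E < +oo)%E.

Section fixed_mesh.
Variable kap : R.
Hypothesis kap_gt0 : 0 < kap.

Local Notation gcell m := (@grid_cell R kap m).
Local Notation pi m := (cell_weight (gcell m) mu).
Local Notation mgc m := (@measurable_grid_cell R kap m kap_gt0).

(** The grid point of [x] in a grid without merged levels. *)
Definition round_down (x : R) : R := (-1) ^+ (x < 0)%R * grid_radius kap (level kap x).

Lemma round_downE m x : (level kap x < m)%N -> grid_point kap (gcell m x) = round_down x.
Proof.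
move=> xm; rewrite /grid_point grid_cell2 (minn_idPl (ltnW xm)).
by [].
Qed.

Lemma round_down_le x : `|round_down x| <= `|x|.
Proof. by rewrite -(round_downE (ltnSn _)); exact: grid_point_le. Qed.

Lemma round_down_product x y : kap <= 1 ->
  `|x * y - round_down x * round_down y| <=
  kap * (3 + 3 * (round_down x) ^+ 2 + 3 * (round_down y) ^+ 2).
Proof.
move=> k1; set m := (maxn (level kap x) (level kap y)).+1.
have xm : (level kap x < m)%N by rewrite ltnS leq_maxl.
have ym : (level kap y < m)%N by rewrite ltnS leq_maxr.
rewrite -(round_downE xm) -(round_downE ym); apply: grid_product_near => //;
by rewrite grid_cell2 gtn_min ?xm ?ym.
Qed.

Definition top_cell m (c : (bool * 'I_m.+1)%type) := (c.2 == m :> nat).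

Lemma top_cellE m x : top_cell (gcell m x) = (m <= level kap x)%N.
Proof.
rewrite /top_cell grid_cell2; apply/eqP/idP => [<-|]; first exact: geq_minl.
by move/minn_idPr.
Qed.

(** Markov's inequality for [exp (t0 x^2)], with [exp y >= 1 + y]. *)
Lemma top_mass_le m : top_mass (gcell m) mu (@top_cell m) *
  (t0 * grid_radius kap m ^+ 2) <= exp_mass t0 mu.
Proof.
have [m0|m0] := eqVneq (grid_radius kap m) 0.
  by rewrite m0 expr0n/= !mulr0 (le_trans ler01)// exp_mass_ge1.
have rm : 0 < grid_radius kap m by rewrite lt_neqAle eq_sym m0 grid_radius_ge0.
have a0 : 0 < t0 * grid_radius kap m ^+ 2 by rewrite mulr_gt0// exprn_gt0.
rewrite -lee_fin exp_massE// EFinM /top_mass.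
rewrite -(prob_finite mu (@top_cell m) (mgc m)) muleC.
have mf : measurable_fun setT (fun x : R => (expR (t0 * x ^+ 2))%:E).
  by apply/measurable_EFinP; exact: measurable_expsqr.
have := le_integral_abse mu measurableT mf a0.
rewrite setTI; under eq_integral do rewrite gee0_abs ?lee_fin ?expR_ge0//.
apply: le_trans; apply: lee_wpmul2l; first by rewrite lee_fin ltW.
apply: le_measure; rewrite ?inE.
- exact: (measurable_finite_pred (@top_cell m) (mgc m)).
- rewrite -[X in measurable X]setTI; apply: emeasurable_fun_c_infty => //.
  exact: measurableT_comp.
move=> x /=; rewrite top_cellE level_ge// => xm.
rewrite lee_fin ger0_norm ?expR_ge0//.
apply: (@le_trans _ _ (1 + t0 * x ^+ 2)); last exact: expR_ge1Dx.
rewrite ler_wpDl// ler_pM2l// -[x ^+ 2]real_normK ?num_real// lerXn2r ?nnegrE ?grid_radius_ge0//.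
by rewrite lerBlDl.
Qed.

Lemma bernoulli_radius m : m%:R * kap <= grid_radius kap m.
Proof.
rewrite lerBrDl; elim: m => [|m ih]; first by rewrite mul0r addr0 expr0.
rewrite exprS; have h : 0 <= m%:R * kap by rewrite mulr_ge0// ltW.
apply: (@le_trans _ _ ((1 + kap) * (1 + m%:R * kap))); last first.
  by rewrite ler_wpM2l// addr_ge0// ltW.
by rewrite -natr1; have := mulr_ge0 (ltW kap_gt0) h; lra.
Qed.

Lemma top_mass_small (e : R) : 0 < e -> exists N, forall m, (N <= m)%N ->
  top_mass (gcell m) mu (@top_cell m) <= e.
Proof.
move=> e0.
have L1 := exp_mass_ge1 t0_gt0 exp_moment.
pose b := exp_mass t0 mu / (e * t0 * kap ^+ 2).
have b0 : 0 < b by rewrite divr_gt0// ?mulr_gt0// ?exprn_gt0// (lt_le_trans ltr01).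
exists (Num.truncn b).+1 => m Nm.
have mb : b <= m%:R by rewrite ltW// (lt_le_trans (truncnS_gt b))// ler_nat.
have m1 : 1 <= m%:R :> R by rewrite ler1n (leq_trans _ Nm).
have := top_mass_le m; have := bernoulli_radius m.
set r := grid_radius kap m; set s := top_mass _ _ _ => hr hs.
have mk : 0 < m%:R * kap by rewrite mulr_gt0// (lt_le_trans ltr01).
have r0 : 0 < r by apply: lt_le_trans hr.
have rr : m%:R * kap ^+ 2 <= r ^+ 2.
  apply: (@le_trans _ _ ((m%:R * kap) ^+ 2)).
    by rewrite exprMn ler_wpM2r ?sqr_ge0// expr2 ler_peMl// ler0n.
  by rewrite lerXn2r ?nnegrE// ltW.
have : exp_mass t0 mu <= e * (t0 * r ^+ 2).
  rewrite -[leLHS](divfK (x := e * t0 * kap ^+ 2)); last first.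
    by rewrite gt_eqF// !mulr_gt0// exprn_gt0.
  rewrite -/b; apply: (@le_trans _ _ (m%:R * (e * t0 * kap ^+ 2))).
    by rewrite ler_wpM2r// ltW// !mulr_gt0// exprn_gt0.
  rewrite [leLHS](_ : _ = (e * t0) * (m%:R * kap ^+ 2)); last by ring.
  by rewrite -mulrA ler_pM2l// ler_pM2l.
move=> h; have := le_trans hs h.
by rewrite ler_pM2r// mulr_gt0// exprn_gt0.
Qed.

(** The cells below the top level do not depend on the number of levels, so
    that a fixed cell of positive mass serves as [c0] for all large numbers of
    levels. *)
Lemma positive_cell : exists b l (w : R), 0 < w /\ forall m, (l < m)%N ->
  pi m (b, inord l) = w.
Proof.
have [N hN] := top_mass_small (e := 2^-1) ltac:(by rewrite invr_gt0).
have [c /andP[cl cw]] : exists c, ~~ top_cell c && (0 < pi N c).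
  apply/existsP; apply: contraT => /existsPn h.
  have := cell_weight_sum1 mu (mgc N).
  rewrite (bigID (@top_cell N))/= [X in _ + X]big1; last first.
    move=> c ct; apply/eqP; rewrite eq_le cell_weight_ge0 andbT leNgt.
    by have := h c; rewrite ct.
  by have := hN N (leqnn _); rewrite /top_mass => h1 h2; exfalso; move: h1 h2; lra.
exists c.1, c.2, (pi N c); split=> // m lm.
rewrite /cell_weight; congr (fine (mu _)).
have lN : (c.2 < N)%N by rewrite ltn_neqAle -ltnS ltn_ord andbT.
have E m' (l : nat) (b : bool) : (l < m')%N ->
    gcell m' @^-1` [set (b, inord l)] = [set x | (x < 0) = b /\ level kap x = l].
  move=> lm'; apply/seteqP; split=> x /=.
    move=> [<- /(congr1 val)] /=; rewrite !inordK ?ltnS ?geq_minr// ?(ltnW lm')// => h.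
    split=> //; move: h; rewrite /minn; case: ifP => // _ h.
    by rewrite h ltnn in lm'.
  by move=> [<- h]; rewrite /grid_cell h (minn_idPl (ltnW lm')).
rewrite (E _ _ _ lm) -(E _ _ _ lN); congr (_ @^-1` [set _]).
by rewrite inord_val; case: c {cl cw lm lN}.
Qed.

(** The grid point of the folded cell of [x] when [v0] is the grid point of
    [c0]. *)
Definition truncated_point (v0 : R) (m : nat) (x : R) : R :=
  if (level kap x < m)%N then round_down x else v0.

Lemma truncated_pointE (b : bool) (l m : nat) (x : R) : (l < m)%N ->
  grid_point kap (folded (gcell m) (@top_cell m) (b, inord l) x) =
  truncated_point ((-1) ^+ b * grid_radius kap l) m x.
Proof.
move=> lm; rewrite /folded /fold_cell top_cellE /truncated_point leqNgt.
case: ifPn => [h|/negPn h]; last by rewrite h round_downE.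
by rewrite (negbTE h) /grid_point /= inordK// ltnW.
Qed.

Lemma measurable_truncated_point (b : bool) (l m : nat) : (l < m)%N ->
  measurable_fun setT (truncated_point ((-1) ^+ b * grid_radius kap l) m).
Proof.
move=> lm; rewrite (_ : truncated_point _ _ =
    fun x => grid_point kap (folded (gcell m) (@top_cell m) (b, inord l) x)); last first.
  by apply/funext => x; rewrite truncated_pointE.
move=> _ Y mY; rewrite setTI.
rewrite (_ : _ @^-1` _ =
    [set x | grid_point kap (folded (gcell m) (@top_cell m) (b, inord l) x) \in Y]).
  exact: (measurable_finite_pred (fun c => grid_point kap c \in Y)
    (measurable_folded (@top_cell m) (b, inord l) (mgc m))).
by apply/seteqP; split=> x /=; [move/mem_set|move/set_mem].
Qed.

Lemma truncated_point_cvg v0 x : truncated_point v0 m x @[m --> \oo] --> round_down x.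
Proof.
apply: cvg_near_cst; near=> m; rewrite /truncated_point.
rewrite (_ : (level kap x < m)%N)//; near: m; exact: nbhs_infty_gt.
Unshelve. all: by end_near.
Qed.

Lemma truncated_point_le v0 m x : `|truncated_point v0 m x| <= `|x| + `|v0|.
Proof.
rewrite /truncated_point; case: ifP => _.
  by rewrite (le_trans (round_down_le x))// lerDl.
by rewrite lerDr.
Qed.

Lemma measurable_round_down : measurable_fun setT round_down.
Proof.
apply: (@measurable_fun_cvg _ _ _ _
  (fun n => truncated_point ((-1) ^+ false * grid_radius kap 0) n.+1)).
  by move=> n; exact: measurable_truncated_point.
move=> x _.
by have := @truncated_point_cvg ((-1) ^+ false * grid_radius kap 0) x; rewrite -cvg_shiftS.
Qed.

Let product_le_sqrs (a c W T1 T2 : R) : 0 <= T1 -> 0 <= T2 ->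
  T1 <= a + W -> T2 <= c + W -> T1 * T2 <= a ^+ 2 + c ^+ 2 + 2 * W ^+ 2.
Proof.
move=> T10 T20 h1 h2; apply: (@le_trans _ _ ((a + W) * (c + W))); first by rewrite ler_pM.
have := sqr_ge0 (a - c); have := sqr_ge0 (a - W); have := sqr_ge0 (c - W); nra.
Qed.

(** Dominated convergence: the truncated points converge to the rounded ones,
    as they are eventually constant, and are bounded by [`|x| + `|v0|]. *)
Lemma truncated_product_cvg (E : R) (nu : probability (k.-tuple R) R) (b : bool) l i j :
  bounded_energy E nu ->
  let v0 : R := (-1) ^+ b * grid_radius kap l in
  (\int[nu]_x (truncated_point v0 m (tnth x i) * truncated_point v0 m (tnth x j)))
    @[m --> \oo] --> \int[nu]_x (round_down (tnth x i) * round_down (tnth x j)).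
Proof.
(* The truncated points come from a measurable discretization only when the
   level l of v0 is below m, hence the shift by l + 1. *)
move=> nuE v0; rewrite -(cvg_shiftn l.+1) /=.
pose V := `|v0|.
pose g (x : k.-tuple R) : R := (tnth x i) ^+ 2 + (tnth x j) ^+ 2 + 2 * V ^+ 2.
pose f (n : nat) (x : k.-tuple R) : R :=
  truncated_point v0 (n + l.+1) (tnth x i) * truncated_point v0 (n + l.+1) (tnth x j).
pose h (x : k.-tuple R) : R := round_down (tnth x i) * round_down (tnth x j).
have mt a : measurable_fun setT (fun x : k.-tuple R => tnth x a) by exact: measurable_tnth.
have mf n : measurable_fun setT (f n).
  by apply: measurable_funM; apply: measurableT_comp (mt _);
    apply: measurable_truncated_point; rewrite addnS ltnS leq_addl.
have mh : measurable_fun setT h.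
  by apply: measurable_funM; apply: measurableT_comp (mt _); exact: measurable_round_down.
have ig : nu.-integrable setT (EFin \o g).
  apply: integrable_addr => //.
    by apply: integrable_addr => //; exact: bounded_energy_sqr nuE.
  by apply: bounded_integrable => //; exists `|2 * V ^+ 2|.
have fg n x : `|f n x| <= g x.
  have h1 := truncated_point_le v0 (n + l.+1) (tnth x i).
  have h2 := truncated_point_le v0 (n + l.+1) (tnth x j).
  rewrite /f normrM /g -/V -[tnth x i ^+ 2]real_normK ?num_real//.
  rewrite -[tnth x j ^+ 2]real_normK ?num_real//.
  exact: product_le_sqrs.
have fh x : f n x @[n --> \oo] --> h x.
  have H a := @truncated_point_cvg v0 (tnth x a).
  have HH := cvgM (H i) (H j); rewrite -(cvg_shiftn l.+1) in HH.
  exact: HH.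
have fhE x : (f n x)%:E @[n --> \oo] --> (h x)%:E.
  by apply/cvg_EFin; [exact: nearW|exact: fh].
have [ih _ cv] := @dominated_convergence _ _ R nu setT measurableT
  (fun n x => (f n x)%:E) (EFin \o h) (EFin \o g)
  (fun n => (measurable_EFinP _ _).2 (mf n)) ((measurable_EFinP _ _).2 mh)
  (aeW _ (fun x _ => fhE x)) ig
  (aeW _ (fun x n _ => fg n x)).
have e := EFin_Rintegral ih; rewrite -[X in _ --> X]e in cv.
exact: (fine_cvg cv).
Qed.

End fixed_mesh.
End truncation.

(** * Discrete targets with strict constraints *)

Section target_construction.
Context {R : realType}.
Variables (k : nat) (beta t0 : R) (mu : probability R R).
Hypothesis beta_gt0 : 0 < beta.
Hypothesis t0_gt0 : 0 < t0.
Hypothesis exp_moment : (\int[mu]_x (expR (t0 * x ^+ 2))%:E < +oo)%E.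

(** The strict inequality leaves room for the fluctuation [e] of the
    frequencies. *)
Definition good_target kap m (q : {ffun 'I_k -> bool * 'I_m.+1} -> R) (e : R) :=
  [/\ 0 < e, forall c, 0 <= q c, \sum_c q c = 1,
    forall c, prod_weight (cell_weight (@grid_cell R kap m) mu) c = 0 -> q c = 0 &
    forall U : {set 'I_k}, U != finset.set0 ->
      relative_entropy (cell_weight (@grid_cell R kap m) mu) q U +
      e * log_ratio_mass (cell_weight (@grid_cell R kap m) mu) q U < #|U|%:R / beta].

(** A deterministic property of arrays, so that the probabilistic part of the
    lower bound is about the frequencies of the cells only. *)
Definition approximates_target kap m (q : {ffun 'I_k -> bool * 'I_m.+1} -> R)
    (e eps : R) (A : 'M[R]_k) :=
  forall p n (x : 'I_p * 'I_n -> R) (s : 'I_k -> 'I_n), (0 < p)%N ->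
    let y := column_cells s [ffun ij => @grid_cell R kap m (x ij)] in
    freq_close q e y -> (forall i, 0 < q (y i)) ->
    forall a b, `|p%:R^-1 * (\sum_i x (i, s a) * x (i, s b)) - A a b| <= eps.

(** The three error terms are the rounding of the entries, the fluctuation of
    the frequencies and the distance from the second moments of [q] to [A]. *)
Lemma empirical_gram_near kap m (q : {ffun 'I_k -> bool * 'I_m.+1} -> R)
    (e S B zeta : R) (A : 'M[R]_k) : 0 < kap -> kap <= 1 -> 0 < e ->
  (forall c, 0 < q c -> forall j, ~~ top_cell (c j)) ->
  (forall a b, \sum_(c : {ffun 'I_k -> bool * 'I_m.+1})
     `|grid_point kap (c a) * grid_point kap (c b)| <= S) ->
  (forall a, \sum_c q c * grid_point kap (c a) ^+ 2 <= B) ->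
  (forall a b, `|\sum_c q c * (grid_point kap (c a) * grid_point kap (c b)) - A a b| <= zeta) ->
  approximates_target kap q e (kap * (3 + 6 * (B + e * S)) + e * S + zeta) A.
Proof.
move=> kap0 kap1 e0 qlow SS BB qA p n x s p0 y /forallP fy qy a b.
have p1 : 0 < p%:R :> R by rewrite ltr0n.
have ip : 0 <= p%:R^-1 :> R by rewrite invr_ge0 ltW.
pose pt := @grid_point R kap m.
have mean (F : {ffun 'I_k -> bool * 'I_m.+1} -> R) :
    p%:R^-1 * \sum_i F (y i) = \sum_c freq R y c * F c.
  by rewrite (sum_comp_freq p0 y F) mulrA mulVf ?mul1r// gt_eqF.
have close a' b' : `|\sum_c freq R y c * (pt (c a') * pt (c b')) -
    \sum_c q c * (pt (c a') * pt (c b'))| <= e * S.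
  rewrite -sumrB; apply: le_trans (ler_norm_sum _ _ _) _.
  apply: (@le_trans _ _ (\sum_(c : {ffun 'I_k -> bool * 'I_m.+1}) e * `|pt (c a') * pt (c b')|)).
    by apply: ler_sum => c _; rewrite -mulrBl normrM ler_wpM2r.
  by rewrite -mulr_sumr ler_wpM2l ?SS// ltW.
have energy a' : p%:R^-1 * \sum_i pt (y i a') ^+ 2 <= B + e * S.
  rewrite (mean (fun c => pt (c a') ^+ 2)).
  have := close a' a'; have := BB a'; rewrite ler_norml.
  under eq_bigr do rewrite expr2.
  under [in X in _ -> _ -> X <= _]eq_bigr do rewrite expr2.
  move=> h1 /andP[_ h2]; move: h1 h2; rewrite /pt; lra.
have near1 : `|p%:R^-1 * (\sum_i x (i, s a) * x (i, s b)) -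
    p%:R^-1 * \sum_i pt (y i a) * pt (y i b)| <= kap * (3 + 6 * (B + e * S)).
  apply: (@le_trans _ _ (p%:R^-1 * \sum_i kap * (3 + 3 * pt (y i a) ^+ 2 + 3 * pt (y i b) ^+ 2))).
    rewrite -mulrBr -sumrB normrM ger0_norm// ler_wpM2l//.
    apply: le_trans (ler_norm_sum _ _ _) _; apply: ler_sum => i _.
    have yE j : y i j = grid_cell kap m (x (i, s j)) by rewrite !ffunE.
    have low j : ((grid_cell kap m (x (i, s j))).2 < m)%N.
      by rewrite ltn_neqAle -ltnS ltn_ord andbT -yE; exact: (qlow _ (qy i) j).
    by rewrite /pt !yE; apply: grid_product_near.
  have -> : p%:R^-1 * \sum_i kap * (3 + 3 * pt (y i a) ^+ 2 + 3 * pt (y i b) ^+ 2) =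
      kap * (3 + 3 * (p%:R^-1 * \sum_i pt (y i a) ^+ 2)
      + 3 * (p%:R^-1 * \sum_i pt (y i b) ^+ 2)).
    rewrite -mulr_sumr !big_split/= -!mulr_sumr sumr_const card_ord -mulr_natl.
    by field; rewrite gt_eqF.
  by rewrite ler_pM2l//; have := energy a; have := energy b; lra.
move: near1; rewrite (mean (fun c => pt (c a) * pt (c b))).
have := close a b; have := qA a b; rewrite -/pt.
rewrite !ler_norml => /andP[? ?] /andP[? ?] /andP[? ?].
by apply/andP; split; lra.
Qed.

(** Mixing [nu] with the power of [mu] with weight [delta] leaves a gap [delta
    #|U| / beta] in the constraint on [U]. Half of this gap is spent on
    folding the top cells, for a large number [m] of levels, and on the
    fluctuations [e] of the frequencies. The mesh [kap] has to be fixed before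
    [m], because the cell onto which the top cells are folded depends on it. *)
Lemma lower_target nu (eps : R) : dual_M beta mu nu -> 0 < eps ->
  exists kap m (q : {ffun 'I_k -> bool * 'I_m.+1} -> R) e,
    [/\ 0 < kap, good_target kap q e &
        approximates_target kap q e eps (second_moment_mx nu)].
Proof.
move=> nuM eps0.
pose E := energy_bound t0 mu beta^-1.
have ib : 0 < beta^-1 by rewrite invr_gt0.
have E0 : 0 < E.
  by rewrite divr_gt0// addr_gt0// (lt_le_trans ltr01)// exp_mass_ge1.
pose kap := Num.min 1 (eps / (8 * (3 + 6 * (E + 1)))).
have K0 : 0 < 8 * (3 + 6 * (E + 1)) by lra.
have kap0 : 0 < kap by rewrite lt_min ltr01 divr_gt0.
have kap1 : kap <= 1 by rewrite ge_min lexx.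
have kapE : kap * (3 + 6 * (E + 1)) <= eps / 8.
  have : kap <= eps / (8 * (3 + 6 * (E + 1))) by rewrite ge_min lexx orbT.
  rewrite ler_pdivlMr//; lra.
have E16 : 0 < 16 * E by apply: mulr_gt0.
pose delta := Num.min 1 (eps / (16 * E)).
have d0 : 0 < delta by rewrite lt_min ltr01 divr_gt0.
have d1 : delta <= 1 by rewrite ge_min lexx.
have dE : delta * (2 * E) <= eps / 8.
  have : delta <= eps / (16 * E) by rewrite ge_min lexx orbT.
  rewrite ler_pdivlMr// => h.
  have -> : delta * (2 * E) = (delta * (16 * E)) / 8 by field.
  by rewrite ler_pM2r ?invr_gt0.
(* One tolerance for the three choices made after kap: the loss by truncation,
   the entropy lost by folding and the fluctuations of the frequencies. *)
pose zeta := Num.min (Num.min 2^-1 (eps / 8)) (delta / (4 * beta)).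
have b4 : 0 < 4 * beta by apply: mulr_gt0.
have e8 : 0 < eps / 8 by rewrite divr_gt0.
have ed : 0 < delta / (4 * beta) by rewrite divr_gt0.
have z0 : 0 < zeta by rewrite !lt_min e8 ed invr_gt0 ltr0n.
have z1 : zeta <= 2^-1 by rewrite !ge_min lexx.
have z2 : zeta <= eps / 8 by rewrite !ge_min lexx orbT.
have z3 : zeta <= delta / (4 * beta) by rewrite !ge_min lexx orbT.
have t01 : 0 <= 1 - delta <= 1 by rewrite subr_ge0 d1 lerBlDr lerDl ltW.
have [nu1 nu1E] := convex_combination nu (power_probability mu k) t01.
have nu1_dual (U : {set 'I_k}) : U != finset.set0 ->
    kl_dual_le (marginal U nu1) (power_probability mu #|U|) ((1 - delta) * (#|U|%:R / beta)).
  move=> U0; have := convex_combination_dual t01 nu1E (nuM U U0) (@kl_dual_le_power R mu k U).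
  by rewrite mulr0 addr0.
have nu1M : dual_M beta mu nu1.
  move=> U U0 g mg bg; have := nu1_dual U U0 g mg bg.
  have : 0 <= delta * (#|U|%:R / beta) by rewrite mulr_ge0 ?divr_ge0// ltW.
  lra.
have nuE := dual_M_energy t0_gt0 exp_moment nuM.
have nu1En := dual_M_energy t0_gt0 exp_moment nu1M.
have powE := dual_M_energy t0_gt0 exp_moment (@power_in_M R k beta mu beta_gt0).
have nu1A a b : `|second_moment_mx nu1 a b - second_moment_mx nu a b| <= eps / 8.
  have b1 := second_moment_bound a b nuE; have b2 := second_moment_bound a b powE.
  have [_ e1] := nu1E _ (measurable_coordinate_product a b)
    (bounded_energy_product a b nuE) (bounded_energy_product a b powE).
  have -> : second_moment_mx nu1 a b - second_moment_mx nu a b = delta *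
    (second_moment_mx (power_probability mu k) a b - second_moment_mx nu a b).
    by rewrite [X in X - _]mxE e1 !mxE; ring.
  apply: le_trans dE; rewrite normrM gtr0_norm// ler_pM2l//.
  by rewrite (le_trans (ler_normB _ _))//; rewrite -/E in b1 b2; lra.
have [b [l [w [w0 wE]]]] := positive_cell t0_gt0 exp_moment kap0.
have wz : 0 < w * zeta by rewrite mulr_gt0.
have [N1 topN] := top_mass_small t0_gt0 exp_moment kap0 wz.
pose v0 : R := (-1) ^+ b * grid_radius kap l.
have [m [lm N1m close]] : exists m, [/\ (l < m)%N, (N1 <= m)%N & forall ij : 'I_k * 'I_k,
    `|\int[nu1]_x (round_down kap (tnth x ij.1) * round_down kap (tnth x ij.2)) -
      \int[nu1]_x (truncated_point kap v0 m (tnth x ij.1) * truncated_point kap v0 m (tnth x ij.2))|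
    <= zeta].
  have H : \forall m \near \oo, forall ij : 'I_k * 'I_k,
    `|\int[nu1]_x (round_down kap (tnth x ij.1) * round_down kap (tnth x ij.2)) -
      \int[nu1]_x (truncated_point kap v0 m (tnth x ij.1) * truncated_point kap v0 m (tnth x ij.2))|
    <= zeta.
    apply: filter_forall => -[i j] /=.
    have := @truncated_product_cvg R k kap kap0 _ nu1 b l i j nu1En.
    by move/cvgrPdist_le/(_ _ z0).
  near \oo => m; exists m; split.
  - by near: m; exact: nbhs_infty_gt.
  - by near: m; exact: nbhs_infty_ge.
  - by near: m.
pose c0 : bool * 'I_m.+1 := (b, inord l).
pose cl := @grid_cell R kap m.
pose mcl := @measurable_grid_cell R kap m kap0.
have c0_low : ~~ top_cell c0.
  by rewrite /top_cell /= inordK ?ltnS 1?ltnW// neq_ltn lm.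
have c0_pos : 0 < cell_weight cl mu c0 by rewrite wE.
pose fcl := folded cl (@top_cell m) c0.
have mfcl := measurable_folded (@top_cell m) c0 mcl.
pose q : {ffun 'I_k -> bool * 'I_m.+1} -> R := cell_law fcl nu1.
pose pi := cell_weight cl mu.
pose pt := @grid_point R kap m.
pose S := \sum_(ab : 'I_k * 'I_k) \sum_(c : {ffun 'I_k -> bool * 'I_m.+1})
   `|pt (c ab.1) * pt (c ab.2)|.
have S0 : 0 <= S by apply: sumr_ge0 => ab _; apply: sumr_ge0.
pose L := \sum_(U : {set 'I_k}) log_ratio_mass pi q U.
have L0 U : 0 <= log_ratio_mass pi q U by apply: sumr_ge0.
have LL : 0 <= L by apply: sumr_ge0.
(* S bounds the effect of the fluctuations on second moments, and L their
   effect on entropies. *)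
pose e := zeta / (S + L + 1).
have SL : 0 < S + L + 1 by rewrite ltr_wpDl// addr_ge0.
have e0 : 0 < e by rewrite divr_gt0.
have eX X : X <= S + L + 1 -> e * X <= zeta.
  by move=> hX; rewrite /e mulrAC ler_pdivrMr// ler_pM2l.
have eS : e * S <= zeta by apply: eX; rewrite -addrA lerDl addr_ge0.
have eL U : e * log_ratio_mass pi q U <= zeta.
  apply: eX; apply: (@le_trans _ _ L); last by rewrite -addrA ler_wpDl// lerDl.
  by rewrite /L (bigD1 U)//= lerDl sumr_ge0.
have q_low c : 0 < q c -> forall j, ~~ top_cell (c j) by exact: folded_law_low.
have qmean a' b' : \sum_c q c * (pt (c a') * pt (c b')) =
    \int[nu1]_x (truncated_point kap v0 m (tnth x a') * truncated_point kap v0 m (tnth x b')).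
  rewrite -(Rintegral_cells mfcl nu1 (fun c => pt (c a') * pt (c b'))).
  by apply: eq_Rintegral => x _; rewrite !ffunE /pt /fcl /c0 /cl !truncated_pointE.
have irr a' b' : nu1.-integrable setT
    (EFin \o (fun x => round_down kap (tnth x a') * round_down kap (tnth x b'))).
  apply: (le_integrable measurableT _ _ (integrable_addr measurableT
    (bounded_energy_sqr a' nu1En) (bounded_energy_sqr b' nu1En))).
    apply/measurable_EFinP; apply: measurable_funM;
    by apply: measurableT_comp (measurable_tnth _); exact: measurable_round_down.
  move=> x _ /=; rewrite lee_fin [leRHS]ger0_norm; last by rewrite addr_ge0 ?sqr_ge0.
  apply: le_trans (norm_product_le _ _) _.
  have sq y : round_down kap y ^+ 2 <= y ^+ 2.
    rewrite -[leLHS]real_normK ?num_real// -[leRHS]real_normK ?num_real//.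
    by rewrite lerXn2r ?nnegrE//; exact: round_down_le.
  have := sq (tnth x a'); have := sq (tnth x b').
  have := sqr_ge0 (tnth x a'); have := sqr_ge0 (tnth x b'); lra.
have rE a' : \int[nu1]_x (round_down kap (tnth x a') ^+ 2) <= E.
  rewrite -lee_fin -/E; apply: le_trans (nu1En a').
  under [in leLHS]eq_Rintegral do rewrite expr2.
  rewrite EFin_Rintegral//; apply: ge0_le_integral => //.
  - by move=> x _; rewrite lee_fin -expr2 sqr_ge0.
  - by case/integrableP: (irr a' a').
  - by apply/measurable_EFinP/measurable_funX; exact: measurable_tnth.
  move=> x _; rewrite lee_fin -expr2.
  rewrite -[leLHS]real_normK ?num_real// -[leRHS]real_normK ?num_real//.
  by rewrite lerXn2r ?nnegrE//; exact: round_down_le.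
have near2 a' b' : `|\int[nu1]_x (round_down kap (tnth x a') * round_down kap (tnth x b'))
    - second_moment_mx nu1 a' b'| <= eps / 8.
  rewrite mxE -RintegralB//; last exact: bounded_energy_product nu1En.
  have ib2 := integrable_subr measurableT (irr a' b') (bounded_energy_product a' b' nu1En).
  apply: le_trans (le_normr_Rintegral _ ib2) _ => //.
  have i3 : nu1.-integrable setT (EFin \o (fun x => kap * (3 + 3 * round_down kap (tnth x a') ^+ 2
      + 3 * round_down kap (tnth x b') ^+ 2))).
    apply: integrable_scaler => //; apply: integrable_addr => //; [apply: integrable_addr => //|].
    - by apply: bounded_integrable => //; exists `|3|.
    - by apply: integrable_scaler => //; exact: (irr a' a').
    - by apply: integrable_scaler => //; exact: (irr b' b').
  apply: (@le_trans _ _ (\int[nu1]_x (kap * (3 + 3 * round_down kap (tnth x a') ^+ 2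
      + 3 * round_down kap (tnth x b') ^+ 2)))).
    apply: le_Rintegral => //; first exact: integrable_norm.
    by move=> x _; rewrite distrC; exact: round_down_product.
  have ir j : nu1.-integrable setT (EFin \o (fun x => 3 * round_down kap (tnth x j) ^+ 2)).
    by apply: integrable_scaler => //; exact: (irr j j).
  have i30 : nu1.-integrable setT (EFin \o (fun _ : k.-tuple R => 3)).
    by apply: bounded_integrable => //; exists `|3|.
  rewrite RintegralZl//; last first.
    by apply: integrable_addr => //; apply: integrable_addr.
  rewrite RintegralD//; last exact: integrable_addr.
  rewrite RintegralD// Rintegral_probability_cst.
  rewrite !RintegralZl//; [|exact: (irr _ _)..].
  apply: le_trans kapE; rewrite ler_pM2l//.
  by have := rE a'; have := rE b'; lra.
exists kap, m, q, e; split=> //.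
  split=> //.
  - by move=> c; exact: cell_law_ge0.
  - exact: cell_law_sum1.
  - move=> c pc; apply/eqP; rewrite eq_le cell_law_ge0 andbT leNgt; apply/negP => qc.
    suff : 0 < prod_weight pi c by rewrite pc ltxx.
    apply: prodr_gt0 => j _.
    have j0 : [set j]%SET != finset.set0 :> {set 'I_k}.
      by apply/eqP => /setP/(_ j); rewrite !inE eqxx.
    have [|//] := folded_weight_gt0 mcl c0_low c0_pos (nu1M [set j]%SET j0) qc (j := j).
    by rewrite inE.
  - move=> U U0.
    have := folded_relative_entropy mcl c0_low c0_pos (nu1_dual U U0).
    have th : top_mass cl mu (@top_cell m) / cell_weight cl mu c0 <= delta / (4 * beta).
      apply: le_trans z3; rewrite ler_pdivrMr// mulrC wE//; exact: topN.
    have u1 : 1 <= #|U|%:R :> R by rewrite ler1n card_gt0.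
    have := eL U; rewrite -/pi -/q.
    have uth : #|U|%:R * (top_mass cl mu (@top_cell m) / pi c0) <= #|U|%:R * (delta / (4 * beta)).
      by rewrite ler_wpM2l.
    have db : 0 < delta / beta by rewrite divr_gt0.
    have e4 : delta / (4 * beta) = 4^-1 * (delta / beta) by field; rewrite gt_eqF.
    have e5 : (1 - delta) * (#|U|%:R / beta) = #|U|%:R / beta - #|U|%:R * (delta / beta).
      by field; rewrite gt_eqF.
    rewrite e5; rewrite e4 in uth z3.
    have : delta / beta <= #|U|%:R * (delta / beta) by rewrite ler_peMl// ltW.
    lra.
have mono : kap * (3 + 6 * ((E + 2^-1) + e * S)) + e * S + (eps / 8 + eps / 8 + zeta) <= eps.
  have : kap * (3 + 6 * ((E + 2^-1) + e * S)) <= kap * (3 + 6 * (E + 1)).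
    by rewrite ler_pM2l//; lra.
  lra.
have H : approximates_target kap q e (kap * (3 + 6 * ((E + 2^-1) + e * S)) + e * S +
    (eps / 8 + eps / 8 + zeta)) (second_moment_mx nu).
  apply: empirical_gram_near => //.
  - move=> a' b'; rewrite /S (bigD1 (a', b'))//= lerDl.
    by apply: sumr_ge0 => ab _; apply: sumr_ge0.
  - move=> a'; under eq_bigr do rewrite expr2.
    rewrite qmean; have := close (a', a'); have := rE a'.
    under eq_Rintegral do rewrite expr2.
    by rewrite /= ler_norml => h1 /andP[h2 h3]; lra.
  - move=> a' b'; rewrite qmean; have := close (a', b'); have := near2 a' b'.
    have := nu1A a' b'; rewrite /= !ler_norml => /andP[? ?] /andP[? ?] /andP[? ?].
    by apply/andP; split; lra.
move=> p n x s p0 y fy qy a' b'; apply: le_trans mono; exact: (H p n x s p0 fy qy a' b').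
Unshelve. all: by end_near.
Qed.

End target_construction.

(** * Asymptotics under p ~ beta ln n *)

Section asymptotics.
Context {R : realType}.
Variables (p : nat -> nat) (beta : R).
Hypothesis beta_gt0 : 0 < beta.
Hypothesis p_cvg : (p n)%:R / ln (n%:R : R) @[n --> \oo] --> beta.

Lemma near_ln_ge (A : R) : \forall n \near \oo, A <= ln (n%:R : R).
Proof.
near=> n; have n0 : 0 < n%:R :> R.
  by rewrite ltr0n; near: n; exact: nbhs_infty_gt.
rewrite -ler_expR lnK ?posrE//; near: n; exact: nbhs_infty_ger.
Unshelve. all: by end_near.
Qed.

Lemma near_p_ge (A : R) : \forall n \near \oo, A <= (p n)%:R.
Proof.
have b2 : 0 < beta / 2 by rewrite divr_gt0.
near=> n.
have l0 : 1 <= ln (n%:R : R) by near: n; exact: near_ln_ge.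
have l1 : `|A| * 2 / beta <= ln (n%:R : R) by near: n; exact: near_ln_ge.
have : `|beta - (p n)%:R / ln (n%:R : R)| <= beta / 2.
  by near: n; move/cvgrPdist_le : p_cvg; apply.
rewrite ler_norml => /andP[_ h].
have l2 : 0 < ln (n%:R : R) by apply: lt_le_trans l0.
have h2 : beta / 2 * ln (n%:R : R) <= (p n)%:R by rewrite -ler_pdivlMr//; lra.
apply: le_trans (ler_norm A) _; apply: le_trans h2.
have -> : `|A| = beta / 2 * (`|A| * 2 / beta) by field; rewrite gt_eqF.
by rewrite ler_pM2l.
Unshelve. all: by end_near.
Qed.

Lemma near_p_ln (g : R) : 0 < g ->
  \forall n \near \oo, `|(p n)%:R / beta - ln (n%:R : R)| <= g * (p n)%:R.
Proof.
move=> g0; have b2 : 0 < beta / 2 by rewrite divr_gt0.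
have gb : 0 < g * beta ^+ 2 / 2 by rewrite divr_gt0// mulr_gt0// exprn_gt0.
near=> n.
have l0 : 0 < ln (n%:R : R).
  by apply: (@lt_le_trans _ _ 1) => //; near: n; exact: near_ln_ge.
have h1 : `|beta - (p n)%:R / ln (n%:R : R)| <= beta / 2.
  by near: n; move/cvgrPdist_le : p_cvg; apply.
have h2 : `|beta - (p n)%:R / ln (n%:R : R)| <= g * beta ^+ 2 / 2.
  by near: n; move/cvgrPdist_le : p_cvg; apply.
move: l0 h1 h2; move: (ln _) ((p n)%:R) => l q l0 h1 h2.
have E : q / beta - l = - (l / beta) * (beta - q / l) by field; rewrite !gt_eqF.
have lb : 0 < l / beta by rewrite divr_gt0.
rewrite E mulNr normrN normrM (gtr0_norm lb).
apply: (@le_trans _ _ ((l / beta) * (g * beta ^+ 2 / 2))); first by rewrite ler_pM2l.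
have -> : l / beta * (g * beta ^+ 2 / 2) = g * (beta / 2 * l) by field; rewrite gt_eqF.
rewrite ler_pM2l//; move: h1; rewrite ler_norml => /andP[_ h].
by rewrite -ler_pdivlMr//; lra.
Unshelve. all: by end_near.
Qed.

Lemma expR_small (c : R) (eta : R) : 0 < c -> 0 < eta ->
  \forall n \near \oo, expR (- (c * (p n)%:R)) <= eta.
Proof.
move=> c0 e0; near=> n.
have h : - ln eta / c <= (p n)%:R by near: n; exact: near_p_ge.
by rewrite -[leRHS]lnK// ler_expR lerNl mulrC -ler_pdivrMr.
Unshelve. all: by end_near.
Qed.

Lemma pow_le_expR N (y : R) : 0 <= y -> y ^+ N <= (N%:R ^+ N) * expR y.
Proof.
move=> y0; case: N => [|N]; first by rewrite !expr0 mul1r -[leLHS]expR0 ler_expR.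
have N0 : 0 < N.+1%:R :> R by rewrite ltr0n.
have -> : expR y = expR (y / N.+1%:R) ^+ N.+1.
  by rewrite -expRM_natl; congr expR; field; rewrite gt_eqF.
rewrite -exprMn; apply: lerXn2r; rewrite ?nnegrE//.
by rewrite [leRHS]mulrC -ler_pdivrMr//; apply: le_trans (expR_ge1Dx _); rewrite lerDr.
Qed.

(** The number of levels needed for the radius of the grid to exceed [sqrt (p
    E)]. *)
Definition grid_size (kap E : R) (n : nat) : nat :=
  (Num.truncn (ln (2 + (p n)%:R * E) / ln (1 + kap))).+1.

Lemma grid_size_radius kap E n : 0 < kap -> 0 < E ->
  (p n)%:R * E < grid_radius kap (grid_size kap E n) ^+ 2.
Proof.
move=> k0 E0; have k1 : 1 < 1 + kap by rewrite ltrDl.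
have l0 : 0 < ln (1 + kap) by exact: ln_gt0.
have pE : 0 <= (p n)%:R * E by rewrite mulr_ge0// ltW.
have h : ln (2 + (p n)%:R * E) / ln (1 + kap) < (grid_size kap E n)%:R.
  exact: truncnS_gt.
have e0 : 0 < 1 + kap by lra.
have s0 : 0 < 2 + (p n)%:R * E by lra.
rewrite ltr_pdivrMr// [X in _ < X]mulr_natl -lnXn// ltr_ln ?posrE ?exprn_gt0// in h.
have r1 : 1 + (p n)%:R * E < grid_radius kap (grid_size kap E n) by rewrite /grid_radius; move: h; move: (_ ^+ _) => z; lra.
move: r1; move: (grid_radius _ _) ((p n)%:R * E) pE => r q q0 r1; nra.
Qed.

(** The number of cells is [O(ln p)], so the logarithm of the number of types
    is at most a power of [ln p]. With [Y = ln (p + 2)], the cost is at most a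
    constant times [Y ^ (k + 1)], while [Y ^ (k + 2)] is at most a constant
    times [exp Y = p + 2]; the extra factor [Y] absorbs the constants. *)
Lemma near_grid_cost (k : nat) (kap E g : R) : 0 < kap -> 0 < E -> 0 < g ->
  \forall n \near \oo, (2 * (grid_size kap E n).+1)%:R ^+ k * ln ((p n).+1%:R) <= g * (p n)%:R.
Proof.
move=> k0 E0 g0; have k1 : 1 < 1 + kap by rewrite ltrDl.
have l0 : 0 < ln (1 + kap) by exact: ln_gt0.
pose c : R := 2 * ((1 + ln (1 + E)) / ln (1 + kap) + 2).
have lE : 0 < ln (1 + E) by apply: ln_gt0; rewrite ltrDl.
have c0 : 0 < c by rewrite mulr_gt0// addr_gt0// divr_gt0// addr_gt0.
pose N := k.+2.
near=> n.
pose Y : R := ln ((p n)%:R + 2).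
have p0 : 0 <= (p n)%:R :> R by [].
have p2 : 0 < (p n)%:R + 2 :> R by lra.
have Yge (A : R) : expR A <= (p n)%:R + 2 -> A <= Y by move=> h; rewrite -ler_expR lnK.
have Y1 : 1 <= Y.
  apply: Yge; apply: (@le_trans _ _ (p n)%:R); last by rewrite lerDl.
  by near: n; exact: near_p_ge.
pose Y0 : R := c ^+ k * N%:R ^+ N * 2 / g.
have YY0 : Y0 <= Y.
  apply: Yge; apply: (@le_trans _ _ (p n)%:R); last by rewrite lerDl.
  by near: n; exact: near_p_ge.
have pge2 : 2 <= (p n)%:R :> R by near: n; exact: near_p_ge.
have p22 : (p n)%:R + 2 <= 2 * (p n)%:R :> R by lra.
have Ypos : 0 < Y by apply: lt_le_trans Y1.
have size_le : (2 * (grid_size kap E n).+1)%:R <= c * Y.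
  rewrite natrM /c -mulrA ler_pM2l// mulrDl.
  have -> : (grid_size kap E n).+1%:R =
      (Num.truncn (ln (2 + (p n)%:R * E) / ln (1 + kap)))%:R + 2 :> R.
    by rewrite -natrD addn2.
  have t0 : 0 <= ln (2 + (p n)%:R * E) / ln (1 + kap).
    apply: divr_ge0; last exact: ltW.
    by apply: ln_ge0; have := mulr_ge0 p0 (ltW E0); lra.
  have /andP[h1 _] := truncn_itv t0.
  have h2 : ln (2 + (p n)%:R * E) <= (1 + ln (1 + E)) * Y.
    apply: (@le_trans _ _ (ln (((p n)%:R + 2) * (1 + E)))).
      rewrite ler_ln ?posrE ?mulr_gt0//; first by have := mulr_ge0 p0 (ltW E0); lra.
      - by have := mulr_ge0 p0 (ltW E0); lra.
      - by lra.
    rewrite lnM ?posrE//; last by lra.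
    rewrite -/Y mulrDl mul1r lerD2l ler_peMr// ltW//.
  have h3 : ln (2 + (p n)%:R * E) / ln (1 + kap) <= (1 + ln (1 + E)) / ln (1 + kap) * Y.
    by rewrite mulrAC ler_pM2r ?invr_gt0.
  by move: (le_trans h1 h3) Y1; lra.
have lnp : ln ((p n).+1%:R) <= Y.
  by rewrite ler_ln ?posrE ?ltr0n// -natr1 lerD2l; lra.
have cost1 : (2 * (grid_size kap E n).+1)%:R ^+ k * ln ((p n).+1%:R) <= c ^+ k * Y ^+ k.+1.
  rewrite [Y ^+ _]exprSr mulrA -exprMn; apply: ler_pM => //.
  - by rewrite ln_ge0// ler1n.
  - by rewrite lerXn2r ?nnegrE// mulr_ge0// ltW.
apply: (le_trans cost1).
have powY : Y ^+ N <= N%:R ^+ N * ((p n)%:R + 2).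
  by have := pow_le_expR N (ltW Ypos); rewrite /Y lnK.
have h : c ^+ k * Y ^+ k.+1 * Y <= g * (p n)%:R * Y.
  rewrite -mulrA -exprSr -/N.
  apply: (@le_trans _ _ (c ^+ k * (N%:R ^+ N * ((p n)%:R + 2)))).
    by rewrite ler_pM2l// exprn_gt0.
  apply: (@le_trans _ _ (c ^+ k * (N%:R ^+ N * (2 * (p n)%:R)))).
    by rewrite ler_pM2l ?exprn_gt0// ler_wpM2l ?exprn_ge0.
  have -> : c ^+ k * (N%:R ^+ N * (2 * (p n)%:R)) = g * (p n)%:R * Y0.
    rewrite /Y0; move: (c ^+ k) (N%:R ^+ N) ((p n)%:R : R) => x z v.
    by field; rewrite gt_eqF.
  by rewrite ler_wpM2l// mulr_ge0// ltW.
by rewrite ler_pM2r in h.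
Unshelve. all: by end_near.
Qed.

(** With [ln n] within [delta p / 4] of [p / beta] and the logarithm of the
    number of types below [delta p / 4], the exponent of each term is at most
    [- delta p / 2]. *)
Lemma near_union_bound (k : nat) (kap E delta eta : R) :
  0 < kap -> 0 < E -> 0 < delta -> 0 < eta ->
  \forall n \near \oo, \sum_(u < k) (n ^ u.+1)%:R *
    (expR (- ((p n)%:R * (u.+1%:R * (beta^-1 + delta)))) *
     ((p n).+1 ^ ((2 * (grid_size kap E n).+1) ^ u.+1))%:R) <= eta.
Proof.
move=> k0 E0 d0 e0.
have d4 : 0 < delta / 4 by rewrite divr_gt0.
have ek : 0 < eta / k.+1%:R by rewrite divr_gt0.
near=> n.
have n0 : 0 < n%:R :> R by rewrite ltr0n; near: n; exact: nbhs_infty_gt.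
have h1 : `|(p n)%:R / beta - ln (n%:R : R)| <= delta / 4 * (p n)%:R.
  by near: n; exact: near_p_ln.
have h2 : (2 * (grid_size kap E n).+1)%:R ^+ k * ln ((p n).+1%:R) <= delta / 4 * (p n)%:R.
  by near: n; exact: near_grid_cost.
have h3 : expR (- (delta / 2 * (p n)%:R)) <= eta / k.+1%:R.
  by near: n; apply: expR_small => //; rewrite divr_gt0.
apply: (@le_trans _ _ (\sum_(u < k) eta / k.+1%:R)); last first.
  rewrite sumr_const card_ord -[leLHS]mulr_natl mulrC -mulrA ler_piMr ?ltW//.
  by rewrite mulrC ltr_pdivrMr// mul1r ltr_nat.
apply: ler_sum => u _; apply: le_trans h3.
set q : R := (p n)%:R in h1 h2 *.
have G0 : (0 < 2 * (grid_size kap E n).+1)%N by rewrite muln_gt0.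
move: G0 h2; move: (2 * (grid_size kap E n).+1)%N => G G0 h2.
have p10 : 0 < (p n).+1%:R :> R by rewrite ltr0n.
have e1 : (n ^ u.+1)%:R = expR (u.+1%:R * ln n%:R) :> R.
  by rewrite expRM_natl lnK ?posrE// natrX.
have e2 : ((p n).+1 ^ (G ^ u.+1))%:R = expR ((G ^ u.+1)%:R * ln (p n).+1%:R) :> R.
  by rewrite expRM_natl lnK ?posrE// natrX.
rewrite e1 e2 -!expRD ler_expR.
have lp : 0 <= ln ((p n).+1%:R : R) by rewrite ln_ge0// ler1n.
have h4 : (G ^ u.+1)%:R * ln (p n).+1%:R <= delta / 4 * q.
  apply: le_trans h2; rewrite ler_wpM2r// -natrX ler_nat.
  exact: (leq_pexp2l G0 (ltn_ord u)).
have q0 : 0 <= q by [].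
have h5 : ln n%:R - q / beta <= delta / 4 * q.
  by move: h1; rewrite ler_norml => /andP[]; lra.
have u1 : 1 <= u.+1%:R :> R by rewrite ler1n.
move: h4 h5 u1; move: (_ * ln (p n).+1%:R) (ln n%:R) (u.+1%:R) => z l v h4 h5 v1.
have -> : v * l + (- (q * (v * (beta^-1 + delta))) + z) = v * (l - q / beta - delta * q) + z.
  by field; rewrite gt_eqF.
have : v * (l - q / beta - delta * q) <= v * (- (3 * (delta / 4) * q)).
  by rewrite ler_pM2l; lra.
have : 0 <= (v - 1) * (delta / 4 * q).
  by rewrite mulr_ge0// ?subr_ge0// mulr_ge0// ltW.
lra.
Unshelve. all: by end_near.
Qed.

(** Since [n %/ k >= n / (2 k)], its logarithm is [p / beta] up to [o(p)], and
    the exponent of the term of [U] is at most [- p (#|U| / beta - a U) / 2]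
    plus a constant. *)
Lemma near_overlap_bound (k : nat) (a : {set 'I_k} -> R) (eta : R) :
  (0 < k)%N -> 0 < eta ->
  (forall U : {set 'I_k}, U != finset.set0 -> a U < #|U|%:R / beta) ->
  \forall n \near \oo, \sum_(U : {set 'I_k} | U != finset.set0)
     expR ((p n)%:R * a U) / (n %/ k)%:R ^+ #|U| <= eta.
Proof.
move=> k0 e0 aU.
pose nU := #|{set 'I_k}|.
have nU0 : (0 < nU)%N by apply/card_gt0P; exists finset.set0.
suff H : forall U : {set 'I_k}, U != finset.set0 -> \forall n \near \oo,
    expR ((p n)%:R * a U) / (n %/ k)%:R ^+ #|U| <= eta / nU%:R.
  have : \forall n \near \oo, forall U : {set 'I_k}, U != finset.set0 ->
    expR ((p n)%:R * a U) / (n %/ k)%:R ^+ #|U| <= eta / nU%:R.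
    apply: filter_forall => U; have [->|U0] := eqVneq U finset.set0.
      by apply: nearW => n; rewrite ?eqxx.
    by near=> n => _; near: n; exact: H.
  move=> h; near=> n; have hn : forall U : {set 'I_k}, U != finset.set0 ->
    expR ((p n)%:R * a U) / (n %/ k)%:R ^+ #|U| <= eta / nU%:R by near: n.
  apply: (@le_trans _ _ (\sum_(U : {set 'I_k}) eta / nU%:R)).
    rewrite big_mkcond/=; apply: ler_sum => U _; case: ifPn => [/hn//|_].
    by rewrite divr_ge0// ltW.
  by rewrite sumr_const -[leLHS]mulr_natl mulrC divfK// pnatr_eq0 -lt0n.
move=> U U0; pose u := #|U|; pose g := u%:R / beta - a U.
have g0 : 0 < g by rewrite subr_gt0 aU.
have u0 : 0 < u%:R :> R by rewrite ltr0n card_gt0.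
have gu : 0 < g / (2 * u%:R) by rewrite divr_gt0// mulr_gt0.
have k2 : 0 < (2 * k)%:R :> R by rewrite ltr0n muln_gt0.
pose c : R := u%:R * ln (2 * k)%:R.
have eN : 0 < eta / nU%:R * expR (- c) by rewrite mulr_gt0 ?expR_gt0 ?divr_gt0// ltr0n.
near=> n.
have n0 : 0 < n%:R :> R by rewrite ltr0n; near: n; exact: nbhs_infty_gt.
have kn : (k <= n)%N by near: n; exact: nbhs_infty_ge.
have h1 : `|(p n)%:R / beta - ln (n%:R : R)| <= g / (2 * u%:R) * (p n)%:R.
  by near: n; exact: near_p_ln.
have h3 : expR (- (g / 2 * (p n)%:R)) <= eta / nU%:R * expR (- c).
  by near: n; apply: expR_small => //; rewrite divr_gt0.
have M0 : (0 < n %/ k)%N by rewrite divn_gt0.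
have M1 : 0 < (n %/ k)%:R :> R by rewrite ltr0n.
have Mn : n%:R / (2 * k)%:R <= (n %/ k)%:R :> R.
  rewrite ler_pdivrMr// -natrM ler_nat.
  have := ltn_pmod n k0; have := divn_eq n k; move: M0.
  set M := (n %/ k)%N; set r := (n %% k)%N => M0 -> rk.
  have : (k <= M * k)%N by rewrite leq_pmull.
  rewrite mulnCA mul2n -addnn; move=> h; rewrite leq_add2l.
  by rewrite (leq_trans (ltnW rk)).
rewrite -(@ler_pM2r _ (expR (- c))) ?expR_gt0//; apply: le_trans h3.
have -> : (n %/ k)%:R ^+ u = expR (u%:R * ln (n %/ k)%:R) :> R.
  by rewrite expRM_natl lnK.
rewrite -expRN -!expRD ler_expR.
have lM : ln n%:R - ln (2 * k)%:R <= ln (n %/ k)%:R :> R.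
  by rewrite -ln_div ?posrE// ler_ln ?posrE// divr_gt0.
have h2 : (p n)%:R / beta - ln n%:R <= g / (2 * u%:R) * (p n)%:R.
  by move: h1; rewrite ler_norml => /andP[].
have h4 : u%:R * ((p n)%:R / beta - ln n%:R) <= g / 2 * (p n)%:R.
  have -> : g / 2 * (p n)%:R = u%:R * (g / (2 * u%:R) * (p n)%:R).
    by field; rewrite gt_eqF.
  by rewrite ler_pM2l.
have h5 : u%:R * (ln n%:R - ln (2 * k)%:R) <= u%:R * ln (n %/ k)%:R :> R by apply: ler_wpM2l => //; exact: ltW.
have -> : (p n)%:R * a U = u%:R * ((p n)%:R / beta) - g * (p n)%:R.
  by rewrite /g; field; rewrite gt_eqF.
move: h4 h5; rewrite /c !mulrBr.
move: (u%:R * ln (n %/ k)%:R) (u%:R * ln n%:R) (u%:R * ln (2 * k)%:R) (u%:R * ((p n)%:R / beta)).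
move: ((p n)%:R : R) => P A B D Q; lra.
Unshelve. all: by end_near.
Qed.

End asymptotics.

(** * Events of high probability *)

Section high_probability.
Context {R : realType} {d : nat -> measure_display} {T : forall n, measurableType (d n)}.
Variable P : forall n, probability (T n) R.

(** Covering the complement by measurable sets avoids the question of the
    measurability of [G n] itself, which quantifies over uncountable sets of
    matrices. *)
Definition whp (G : forall n, T n -> Prop) : Prop :=
  exists B : forall n, set (T n),
    [/\ forall n, measurable (B n), (P n (B n) @[n --> \oo] --> 0)%E &
        forall n w, ~ B n w -> G n w].

Lemma whp_intro (G : forall n, T n -> Prop) (B : forall n, set (T n)) :
  (forall n, measurable (B n)) ->
  (forall eta : R, 0 < eta -> \forall n \near \oo, (P n (B n) <= eta%:E)%E) ->
  (\forall n \near \oo, forall w, ~ B n w -> G n w) -> whp G.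
Proof.
move=> mB PB [N _ BG].
exists (fun n => if (n < N)%N then setT else B n); split.
- by move=> n; case: ifP.
- apply/fine_cvgP; split.
    apply: nearW => n; rewrite fin_num_measure//; case: ifP => //.
  apply/cvgrPdist_le => e e0; near=> n.
  rewrite sub0r normrN ger0_norm ?fine_ge0// /= ltnNge ifN; last first.
    by rewrite negbK; near: n; exact: nbhs_infty_ge.
  rewrite -lee_fin fineK ?fin_num_measure//; near: n; exact: PB.
- move=> n w; case: ltnP => [_ /(_ I)//|Nn]; exact: BG.
Unshelve. all: by end_near.
Qed.

Lemma whp_and (G H : forall n, T n -> Prop) : whp G -> whp H ->
  whp (fun n w => G n w /\ H n w).
Proof.
move=> [B [mB PB BG]] [B' [mB' PB' BH]].
exists (fun n => B n `|` B' n); split.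
- by move=> n; exact: measurableU.
- apply: (@squeeze_cvge _ _ _ _ (cst 0%E) _ (fun n => P n (B n) + P n (B' n))%E).
  + by apply: nearW => n; rewrite measure_ge0/= measureU2.
  + exact: cvg_cst.
  + by rewrite -[X in _ --> X]adde0; apply: cvgeD.
- move=> n w nBw; split; [apply: BG|apply: BH] => Bw; apply: nBw; [by left|by right].
Qed.

Lemma whp_all (I : eqType) (s : seq I) (G : I -> forall n, T n -> Prop) :
  (forall i, i \in s -> whp (G i)) ->
  whp (fun n w => forall i, i \in s -> G i n w).
Proof.
elim: s => [_|i s ih h].
  exists (fun=> set0); split => //.
  by under eq_fun do rewrite measure0; exact: cvg_cst.
have hi : whp (G i) by apply: h; rewrite inE eqxx.
have hs : whp (fun n w => forall i, i \in s -> G i n w).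
  by apply: ih => j js; apply: h; rewrite inE js orbT.
have [B [mB PB BG]] := whp_and hi hs.
exists B; split=> // n w nB j; have [Gi Gs] := BG n w nB.
by rewrite inE => /orP[/eqP ->|/Gs].
Qed.

End high_probability.

Section column_selection.
Context {R : realType}.

Lemma wishart_entry p n k (X : 'M[R]_(p, n)) (S : {set 'I_n}) (cardS : #|S| = k) a b :
  (p%:R^-1 *: ((column_submx X cardS)^T *m column_submx X cardS)) a b =
  p%:R^-1 * \sum_i X i (enum_val (cast_ord (esym cardS) a)) *
     X i (enum_val (cast_ord (esym cardS) b)).
Proof. by rewrite !mxE; congr (_ * _); apply: eq_bigr => i _; rewrite !mxE. Qed.

Lemma enum_increasing n k (s : 'I_k -> 'I_n) : {homo s : i j / (i < j)%N} ->
  enum [set s i | i : 'I_k]%SET = [seq s i | i <- enum 'I_k].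
Proof.
move=> s_homo; apply: (inj_map val_inj).
apply: (irr_sorted_eq ltn_trans ltnn).
- rewrite -[X in map _ X]/(enum (mem [set s i | i : 'I_k]%SET)).
  rewrite {1}/enum_mem -enumT (subseq_sorted ltn_trans (s2 := map val (enum 'I_n)))//.
    by apply: map_subseq; exact: filter_subseq.
  by rewrite val_enum_ord iota_ltn_sorted.
- rewrite -map_comp.
  apply: (@homo_sorted _ _ _ (relpre val ltn) ltn); first by move=> i j; exact: s_homo.
  by rewrite -sorted_map val_enum_ord iota_ltn_sorted.
- move=> x; apply/mapP/mapP => -[y + ->].
    by rewrite mem_enum => ys; exists y => //; move/imsetP: ys => [i _ ->]; rewrite map_f// mem_enum.
  by move=> /mapP[i _ ->]; exists (s i) => //; rewrite mem_enum imset_f.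
Qed.

(** The matrices of [wishart_set] list the columns of a set in increasing
    order, so an increasing choice of columns is realized by its image. *)
Lemma increasing_selection n k (s : 'I_k -> 'I_n) : {homo s : i j / (i < j)%N} ->
  exists (S : {set 'I_n}) (cardS : #|S| = k),
    forall j, enum_val (cast_ord (esym cardS) j) = s j.
Proof.
move=> s_homo; have s_inj : injective s.
  move=> i j sij; apply: val_inj; case: (ltngtP i j) => // h;
  by have := s_homo _ _ h; rewrite sij ltnn.
have cS : #|[set s i | i : 'I_k]%SET| = k by rewrite card_imset// card_ord.
exists [set s i | i : 'I_k]%SET, cS => j.
rewrite /enum_val enum_increasing//= (nth_map j) ?size_enum_ord//.
by rewrite nth_ord_enum.
Qed.

End column_selection.

Section events.
Context {R : realType}.
Variables (k : nat) (beta t0 : R) (mu : probability R R).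
Hypothesis k_gt0 : (0 < k)%N.
Hypothesis beta_gt0 : 0 < beta.
Hypothesis t0_gt0 : 0 < t0.
Hypothesis exp_moment : (\int[mu]_x (expR (t0 * x ^+ 2))%:E < +oo)%E.
Variable p : nat -> nat.
Hypothesis p_cvg : (p n)%:R / ln (n%:R : R) @[n --> \oo] --> beta.
Context {d : nat -> measure_display} {T : forall n, measurableType (d n)}.
Variables (P : forall n, probability (T n) R)
  (X : forall n, 'I_(p n) -> 'I_n -> {RV (P n) >-> R}).
Hypothesis X_law : forall n i j (B : set R), measurable B ->
  distribution (P n) (@X n i j) B = mu B.
Hypothesis X_indep : forall n, mutually_independent
  (fun ij : 'I_(p n) * 'I_n => @X n ij.1 ij.2).

Local Notation data n w := (\matrix_(i, j) @X n i j w).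
Local Notation G := (Gamma_set k beta mu).

(** Typical arrays have this property by [upper_approx], and they have high
    probability by [sum_atypical_array] and [near_union_bound]. *)
Lemma upper_whp (eps : R) : 0 < eps ->
  whp P (fun n w => forall A : 'M[R]_k, wishart_set k (data n w) A ->
    exists2 B, G B & forall a b, `|A a b - B a b| <= eps).
Proof.
move=> eps0; have ib : 0 < beta^-1 by rewrite invr_gt0.
have L1 := exp_mass_ge1 t0_gt0 exp_moment.
pose E1 := energy_bound t0 mu (beta^-1 + 1).
have E10 : 0 < E1 by rewrite divr_gt0// addr_gt0// ?addr_gt0// (lt_le_trans ltr01).
(* E1 is the energy bound for delta = 1, hence an upper bound for all the
   values of delta considered; it allows kap to be chosen before delta. *)
pose kap := Num.min 1 (eps / (8 * (3 + 6 * E1))).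
have K0 : 0 < 8 * (3 + 6 * E1) by lra.
have kap0 : 0 < kap by rewrite lt_min ltr01 divr_gt0.
have kap1 : kap <= 1 by rewrite ge_min lexx.
have kapE : kap * (8 * (3 + 6 * E1)) <= eps.
  by rewrite -ler_pdivlMr// ge_min lexx orbT.
have bE : 0 < 8 * (beta * E1) by apply: mulr_gt0 => //; exact: mulr_gt0.
pose delta := Num.min 1 (eps / (8 * (beta * E1))).
have d0 : 0 < delta by rewrite lt_min ltr01 divr_gt0.
have d1 : delta <= 1 by rewrite ge_min lexx.
have dE : delta * (8 * (beta * E1)) <= eps.
  by rewrite -ler_pdivlMr// ge_min lexx orbT.
pose r := beta^-1 + delta.
pose E := energy_bound t0 mu r.
have r0 : 0 < r by rewrite addr_gt0.
have E0 : 0 < E by rewrite divr_gt0// addr_gt0// (lt_le_trans ltr01).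
have EE : E <= E1 by rewrite ler_pM2r ?invr_gt0// lerD2r lerD2l.
have err : upper_error beta t0 mu kap delta <= eps.
  rewrite /upper_error -/r -/E.
  have -> : 1 - beta^-1 / r = delta / r.
    rewrite -[X in X - _](@divff _ r) ?gt_eqF// -mulrBl; congr (_ / r).
    by rewrite /r addrC addKr.
  have h1 : kap * (3 + 6 * E) <= kap * (3 + 6 * E1) by rewrite ler_pM2l//; lra.
  have h2 : delta / r * E <= delta * (beta * E1).
    have rb : r^-1 <= beta.
      by rewrite -[leRHS]invrK lef_pV2 ?posrE// lerDl; exact: ltW.
    rewrite -mulrA ler_pM2l//; apply: ler_pM => //; last exact: ltW.
    by rewrite invr_ge0; exact: ltW.
  rewrite -mulrA; move: h1 h2 kapE dE; lra.
pose m n := grid_size p kap E n.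
pose cl n := @grid_cell R kap (m n).
pose mcl n := @measurable_grid_cell R kap (m n) kap0.
pose Z n w := cell_array (fun ij : 'I_(p n) * 'I_n => @X n ij.1 ij.2) (cl n) w.
apply: (@whp_intro _ _ _ P _ (fun n => [set w | atypical_array mu (cl n) k r (Z n w)])).
- by move=> n; exact: (measurable_array _ (mcl n)).
- move=> eta eta0; near=> n.
  rewrite (prob_array (@X_indep n) (fun ij => @X_law n ij.1 ij.2) (mcl n)) lee_fin.
  have p0 : (0 < p n)%N.
    by rewrite -(ltr0n R) (lt_le_trans ltr01)//; near: n; exact: near_p_ge p_cvg _.
  apply: le_trans (sum_atypical_array (@X_indep n) (fun ij => @X_law n ij.1 ij.2) (mcl n) k r p0) _.
  rewrite card_prod card_bool card_ord.
  near: n; exact: near_union_bound.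
near=> n => w /negP tw A [S [cardS ->]].
have p0 : (0 < p n)%N.
  by rewrite -(ltr0n R) (lt_le_trans ltr01)//; near: n; exact: near_p_ge p_cvg _.
pose s j := enum_val (cast_ord (esym cardS) j).
have s_inj : injective s by move=> i j /enum_val_inj/cast_ord_inj.
have pE := @grid_size_radius R p kap E n kap0 E0.
have [B GB near_B] := upper_approx k_gt0 beta_gt0 t0_gt0 exp_moment kap0 kap1 d0
  p0 pE s_inj tw.
exists B => // a b; rewrite wishart_entry; apply: le_trans err.
by under eq_bigr do rewrite !mxE; exact: near_B.
Unshelve. all: by end_near.
Qed.

(** When the weighted number of good block selections is not zero, some
    selection has frequencies close to the discrete target. *)
Lemma lower_whp nu (eps : R) : dual_M beta mu nu -> 0 < eps ->
  whp P (fun n w => exists2 A : 'M[R]_k, wishart_set k (data n w) A &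
    forall a b, `|A a b - second_moment_mx nu a b| <= eps).
Proof.
move=> nuM eps0.
have [kap [m [q [e [kap0 [e0 q0 q1 qdom qent] qapp]]]]] :=
  lower_target beta_gt0 t0_gt0 exp_moment nuM eps0.
pose cl := @grid_cell R kap m.
pose mcl := @measurable_grid_cell R kap m kap0.
pose pi := cell_weight cl mu.
pose M n := (n %/ k)%N.
have kM n : (k * M n <= n)%N by rewrite mulnC leq_trunc_div.
pose Z n w := cell_array (fun ij : 'I_(p n) * 'I_n => @X n ij.1 ij.2) cl w.
pose Y n (s : {ffun 'I_k -> 'I_(M n)}) (z : {ffun 'I_(p n) * 'I_n -> bool * 'I_m.+1}) :=
  column_cells (block_column (kM n) s) z.
pose none n : pred {ffun 'I_(p n) * 'I_n -> bool * 'I_m.+1} :=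
  fun z => [forall s : {ffun 'I_k -> 'I_(M n)}, tilted_indicator pi q e (Y n s z) == 0].
apply: (@whp_intro _ _ _ P _ (fun n => [set w | none n (Z n w)])).
- by move=> n; exact: (measurable_array _ mcl).
- move=> eta eta0; have eta4 : 0 < eta / 4 by rewrite divr_gt0.
  near=> n.
  rewrite (prob_array (@X_indep n) (fun ij => @X_law n ij.1 ij.2) mcl) lee_fin.
  have p0 : (0 < p n)%N.
    by rewrite -(ltr0n R) (lt_le_trans ltr01)//; near: n; exact: near_p_ge p_cvg _.
  have M0 : (0 < M n)%N.
    by rewrite divn_gt0//; near: n; exact: nbhs_infty_ge.
  have pi0 c : 0 <= pi c by exact: cell_weight_ge0.
  pose K : R := #|{ffun 'I_k -> bool * 'I_m.+1}|%:R.
  have th2 : 2^-1 <= typical_mass (p n) q e.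
    (* For large p, at least half of the mass of q lies on typical sequences. *)
    apply: le_trans (sum_freq_close p0 q0 q1 e0).
    have p1 : 0 < (p n)%:R :> R by rewrite ltr0n.
    have hK : K * 2 / e ^+ 2 <= (p n)%:R by near: n; exact: near_p_ge p_cvg _.
    have : K / ((p n)%:R * e ^+ 2) <= 2^-1.
      rewrite ler_pdivrMr ?mulr_gt0 ?exprn_gt0//.
      by move: hK; rewrite ler_pdivrMr ?exprn_gt0//; lra.
    by rewrite /K; lra.
  have th0 : 0 < typical_mass (p n) q e by apply: lt_le_trans th2; rewrite invr_gt0.
  have plaw := block_pair_law (@X_indep n) (fun ij => @X_law n ij.1 ij.2) mcl (kM n).
  apply: le_trans (no_typical_selection p0 pi0 q0 q1 qdom M0
    (array_weight_ge0 mu cl) (array_weight_sum1 _ mu mcl) plaw th0) _.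
  rewrite ler_pdivrMr ?exprn_gt0//.
  apply: (@le_trans _ _ (eta / 4)).
    near: n; exact: (near_overlap_bound beta_gt0 p_cvg k_gt0 eta4 qent).
  have : 4^-1 <= typical_mass (p n) q e ^+ 2.
    rewrite (_ : 4^-1 = 2^-1 ^+ 2); last by field.
    by rewrite lerXn2r ?nnegrE// ltW.
  by move=> h; rewrite ler_pM2l.
near=> n => w /negP; rewrite negb_forall => /existsP[s ts].
have p0 : (0 < p n)%N.
  by rewrite -(ltr0n R) (lt_le_trans ltr01)//; near: n; exact: near_p_ge p_cvg _.
have [fs qs] := tilted_indicator_neq0 q0 ts.
have near_A := qapp _ _ _ _ p0 fs qs.
have inc : {homo block_column (kM n) s : i j / (i < j)%N}.
  move=> i j ij /=; apply: (@leq_trans (i.+1 * M n)).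
    by rewrite mulSn addnC ltn_add2r.
  by apply: leq_trans (leq_addr _ _); rewrite leq_mul2r ij orbT.
have [S [cardS sE]] := increasing_selection inc.
exists (((p n)%:R^-1 : R) *: ((column_submx (data n w) cardS)^T *m column_submx (data n w) cardS)).
  by exists S, cardS.
move=> a b; rewrite wishart_entry !sE.
by under eq_bigr do rewrite !mxE; exact: near_A.
Unshelve. all: by end_near.
Qed.

End events.

(** * Measurability of the Hausdorff distance *)

Section countable_suprema.
Context {d : measure_display} {T : measurableType d} {R : realType}.

Lemma measurable_countable_sup (I : countType) (f : I -> T -> \bar R) :
  (forall i, measurable_fun setT (f i)) ->
  measurable_fun setT (fun w => ereal_sup [set f i w | i in setT]).
Proof.
move=> mf mD; apply: (measurability _ (ErealGenOInfty.measurableE R)) => //.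
move=> _ [_ [r ->] <-]; rewrite setTI.
rewrite (_ : _ @^-1` _ = \bigcup_(i : I) (f i @^-1` `]r%:E, +oo[%classic)).
  apply: countable_bigcupT_measurable => // i.
  by rewrite -[X in measurable X]setTI; apply: mf => //; exact: emeasurable_itv.
apply/seteqP; split => [w/=|w [i _]/=]; rewrite !in_itv/= !andbT.
  by move=> /ereal_sup_gt[_ [i _ <-] ri]; exists i => //=; rewrite in_itv/= andbT.
by move=> ri; apply: lt_le_trans ri _; apply: ereal_sup_ubound; exists i.
Qed.

Lemma measurable_countable_inf (I : countType) (f : I -> T -> \bar R) :
  (forall i, measurable_fun setT (f i)) ->
  measurable_fun setT (fun w => ereal_inf [set f i w | i in setT]).
Proof.
move=> mf; rewrite (_ : (fun _ => _) =
    fun w => - ereal_sup [set - f i w | i in setT])%E.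
  apply: measurableT_comp => //; apply: measurable_countable_sup => i.
  exact: measurableT_comp.
apply/funext => w; rewrite ereal_infEN; congr (- ereal_sup _)%E.
by rewrite image_comp.
Qed.

End countable_suprema.

Section hausdorff_measurable.
Context {R : realType}.
Variable k : nat.
Implicit Types A B : 'M[R]_k.
Local Notation dist := (@frobenius_distance R k).

Definition dense_sequence (G : set 'M[R]_k) (u : nat -> 'M[R]_k) :=
  (forall n, G (u n)) /\ forall A, G A -> forall e : R, 0 < e -> exists n, dist A (u n) < e.

Lemma dense_sequence_exists (G : set 'M[R]_k) A0 : G A0 -> totally_bounded dist G ->
  exists u, dense_sequence G u.
Proof.
move=> GA0 Gtb.
have h (i : nat) : {s : seq 'M[R]_k | [set` s] `<=` G /\
    forall A, G A -> exists2 B, B \in s & dist A B < i.+1%:R^-1}.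
  by apply: cid; apply: Gtb; rewrite invr_gt0.
pose u n := if unpickle n is Some (i, j) then nth A0 (sval (h i)) j else A0.
exists u; split=> [n|A GA e e0].
  rewrite /u; case: unpickle => // -[i j]; have [hG _] := svalP (h i).
  by have [js|js] := ltnP j (size (sval (h i)));
    [apply: hG; exact: mem_nth|rewrite nth_default].
have [i ie] : exists i : nat, i.+1%:R^-1 < e.
  exists (Num.truncn e^-1); rewrite -[ltRHS]invrK ltf_pV2 ?posrE ?invr_gt0//.
  by rewrite truncnS_gt// ltW// invr_gt0.
have [_ /(_ _ GA)[B Bs AB]] := svalP (h i).
exists (pickle (i, index B (sval (h i)))).
by rewrite /u pickleK nth_index//; exact: lt_trans ie.
Qed.

Section dense.
Variables (G : set 'M[R]_k) (u : nat -> 'M[R]_k).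
Hypothesis Gu : dense_sequence G u.

Lemma dense_inf A :
  ereal_inf [set (dist A B)%:E | B in G] = ereal_inf [set (dist A (u n))%:E | n in setT].
Proof.
apply/eqP; rewrite eq_le; apply/andP; split.
  by apply: ereal_inf_le_tmp => _ [n _ <-]; exists (u n) => //; exact: Gu.1.
apply: le_ereal_inf_tmp => _ [B GB <-]; apply/lee_addgt0Pr => e e0.
have [n Bn] := Gu.2 B GB e e0.
apply: (@le_trans _ _ (dist A (u n))%:E); first by apply: ereal_inf_lbound; exists n.
by rewrite -EFinD lee_fin (le_trans (frobenius_triangle _ B _))// lerD2l ltW.
Qed.

(** The infimum over [W] is a nonexpansive function of [B], so its supremum is
    not changed by passing to a dense subset. This holds also when [W] is
    empty and the infimum is infinite. *)
Lemma dense_sup (W : set 'M[R]_k) :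
  ereal_sup [set ereal_inf [set (dist A B)%:E | A in W] | B in G] =
  ereal_sup [set ereal_inf [set (dist A (u n))%:E | A in W] | n in setT].
Proof.
apply/eqP; rewrite eq_le; apply/andP; split; last first.
  by apply: ereal_sup_le => _ [n _ <-]; exists (u n) => //; exact: Gu.1.
apply: ge_ereal_sup => _ [B GB <-]; apply/lee_addgt0Pr => e e0.
have [n Bn] := Gu.2 B GB e e0.
apply: (@le_trans _ _ (ereal_inf [set (dist A (u n))%:E | A in W] + e%:E))%E; last first.
  by rewrite leeD2r//; apply: ereal_sup_ubound; exists n.
rewrite -leeBlDr//; apply: le_ereal_inf_tmp => _ [A WA <-]; rewrite leeBlDr//.
apply: (@le_trans _ _ (dist A B)%:E); first by apply: ereal_inf_lbound; exists A.
rewrite -EFinD lee_fin (le_trans (frobenius_triangle _ (u n) _))// lerD2l.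
by rewrite frobenius_sym ltW.
Qed.

End dense.

Lemma measurable_hausdorff (d : measure_display) (T : measurableType d) (I : countType)
    (F : I -> T -> 'M[R]_k) (G : set 'M[R]_k) A0 :
  (forall i a b, measurable_fun setT (fun w => F i w a b)) ->
  G A0 -> totally_bounded dist G ->
  measurable_fun setT (fun w => hausdorff_distance dist [set F i w | i in setT] G).
Proof.
move=> mF GA0 /(dense_sequence_exists GA0)[u Gu].
have mdist i B : measurable_fun setT (fun w => (dist (F i w) B)%:E).
  have msqrt : measurable_fun setT (@Num.sqrt R).
    by apply: continuous_measurable_fun; exact: sqrt_continuous.
  apply/measurable_EFinP; apply: (measurableT_comp msqrt).
  apply: measurable_sum => a; apply: measurable_sum => b.
  by apply: measurable_funX; apply: measurable_funB => //; exact: mF.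
rewrite (_ : (fun _ => _) = fun w => Order.max
    (ereal_sup [set ereal_inf [set (dist (F i w) (u n))%:E | n in setT] | i in setT])
    (ereal_sup [set ereal_inf [set (dist (F i w) (u n))%:E | i in setT] | n in setT])).
  apply: measurable_maxe; apply: measurable_countable_sup => i;
  by apply: measurable_countable_inf => j; exact: mdist.
apply/funext => w; rewrite /hausdorff_distance (dense_sup Gu); congr Order.max.
  rewrite image_comp; congr ereal_sup; apply: eq_imagel => i _ /=; exact: dense_inf.
congr ereal_sup; apply: eq_imagel => n _; by rewrite image_comp.
Qed.

End hausdorff_measurable.

(** * Convergence in probability *)

Section hausdorff_bounds.
Context {R : realType} {M : eqType} (dist : M -> M -> R).

Lemma hausdorff_le (A B : set M) (e : R) :
  (forall x, A x -> exists2 y, B y & dist x y <= e) ->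
  (forall y, B y -> exists2 x, A x & dist x y <= e) ->
  (hausdorff_distance dist A B <= e%:E)%E.
Proof.
move=> AB BA; rewrite /hausdorff_distance ge_max; apply/andP; split;
    apply: ge_ereal_sup => _ [x xin <-].
  have [y By xy] := AB _ xin; apply: ge_ereal_inf; exists (dist x y)%:E => //.
  by exists y.
have [y By xy] := BA _ xin; apply: ge_ereal_inf; exists (dist y x)%:E => //.
by exists y.
Qed.

Lemma hausdorff_ge0 (A B : set M) y : (forall x y, 0 <= dist x y) -> B y ->
  (0 <= hausdorff_distance dist A B)%E.
Proof.
move=> d0 By; rewrite /hausdorff_distance le_max; apply/orP; right.
apply: (@le_trans _ _ (ereal_inf [set (dist x y)%:E | x in A])).
  by apply: le_ereal_inf_tmp => _ [x _ <-]; rewrite lee_fin.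
by apply: ereal_sup_ubound; exists y.
Qed.

End hausdorff_bounds.

Lemma frobenius_ge0 (R : realType) k (A B : 'M[R]_k) : 0 <= frobenius_distance A B.
Proof. exact: sqrtr_ge0. Qed.

Section convergence.
Context {R : realType}.
Variables (k : nat) (beta t0 : R) (mu : probability R R).
Hypothesis k_gt0 : (0 < k)%N.
Hypothesis beta_gt0 : 0 < beta.
Hypothesis t0_gt0 : 0 < t0.
Hypothesis exp_moment : (\int[mu]_x (expR (t0 * x ^+ 2))%:E < +oo)%E.

Local Notation G := (Gamma_set k beta mu).
Local Notation dist := (@frobenius_distance R k).

Lemma Gamma_totally_bounded : totally_bounded dist G.
Proof.
apply: (@bounded_totally_bounded _ _ _ (energy_bound t0 mu beta^-1)).
move=> _ [nu /(M_setP _ t0_gt0 exp_moment) nuM <-] i j.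
by apply: second_moment_bound; exact: dual_M_energy nuM.
Qed.

Lemma Gamma_nonempty : G (second_moment_mx (power_probability mu k)).
Proof. by exists (power_probability mu k) => //; apply/(M_setP _ t0_gt0 exp_moment); exact: power_in_M. Qed.

(** The sets of [k] columns form a finite type, which gives the Wishart set as
    a family indexed by a fixed countable type. *)
Lemma measurable_wishart_hausdorff (p n : nat) (d : measure_display)
    (T : measurableType d) (P : probability T R) (X : 'I_p -> 'I_n -> {RV P >-> R}) :
  measurable_fun setT (fun w => hausdorff_distance dist
    (wishart_set k (\matrix_(i, j) X i j w)) G).
Proof.
pose I := {S : {set 'I_n} | #|S| == k}.
pose F (S : I) w : 'M[R]_k := (p%:R^-1 : R) *:
  ((column_submx (\matrix_(i, j) X i j w) (eqP (valP S)))^T *m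
    column_submx (\matrix_(i, j) X i j w) (eqP (valP S))).
have -> : (fun w => hausdorff_distance dist (wishart_set k (\matrix_(i, j) X i j w)) G) =
    fun w => hausdorff_distance dist [set F S w | S in setT] G.
  apply/funext => w; congr hausdorff_distance; apply/seteqP; split.
    move=> _ [S [cardS ->]]; have cS : #|S| == k by rewrite cardS.
    exists (exist _ S cS) => //; rewrite /F /=.
    by rewrite (eq_irrelevance cardS (eqP (valP (exist _ S cS : I)))).
  by move=> _ [S _ <-]; exists (val S), (eqP (valP S)).
apply: (measurable_hausdorff _ Gamma_nonempty Gamma_totally_bounded) => S a b.
rewrite /F; under eq_fun do rewrite wishart_entry.
apply: measurable_funM => //; apply: measurable_sum => i.
by under eq_fun do rewrite !mxE; exact: measurable_funM.
Qed.

Variable p : nat -> nat.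
Hypothesis p_cvg : (p n)%:R / ln (n%:R : R) @[n --> \oo] --> beta.
Context {d : nat -> measure_display} {T : forall n, measurableType (d n)}.
Variables (P : forall n, probability (T n) R)
  (X : forall n, 'I_(p n) -> 'I_n -> {RV (P n) >-> R}).
Hypothesis X_law : forall n i j (B : set R), measurable B ->
  distribution (P n) (@X n i j) B = mu B.
Hypothesis X_indep : forall n, mutually_independent
  (fun ij : 'I_(p n) * 'I_n => @X n ij.1 ij.2).

Local Notation data n w := (\matrix_(i, j) @X n i j w).

(** The lower bound holds for one point of [Gamma] at a time; a finite net of
    radius [e / 2] makes it uniform. *)
Lemma hausdorff_whp (e : R) : 0 < e ->
  whp P (fun n w => (hausdorff_distance dist (wishart_set k (data n w)) G <= e%:E)%E).
Proof.
move=> e0; have k0 : 0 < k%:R :> R by rewrite ltr0n.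
pose eps := e / 2 / k%:R.
have eps0 : 0 < eps by rewrite !divr_gt0.
have keps : k%:R * eps = e / 2 by rewrite mulrC divfK// gt_eqF.
have e2 : 0 < e / 2 by rewrite divr_gt0.
have [s [sG net]] := Gamma_totally_bounded e2.
have upper := upper_whp k_gt0 beta_gt0 t0_gt0 exp_moment p_cvg X_law X_indep eps0.
have lower : whp P (fun n w => forall B, B \in s ->
    exists2 A, wishart_set k (data n w) A & forall a b, `|A a b - B a b| <= eps).
  apply: whp_all => B /sG[nu /(M_setP _ t0_gt0 exp_moment) nuM <-].
  exact: (lower_whp k_gt0 beta_gt0 t0_gt0 exp_moment p_cvg X_law X_indep nuM eps0).
have [B [mB PB BG]] := whp_and upper lower.
exists B; split => // n w /BG[up low]; apply: hausdorff_le => A.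
  move=> /up[C GC AC]; exists C => //.
  have := frobenius_le (ltW eps0) AC; rewrite keps; lra.
move=> /net[C Cs AC]; have [D WD DC] := low _ Cs; exists D => //.
have := frobenius_le (ltW eps0) DC; rewrite keps.
have := frobenius_triangle D C A; rewrite (frobenius_sym C A); lra.
Qed.

Lemma hausdorff_cvg : cvg_in_probability P (fun n w =>
  hausdorff_distance dist (wishart_set k (data n w)) G) 0.
Proof.
split=> [n|e e0]; first exact: measurable_wishart_hausdorff.
have [B [mB PB BG]] := hausdorff_whp e0.
apply: (@squeeze_cvge _ _ _ _ (cst 0%E) _ (fun n => P n (B n))) => //; last first.
  exact: cvg_cst.
apply: nearW => n; rewrite measure_ge0/=.
have Y0 w : (0 <= hausdorff_distance dist (wishart_set k (data n w)) G)%E.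
  by apply: hausdorff_ge0 Gamma_nonempty => A C; exact: frobenius_ge0.
under [X in P n X]eq_set do rewrite sube0 gee0_abs//.
apply: le_measure; rewrite ?inE//.
  rewrite -[X in measurable X]setTI.
  by apply: emeasurable_fun_o_infty => //; exact: measurable_wishart_hausdorff.
by move=> w; apply: contraPP => /BG /= h; apply/negP; rewrite -leNgt.
Qed.

End convergence.

Unset Implicit Arguments.

Theorem theorem6 (R : realType) (k : nat) (k_ge1 : (1 <= k)%N)
  (d0 : measure_display) (T0 : measurableType d0) (P0 : probability T0 R)
  (xi : {RV P0 >-> R})
  (xi_mean : ('E_P0[xi] = 0)%E)
  (xi_var : ('E_P0[(fun w => xi w ^+ 2)%R] = 1)%E)
  (xi_exp : exists2 t0 : R, 0 < t0 &
    ('E_P0[(fun w => expR (t0 * xi w ^+ 2))%R] < +oo)%E)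
  (p : nat -> nat) (beta : R) (beta_gt0 : 0 < beta)
  (p_cvg : (p n)%:R / ln (n%:R : R) @[n --> \oo] --> beta)
  (d : nat -> measure_display) (T : forall n, measurableType (d n))
  (P : forall n, probability (T n) R)
  (X : forall n, 'I_(p n) -> 'I_n -> {RV (P n) >-> R})
  (X_law : forall n i j (B : set R), measurable B ->
    distribution (P n) (X n i j) B = distribution P0 xi B)
  (X_indep : forall n, mutually_independent
    (fun ij : 'I_(p n) * 'I_n => X n ij.1 ij.2)) :
  (totally_bounded (@frobenius_distance R k)
      (Gamma_set k beta (distribution P0 xi)) /\
   convex_set (Gamma_set k beta (distribution P0 xi))) /\
  cvg_in_probability P
    (fun n w => hausdorff_distance (@frobenius_distance R k)
      (wishart_set k (\matrix_(i, j) X n i j w))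
      (Gamma_set k beta (distribution P0 xi))) 0.
Proof.
have [t0 t0_gt0 moment] := xi_exp; pose mu := distribution P0 xi.
have mexp : (\int[mu]_x (expR (t0 * x ^+ 2))%:E < +oo)%E.
  rewrite ge0_integral_distribution.
  - move: moment; rewrite unlock; exact.
  - apply/measurable_EFinP; apply: measurableT_comp => //.
    by apply: measurable_funM => //; apply: measurable_funX.
  - by move=> y; rewrite lee_fin expR_ge0.
split; last exact: (hausdorff_cvg k_ge1 beta_gt0 t0_gt0 mexp p_cvg X_law X_indep).
by split; [apply: Gamma_totally_bounded t0_gt0 mexp|apply: Gamma_convex t0_gt0 mexp].
Qed.
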